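(* Assume that $L$ satisfies the strong trace condition. Then for any $v_0\in L_{\mathbf K}(\Omega;\mathbb R^n)$ there exists a maximizer $(E,B)$ of the dual problem (D) in the class $L_{\mathbf K^*}((0,T)\times\Omega;\mathbb R^n)\times L^\infty((0,T)\times\Omega;\mathbb R^{N\times N}_s)$, and $$0\le\frac{\mathfrak H(0)\,|\Omega|\operatorname{Tr}\mathbf F(0)}2\le\tilde{\mathcal J}(v_0,T)<+\infty .$$
   Context: **Spaces and matrices.** $\Omega=\mathbb T^d$ is the periodic box with Lebesgue measure, $(u,w)=\int_\Omega u\cdot w\,dx$ (for matrix fields, the Frobenius product $A:B$ is used). $\mathbb R^{N\times N}_s$ and $\mathbb R^{N\times N}_+$ are the symmetric and the nonnegative-definite matrices; $A\succeq B$ means $A-B\in\mathbb R^{N\times N}_+$. $I$ is the identity matrix. A Young function is a convex even $\Phi:\mathbb R\to\mathbb R_+$ with $\Phi(s)=0$ iff $s=0$, $\Phi(s)/s\to0$ as $s\to0$ and $\Phi(s)/s\to+\infty$ as $s\to+\infty$. An $N$-function is a convex even $\mathbf K:\mathbb R^n\to\mathbb R_+$ such that $\Phi_-(|y|)\le\mathbf K(y)\le\Phi_+(|y|)$ for some Young functions $\Phi_\pm$. It satisfies the $\Delta_2$-condition if $\mathbf K(2y)\le C(\mathbf K(y)+1)$ for all $y$. $\mathbf K^*$ is the Legendre transform. $L_{\mathbf K}(Q;\mathbb R^n)$ is the anisotropic Orlicz space of measurable $f:Q\to\mathbb R^n$ with $\int_Q\mathbf K(f)\,dx<\infty$ (a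 Banach space with the Luxemburg norm; its dual is $L_{\mathbf K^*}$). **Data and standing assumptions.** $\mathbf F:\mathbb R^n\to\mathbb R^{N\times N}_s$ is $C^2$; $L$ is a linear differential operator with constant coefficients mapping $\mathbb R^{N\times N}_s$-valued functions on $\Omega$ to $\mathbb R^n$-valued functions, and $L^*$ is its adjoint, with values in $\mathbb R^{N\times N}_s$. It is assumed that: 1. (Entropy) $\mathbf K(v):=\frac12\operatorname{Tr}(\mathbf F(v)-\mathbf F(0))$ is strictly convex, is an $N$-function, and $\mathbf K,\mathbf K^*$ satisfy $\Delta_2$. Write $v^{\#}:=\nabla\mathbf K(v)$, so that $v=\nabla\mathbf K^*(v^{\#})$. 2. ($\Lambda$-convexity) Let $\Lambda\subset\mathbb R^{N\times N}_s$ be the smallest linear subspace containing $I$ and all values $L^*u(x)$, $u:\Omega\to\mathbb R^n$ smooth, $x\in\Omega$. For every $P\in\Lambda\cap\mathbb R^{N\times N}_+$ the function $\mathbf F:P$ is convex. 3. ($\Lambda$-order) Let $\mathbb R^{N\times N}_\Lambda=\{\Xi\in\mathbb R^{N\times N}_s:\ \Xi:P\ge0\ \forall P\in\Lambda\cap\mathbb R^{N\times N}_+\}$ and write $B\le A$ when $A-B\in\mathbb R^{N\times N}_\Lambda$. Then $\mathbf F(\mathbb R^n)\subset\mathbb R^{N\times N}_\Lambda$, and, with $\pi_\Lambda$ the orthogonal projection onto $\Lambda$, $|\pi_\Lambda\partial_l\mathbf F(v)|\le C(|\nabla\mathbf K(v)|+1)$ for all $v\in\mathbb R^n$, $l=1,\dots,n$.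 4. (Conservativity) $(\mathbf F(v),L^*(v^{\#}))=0$ whenever $v^{\#}:\Omega\to\mathbb R^n$ is smooth and $v=\nabla\mathbf K^*(v^{\#})$. **Weight.** $\mathfrak h$ is a fixed positive scalar function on $[0,T]$ bounded away from $0$ and $\infty$; $\mathfrak H(t)=\int_t^T\mathfrak h(s)\,ds$. **Strong trace condition.** There is a uniform constant $c$ such that for any $\zeta\in D(L^* )$ for which the eigenvalues of $-L^*\zeta(x)$ are bounded from above by a constant $k$ for a.e. $x\in\Omega$, the eigenvalues of $L^*\zeta(x)$ are bounded from above by $ck$ for a.e. $x\in\Omega$. Here $D(L^* )$ is the domain of $L^*$: the functions $\zeta\in L_{\mathbf K^*}(\Omega;\mathbb R^n)$ for which the distributional $L^*\zeta$ is an integrable matrix function. **Dual problem.** Constraint (C) on $(E,B)\in L_{\mathbf K^*}((0,T)\times\Omega;\mathbb R^n)\times L^\infty((0,T)\times\Omega;\mathbb R^{N\times N}_s)$: $\int_0^T[(B,\partial_t\Psi)+(E,L\Psi)]\,dt=0$ for all smooth $\Psi:[0,T]\times\Omega\to\mathbb R^{N\times N}_s$ with $\Psi(0)=0$ (weak form of $\partial_tB=L^*E$, $B(T)=0$). Let $$\mathcal K(E,B)=\inf_{\mathbf F(z)\le M}\int_0^T\big[(z,E)+\tfrac12(M,\mathfrak hI+2B)\big]dt,$$ the infimum over $(z,M)\in L_{\mathbf K}((0,T)\times\Omega;\mathbb R^n)\times L^1((0,T)\times\Omega;\mathbb R^{N\times N}_s)$ with $\mathbf F(z)\le M$ a.e.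 in the $\Lambda$-order. The dual problem is $$\text{(D)}\qquad\tilde{\mathcal J}(v_0,T)=\sup\Big\{-\int_0^T(v_0,E)\,dt+\mathcal K(E,B)\Big\},$$ the supremum being over pairs $(E,B)\in L_{\mathbf K^*}((0,T)\times\Omega;\mathbb R^n)\times L^\infty((0,T)\times\Omega;\mathbb R^{N\times N}_s)$ satisfying (C) and $\mathfrak hI+2B\succeq0$ a.e. in $(0,T)\times\Omega$. *)

(* Defs.v *)
From HB Require Import structures.
From mathcomp Require Import all_boot all_order all_algebra.
From mathcomp Require Import all_classical all_reals all_analysis.
Set Implicit Arguments.
Unset Strict Implicit.
Unset Printing Implicit Defensive.
Import Order.TTheory GRing.Theory Num.Theory.
Import numFieldNormedType.Exports.
Local Open Scope classical_set_scope.
Local Open Scope ring_scope.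

(* The sigma-algebra generated by the entries; over R it is the Borel one.    *)
Definition measure_mx_display : measure_display -> measure_display.
Proof. exact. Qed.

Section measurable_matrix.
Context {d} {T : measurableType d} {m n : nat}.

Definition mx_entry_sets : set (set 'M[T]_(m, n)) :=
  [set A | exists i j,
     preimage_set_system setT (fun M : 'M[T]_(m, n) => M i j) measurable A].

Definition mx_measurable : set (set 'M[T]_(m, n)) := <<s mx_entry_sets >>.

Let mx_measurable0 : mx_measurable set0.
Proof. exact: sigma_algebra0. Qed.

Let mx_measurableC A : mx_measurable A -> mx_measurable (~` A).
Proof. exact: sigma_algebraC. Qed.

Let mx_measurable_bigcup (F : (set 'M[T]_(m, n))^nat) :
  (forall i, mx_measurable (F i)) -> mx_measurable (\bigcup_i (F i)).
Proof. exact: sigma_algebra_bigcup. Qed.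

HB.instance Definition _ := @isMeasurable.Build (measure_mx_display d)
  'M[T]_(m, n) mx_measurable mx_measurable0 mx_measurableC mx_measurable_bigcup.

End measurable_matrix.

Lemma measurable_entry d (T : measurableType d) m n (i : 'I_m) (j : 'I_n) :
  measurable_fun setT (fun M : 'M[T]_(m, n) => M i j).
Proof.
by move=> _ Y mY; apply: sub_sigma_algebra; exists i, j, Y.
Qed.

Lemma measurable_fun_mxP d1 d2 (T1 : measurableType d1) (T2 : measurableType d2)
    m n (f : T1 -> 'M[T2]_(m, n)) :
  measurable_fun setT f <->
  (forall i j, measurable_fun setT (fun x => f x i j)).
Proof.
split=> [mf i j|mf].
  apply: (measurableT_comp (f := fun M : 'M[T2]_(m, n) => M i j)) => //.
  exact: measurable_entry.
apply: (@measurability _ _ _ _ setT f (@mx_entry_sets _ T2 m n)) => //.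
move=> _ [_ [i [j [Y mY <-]]] <-]; rewrite !setTI.
by rewrite -[X in measurable X]setTI; exact: (mf i j).
Qed.


Section torus_measure.
Context {R : realType}.

Lemma lebesgue_oitv_lty (a : R) :
  (@lebesgue_measure R `]0%R, a[%classic < +oo)%E.
Proof. by rewrite lebesgue_measure_itv /=; case: ifP; rewrite ?ltry. Qed.

(* Lebesgue measure of R restricted to the interval ]0, a[.                   *)
Definition lebesgue_oitv (a : R) : set (measurableTypeR R) -> \bar R :=
  @mfrestr _ (measurableTypeR R) R `]0%R, a[%classic (@lebesgue_measure R)
    (measurable_itv `]0%R, a[) (lebesgue_oitv_lty a).
HB.instance Definition _ (a : R) := FiniteMeasure.on (lebesgue_oitv a).

(* The product of Lebesgue measure on ]0, a[ with mu.                         *)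
Definition oitv_prod disp (X : measurableType disp)
    (mu : {finite_measure set X -> \bar R}) (a : R) :
    set (measurableTypeR R * X) -> \bar R :=
  (lebesgue_oitv a \x mu)%E.

Section oitv_prod_measure.
Context disp (X : measurableType disp).
Variables (mu : {finite_measure set X -> \bar R}) (a : R).

HB.instance Definition _ := Measure.on (oitv_prod mu a).

Lemma oitv_prod_fin : fin_num_fun (oitv_prod mu a).
Proof.
apply: lty_fin_num_fun.
suff : ((lebesgue_oitv a \x mu) (setT `*` setT) < +oo)%E by rewrite setXTT.
rewrite product_measure1E// lte_mul_pinfty//.
  by rewrite fin_num_measure.
by rewrite ltey_eq fin_num_measure.
Qed.

HB.instance Definition _ := Measure_isFinite.Build _ _ _ (oitv_prod mu a)
  oitv_prod_fin.

End oitv_prod_measure.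

Definition rv_cons d (p : R * 'rV[R]_d) : 'rV[R]_d.+1 :=
  \row_j oapp (p.2 ord0) p.1 (unlift ord0 j).

Lemma measurable_rv_cons d : measurable_fun setT (@rv_cons d).
Proof.
apply/measurable_fun_mxP => i j; rewrite /rv_cons.
under eq_fun do rewrite mxE.
case: unliftP => [k _|_] /=; last exact: measurable_fst.
apply: (measurableT_comp (f := fun M : 'rV[R]_d => M ord0 k)) => //.
exact: measurable_entry.
Qed.

Definition lebesgue_cons d (mu : {finite_measure set 'rV[R]_d -> \bar R})
    (a : R) : set 'rV[R]_d.+1 -> \bar R :=
  pushforward (oitv_prod mu a) (@rv_cons d).

Section lebesgue_cons_measure.
Context d (mu : {finite_measure set 'rV[R]_d -> \bar R}) (a : R).

Let m : {measure set 'rV[R]_d.+1 -> \bar R} :=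
  measure_function_pushforward__canonical__measure_function_Measure
    (oitv_prod mu a) (@measurable_rv_cons d).

Let cons0 : lebesgue_cons mu a set0 = 0%E.
Proof. exact: (measure0 m). Qed.

Let cons_ge0 A : (0 <= lebesgue_cons mu a A)%E.
Proof. exact: (measure_ge0 m). Qed.

Let cons_sigma_additive : semi_sigma_additive (lebesgue_cons mu a).
Proof. exact: (@measure_semi_sigma_additive _ _ _ m). Qed.

HB.instance Definition _ := isMeasure.Build _ _ _ (lebesgue_cons mu a)
  cons0 cons_ge0 cons_sigma_additive.

Lemma lebesgue_cons_fin : fin_num_fun (lebesgue_cons mu a).
Proof.
move=> A mA; apply: (fin_num_measure (oitv_prod mu a)).
by rewrite -[X in measurable X]setTI; exact: measurable_rv_cons.
Qed.

HB.instance Definition _ := Measure_isFinite.Build _ _ _ (lebesgue_cons mu a)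
  lebesgue_cons_fin.

End lebesgue_cons_measure.

(* Functions on the torus of period l are represented on R^d; their integrals *)
(* are taken over the fundamental cell ]0, l[^d (its faces are null sets).    *)
Fixpoint torus_measure (d : nat) (l : R) :
    {finite_measure set 'rV[R]_d -> \bar R} :=
  match d with
  | 0 => \d_(0 : 'rV[R]_0)
  | d'.+1 => lebesgue_cons (torus_measure d' l) l
  end.

Lemma torus_measure_box d (l : R) (A : 'I_d -> set R) :
  (forall i, measurable (A i)) ->
  torus_measure d l [set x | forall i, A i (x ord0 i)] =
    (\prod_(i < d) lebesgue_measure (A i `&` `]0%R, l[%classic))%E.
Proof.
elim: d A => [|d IH] A mA.
  by rewrite big_ord0 /= diracE mem_set//; case.
pose A' i := A (lift ord0 i : 'I_d.+1).
pose C : set 'rV[R]_d := [set x | forall i, A' i (x ord0 i)].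
have mC : measurable C.
  rewrite (_ : C = \bigcap_(i in [set: 'I_d])
      ((fun x : 'rV[R]_d => x ord0 i) @^-1` A' i)); last first.
    by apply/seteqP; split=> [x Ax i _|x Ax i]; [exact: Ax|exact: (Ax i)].
  apply: fin_bigcap_measurable => // i _.
  rewrite -[X in measurable X]setTI.
  by apply: (@measurable_entry _ _ 1 d ord0 i) => //; exact: mA.
have consC : @rv_cons d @^-1` [set x | forall i, A i (x ord0 i)] =
    A ord0 `*` C.
  apply/seteqP; split => -[t x] /=.
    move=> Ax; split.
      by move: (Ax ord0); rewrite /rv_cons mxE unlift_none.
    by move=> i; move: (Ax (lift ord0 i)); rewrite /rv_cons mxE liftK.
  move=> [A0 Ax] i; rewrite /rv_cons mxE.
  by case: unliftP => [k ->|->]; [exact: Ax|exact: A0].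
have mA' i : measurable (A' i) by exact: mA.
rewrite big_ord_recl -(IH A' mA').
transitivity (oitv_prod (torus_measure d l) l
  (@rv_cons d @^-1` [set x | forall i, A i (x ord0 i)])); first by [].
by rewrite consC; apply: product_measure1E => //; exact: mA.
Qed.

Lemma torus_measureT d (l : R) : 0 <= l ->
  torus_measure d l setT = (l ^+ d)%:E.
Proof.
move=> l0; have := @torus_measure_box d l (fun=> setT) (fun=> measurableT).
rewrite (_ : [set x | _] = setT); last by apply/seteqP; split.
move=> ->; rewrite setTI lebesgue_measure_itv/= lte_fin.
rewrite (_ : (if _ then _ else _) = l%:E).
  by rewrite prodEFin prodr_const card_ord.
case: ltP => [_|l0']; first by rewrite sube0.
by congr EFin; apply/eqP; rewrite eq_le l0 l0'.
Qed.

End torus_measure.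

Section inner_product.
Context {R : realType} {m n : nat}.

Definition frob (A B : 'M[R]_(m, n)) : R := \sum_i \sum_j A i j * B i j.

(* Not the library's `|A|, which is the maximum norm.                         *)
Definition frob_norm (A : 'M[R]_(m, n)) : R := Num.sqrt (frob A A).

End inner_product.

Definition symm_mx (R : realType) (N : nat) : set 'M[R]_N :=
  [set A | A^T = A].

Definition psd_mx (R : realType) (N : nat) : set 'M[R]_N :=
  [set A | symm_mx A /\ forall x : 'rV[R]_N, 0 <= (x *m A *m x^T) ord0 ord0].

Section smooth_functions.
Context {R : realType}.

Fixpoint class_C (k : nat) {V W : normedModType R} (f : V -> W) : Prop :=
  match k with
  | 0 => continuous f
  | k'.+1 => continuous f /\
      forall v, (forall x, derivable f x v) /\ class_C k' ('D_v f)
  end.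

Definition smooth {V W : normedModType R} (f : V -> W) :=
  forall k, class_C k f.

Definition partial d (W : normedModType R) (i : 'I_d) (f : 'rV[R]_d -> W) :
    'rV[R]_d -> W :=
  'D_(delta_mx ord0 i) f.

Definition grad n (f : 'rV[R]_n -> R) (v : 'rV[R]_n) : 'rV[R]_n :=
  \row_i partial i f v.

Definition torus_periodic d (l : R) (T : Type) (f : 'rV[R]_d -> T) :=
  forall i x, f (x + l *: delta_mx ord0 i) = f x.

Definition multi_deriv d q (W : normedModType R) (al : {ffun 'I_d -> 'I_q.+1})
    (f : 'rV[R]_d -> W) : 'rV[R]_d -> W :=
  foldr (fun i g => iter (al i) (partial i) g) f (enum 'I_d).

End smooth_functions.

Section differential_operator.
Context {R : realType} {d n N : nat}.

(* (L Psi)_j = \sum_al a_(al, j) : D^al Psi; the multi-indices have all their *)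
(* entries at most op_order. Linear maps from symmetric matrices to R^n are   *)
(* exactly the maps S |-> (a_j : S)_j with symmetric a_j.                     *)
Record diff_operator := DiffOperator {
  op_order : nat ;
  op_coef : {ffun 'I_d -> 'I_op_order.+1} -> 'I_n -> 'M[R]_N ;
  op_coef_symm : forall al j, symm_mx (op_coef al j) }.
Arguments op_coef : clear implicits.

Definition op_apply (L : diff_operator) (Psi : 'rV[R]_d -> 'M[R]_N)
    (x : 'rV[R]_d) : 'rV[R]_n :=
  \row_j \sum_(al : {ffun 'I_d -> 'I_(op_order L).+1})
    frob (op_coef L al j) (multi_deriv al Psi x).

Definition op_adjoint (L : diff_operator) (u : 'rV[R]_d -> 'rV[R]_n)
    (x : 'rV[R]_d) : 'M[R]_N :=
  \sum_(al : {ffun 'I_d -> 'I_(op_order L).+1})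
    (-1) ^+ (\sum_i al i)%N *:
      \sum_j multi_deriv al u x ord0 j *: op_coef L al j.

End differential_operator.
Arguments diff_operator : clear implicits.

Section n_functions.
Context {R : realType}.

Definition young_function (Phi : R -> R) :=
  [/\ convex_function setT Phi,
      (forall s, Phi (- s) = Phi s),
      (forall s, 0 <= Phi s /\ (Phi s = 0 <-> s = 0)),
      Phi s / s @[s --> 0^'] --> 0 &
      Phi s / s @[s --> +oo] --> +oo].

Definition N_function n (K : 'rV[R]_n -> R) :=
  [/\ convex_function setT K,
      (forall y, K (- y) = K y),
      (forall y, 0 <= K y) &
      exists Phi1 Phi2, [/\ young_function Phi1, young_function Phi2 &
        forall y, Phi1 (frob_norm y) <= K y <= Phi2 (frob_norm y)]].

Definition Delta2 n (K : 'rV[R]_n -> R) :=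
  exists C, forall y, K (2 *: y) <= C * (K y + 1).

Definition strictly_convex n (K : 'rV[R]_n -> R) :=
  forall x y t, x != y -> 0 < t -> t < 1 ->
    K (t *: x + (1 - t) *: y) < t * K x + (1 - t) * K y.

(* The supremum is over a bounded set, hence genuine, when K is an            *)
(* N-function (superlinear growth).                                           *)
Definition legendre n (K : 'rV[R]_n -> R) (w : 'rV[R]_n) : R :=
  sup [set frob v w - K v | v in [set: 'rV[R]_n]].

Definition orlicz disp (X : measurableType disp)
    (mu : {measure set X -> \bar R}) n (K : 'rV[R]_n -> R)
    (f : X -> 'rV[R]_n) :=
  measurable_fun setT f /\ (\int[mu]_x (K (f x))%:E < +oo)%E.

Definition Lp_symm disp (X : measurableType disp)
    (mu : {measure set X -> \bar R}) (p : \bar R) N (B : X -> 'M[R]_N) :=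
  (forall x, symm_mx (B x)) /\
  forall i j, (fun x => B x i j) \in Lfun mu p.

End n_functions.

Section structure.
Context {R : realType} {d n N : nat}.
Variables (l : R) (F : 'rV[R]_n -> 'M[R]_N) (L : diff_operator R d n N).

Definition Kfun (v : 'rV[R]_n) : R := \tr (F v - F 0) / 2.

Definition entropy_assumption :=
  [/\ strictly_convex Kfun, N_function Kfun,
      Delta2 Kfun & Delta2 (legendre Kfun)].

Definition Lambda : set 'M[R]_N :=
  [set A | forall W : {vspace 'M[R]_N}, 1%:M \in W ->
    (forall u : 'rV[R]_d -> 'rV[R]_n, smooth u -> torus_periodic l u ->
       forall x, op_adjoint L u x \in W) ->
    A \in W].

Definition Lambda_convexity :=
  forall P, Lambda P -> psd_mx P ->
    convex_function setT (fun v => frob (F v) P).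

Definition Lambda_cone : set 'M[R]_N :=
  [set Xi | symm_mx Xi /\
    forall P, Lambda P -> psd_mx P -> 0 <= frob Xi P].

Definition Lambda_le (B A : 'M[R]_N) := Lambda_cone (A - B).

Definition Lambda_proj (A : 'M[R]_N) : 'M[R]_N :=
  get [set P | Lambda P /\ forall Q, Lambda Q -> frob (A - P) Q = 0].

Definition Lambda_order_assumption :=
  (forall v, Lambda_cone (F v)) /\
  exists C, forall v j,
    frob_norm (Lambda_proj (partial j F v)) <=
      C * (frob_norm (grad Kfun v) + 1).

Definition conservativity :=
  forall w : 'rV[R]_d -> 'rV[R]_n, smooth w -> torus_periodic l w ->
    (\int[torus_measure d l]_x
       (frob (F (grad (legendre Kfun) (w x))) (op_adjoint L w x))%:E = 0)%E.

(* G is the distributional L^* zeta.                                          *)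
Definition weak_adjoint (zeta : 'rV[R]_d -> 'rV[R]_n)
    (G : 'rV[R]_d -> 'M[R]_N) :=
  forall Psi : 'rV[R]_d -> 'M[R]_N, smooth Psi -> torus_periodic l Psi ->
    (forall x, symm_mx (Psi x)) ->
    (\int[torus_measure d l]_x (frob (zeta x) (op_apply L Psi x))%:E =
     \int[torus_measure d l]_x (frob (G x) (Psi x))%:E)%E.

Definition strong_trace_condition :=
  exists c : R, forall zeta G,
    orlicz (torus_measure d l) (legendre Kfun) zeta ->
    Lp_symm (torus_measure d l) 1%E G ->
    weak_adjoint zeta G ->
    forall k : R,
      (\forall x \ae torus_measure d l,
         forall a, eigenvalue (- G x) a -> a <= k) ->
      (\forall x \ae torus_measure d l,
         forall a, eigenvalue (G x) a -> a <= c * k).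

End structure.

Section dual_problem.
Context {R : realType} {d n N : nat}.
Variables (l T : R) (F : 'rV[R]_n -> 'M[R]_N) (L : diff_operator R d n N).
Variable h : R -> R.

Definition spacetime_measure := oitv_prod (torus_measure d l) T.
HB.instance Definition _ := FiniteMeasure.on spacetime_measure.

Definition Hfun (t : R) : R := \int[lebesgue_measure]_(s in `[t, T]) h s.

Implicit Types (E z : R * 'rV[R]_d -> 'rV[R]_n).
Implicit Types (B M Psi : R * 'rV[R]_d -> 'M[R]_N).

(* Psi ranges over restrictions to [0, T] of smooth functions on R x T^d.     *)
Definition dual_constraint E B :=
  forall Psi, smooth Psi ->
    (forall t, torus_periodic l (fun x => Psi (t, x))) ->
    (forall p, symm_mx (Psi p)) ->
    (forall x, Psi (0, x) = 0) ->
    (\int[spacetime_measure]_p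
       (frob (B p) ('D_((1, 0) : R * 'rV[R]_d) Psi p) +
        frob (E p) (op_apply L (fun x => Psi (p.1, x)) p.2))%:E = 0)%E.

Definition dual_K E B : \bar R :=
  ereal_inf [set e | exists z M,
    [/\ orlicz spacetime_measure (Kfun F) z,
        Lp_symm spacetime_measure 1%E M,
        (\forall p \ae spacetime_measure, Lambda_le l L (F (z p)) (M p)) &
        e = (\int[spacetime_measure]_p
               (frob (z p) (E p) +
                frob (M p) ((h p.1)%:M + 2 *: B p) / 2)%:E)%E]].

Definition dual_admissible E B :=
  [/\ orlicz spacetime_measure (legendre (Kfun F)) E,
      Lp_symm spacetime_measure +oo%E B,
      dual_constraint E B &
      \forall p \ae spacetime_measure, psd_mx ((h p.1)%:M + 2 *: B p)].

Definition dual_objective (v0 : 'rV[R]_d -> 'rV[R]_n) E B : \bar R :=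
  (- (\int[spacetime_measure]_p (frob (v0 p.2) (E p))%:E) + dual_K E B)%E.

Definition dual_value (v0 : 'rV[R]_d -> 'rV[R]_n) : \bar R :=
  ereal_sup [set e | exists E B,
    dual_admissible E B /\ e = dual_objective v0 E B].

End dual_problem.

(* Main.v *)
(* The heart of the matter is an a priori bound for admissible pairs. Integrated against
   nonnegative functions of time, the constraint becomes L^* zeta = G with zeta an average of E
   and G an average of B. Since hI + 2B >= 0 bounds the spectrum of -G from above,
   the strong trace condition bounds tr G, hence tr B almost everywhere, and B is bounded in
   L^infinity because |A_ij| <= tr A for A >= 0. Inserting M = N (tr F(z)) I, which dominates F(z)
   in the Lambda-order, and z = v0 - w into the infimum defining the objective yields
   \int w.E <= A + c \int K(w) for all w, which by duality and the Delta_2-condition bounds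
   \int K^*(E) on superlevel sets and bounds the supremum. In place of weak compactness, a
   Komlos-type argument extracts from the decreasing convex superlevel sets a maximizing sequence
   converging almost everywhere; the constraint and the objective, being infima of linear
   functionals, pass to the limit by Fatou's lemma applied to Young's inequality. The lower
   bound is the value at (E, B) = (0, 0). *)

Require Import Defs.
From mathcomp Require Import all_boot all_order all_algebra.
From mathcomp Require Import all_classical all_reals all_analysis.
From mathcomp Require Import measurable_realfun ess_sup_inf ring lra.
Set Implicit Arguments.
Unset Strict Implicit.
Unset Printing Implicit Defensive.
Import Order.TTheory GRing.Theory Num.Theory.
Import numFieldNormedType.Exports.
Local Open Scope classical_set_scope.
Local Open Scope ring_scope.

(** The constraint asks test functions to vanish only at t = 0, which is how it encodes B(T) = 0. So
    w may be any smooth antiderivative vanishing at 0, and g = w' is free on ]0, T[; this freedom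
    localizes the trace bound in time. Differences of sigmoids serve as g because their
    antiderivatives are explicit, and rational parameters keep the exceptional null sets countable
    in number. The inequality r <= objective is rewritten as a family of real inequalities, linear
    in (E, B) and indexed by the competitors (z, M); the constraint is an equality between pairings
    of the same form. Stability under midpoints and one upper semicontinuity result then serve both.
    The obstacle in the limit is that E_k converges only almost everywhere with bounded \int
    K^*(E_k), so z.E_k need not have an integrable majorant independent of k. Young's inequality
    with a parameter e costs e K^*(E_k), whose integral is small uniformly in k, and the
    Delta_2-condition on K makes K(z/e) integrable for every e. The Delta_2-condition on K^* undoes
    dilations of E. *)

Lemma limn_einf_ge (R : realType) (u : (\bar R)^nat) (a : R) :
  (forall e, 0 < e -> \forall k \near \oo, ((a - e)%:E <= u k)%E) ->
  (a%:E <= limn_einf u)%E.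
Proof.
move=> au; apply/lee_subgt0Pr => e e0; rewrite -EFinB.
have [m _ mu] := au e e0.
rewrite limn_einf_lim; apply: lime_ge; first exact: is_cvg_einfs.
exists m => // k /= mk; apply: le_ereal_inf_tmp => _ [j /= kj <-].
by apply: mu => /=; exact: leq_trans kj.
Qed.

Lemma le_limn_einf (R : realType) (u v : (\bar R)^nat) :
  (forall k, (u k <= v k)%E) -> (limn_einf u <= limn_einf v)%E.
Proof.
move=> uv; rewrite !limn_einf_lim; apply: lee_lim; [exact: is_cvg_einfs|exact: is_cvg_einfs|].
apply: nearW => k; apply: le_ereal_inf_tmp => _ [j /= kj <-].
by apply: le_trans (uv j); apply: ereal_inf_lbound; exists j.
Qed.

(** * Integrals of real functions *)

Section real_integral.
Context disp (X : measurableType disp) (R : realType).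
Variable mu : {measure set X -> \bar R}.
Local Notation itg f := (mu.-integrable setT (EFin \o f)).
Implicit Types f g : X -> R.

Lemma itg_measurable f : itg f -> measurable_fun setT f.
Proof. by move=> /measurable_int/measurable_EFinP. Qed.

Lemma itgD f g : itg f -> itg g -> itg (fun x => f x + g x).
Proof. exact: integrableD. Qed.

Lemma itgZ (k : R) f : itg f -> itg (fun x => k * f x).
Proof. exact: integrableZl. Qed.

Lemma itgB f g : itg f -> itg g -> itg (fun x => f x - g x).
Proof. exact: integrableB. Qed.

Lemma itg_sum (I : finType) (P : pred I) (f : I -> X -> R) :
  (forall i, P i -> itg (f i)) -> itg (fun x => \sum_(i | P i) f i x).
Proof.
move=> itf; rewrite (_ : _ \o _ = fun x => \sum_(i | P i) (EFin \o f i) x)%E.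
  by apply: integrable_sum.
by apply/funext => x /=; rewrite sumEFin.
Qed.

Lemma ge0_itg f : measurable_fun setT f -> (forall x, 0 <= f x) ->
  (\int[mu]_x (f x)%:E < +oo)%E -> itg f.
Proof.
move=> mf f0 fy; apply/integrableP; split; first exact/measurable_EFinP.
by under eq_integral do rewrite /= ger0_norm//.
Qed.

Lemma itg_lty f : (forall x, 0 <= f x) -> itg f ->
  (\int[mu]_x (f x)%:E < +oo)%E.
Proof.
move=> f0 /integrableP[_].
by under eq_integral do rewrite /= ger0_norm//.
Qed.

Lemma ae_le_itg f g : measurable_fun setT f -> itg g ->
  (\forall x \ae mu, `|f x| <= g x) -> itg f.
Proof.
move=> mf ig fg; apply/integrableP; split; first exact/measurable_EFinP.
have /integrableP[mg] := ig; apply: le_lt_trans.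
apply: ae_ge0_le_integral => //=.
- by do 2 apply: measurableT_comp => //.
- by do 2 apply: measurableT_comp => //; exact/measurable_EFinP.
- by apply: filterS fg => x fg _; rewrite lee_fin (le_trans fg)// ler_norm.
Qed.

Lemma itg_norm f : itg f -> itg (fun x => `|f x|).
Proof. exact: integrable_norm. Qed.

Lemma le_itg f g : measurable_fun setT f -> itg g ->
  (forall x, `|f x| <= g x) -> itg f.
Proof. by move=> mf ig fg; apply: (ae_le_itg mf ig); exact: aeW. Qed.

Lemma EFin_Rint f : itg f -> (\int[mu]_x (f x)%:E)%E = (\int[mu]_x f x)%:E.
Proof. by move=> itf; rewrite /Rintegral fineK//; exact: integrable_fin_num. Qed.

Lemma ae_eq_Rint f g : measurable_fun setT f -> measurable_fun setT g ->
  (\forall x \ae mu, f x = g x) -> \int[mu]_x f x = \int[mu]_x g x.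
Proof.
move=> mf mg fg; congr fine; apply: ae_eq_integral => //.
- exact/measurable_EFinP.
- exact/measurable_EFinP.
- by apply: filterS fg => x -> _.
Qed.

Lemma ae_le_Rint f g : itg f -> itg g ->
  (\forall x \ae mu, f x <= g x) -> \int[mu]_x f x <= \int[mu]_x g x.
Proof.
move=> itf ig fg; rewrite -subr_ge0 -RintegralB//.
(* The difference is nonnegative only almost everywhere; its absolute value is so everywhere. *)
have -> : \int[mu]_x (g x - f x) = \int[mu]_x `|g x - f x|.
  apply: ae_eq_Rint.
  - by apply: measurable_funB; exact: itg_measurable.
  - by apply: measurableT_comp => //; apply: measurable_funB; exact: itg_measurable.
  - by apply: filterS fg => x fg; rewrite ger0_norm// subr_ge0.
exact: Rintegral_ge0.
Qed.

Lemma Rint_sum (I : finType) (f : I -> X -> R) : (forall i, itg (f i)) ->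
  \int[mu]_x (\sum_i f i x) = \sum_i \int[mu]_x f i x.
Proof.
move=> itf; apply: EFin_inj; rewrite -EFin_Rint; last by apply: itg_sum.
under eq_integral do rewrite -sumEFin.
rewrite integral_sum//.
by rewrite -sumEFin; apply: eq_bigr => i _; rewrite EFin_Rint.
Qed.

(** Fatou's lemma with lower semicontinuity in place of convergence, which is what a supremum of
    affine functions such as K^* gives directly. Integrability of the limit is part of the
    conclusion. *)
Lemma fatou_lsc (g_ : nat -> X -> R) g (c_ : nat -> R) (c : R) :
  (forall k, itg (g_ k)) -> measurable_fun setT g ->
  (\forall x \ae mu, forall k, 0 <= g_ k x) ->
  (\forall x \ae mu, 0 <= g x) ->
  (\forall x \ae mu, forall e : R, 0 < e ->
     \forall k \near \oo, g x - e <= g_ k x) ->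
  (forall k, \int[mu]_x g_ k x <= c_ k) -> c_ @ \oo --> c ->
  itg g /\ \int[mu]_x g x <= c.
Proof.
move=> ig mg g_0 g0 lsc gc cc.
have mg_ k : measurable_fun setT (fun x => (`|g_ k x|%:E : \bar R)).
  by apply/measurable_EFinP; apply: measurableT_comp => //; exact: itg_measurable.
(* Absolute values make all integrands nonnegative everywhere, as the extended-valued Fatou lemma
   requires. *)
suff gE : (\int[mu]_x `|g x|%:E <= c%:E)%E.
  have itg' : itg g.
    apply/integrableP; split; first exact/measurable_EFinP.
    by rewrite (le_lt_trans gE)// ltry.
  split=> //; apply: (@le_trans _ _ (\int[mu]_x `|g x|)).
    by apply: le_Rintegral => //; [exact: itg_norm|move=> x _; exact: ler_norm].
  by rewrite -lee_fin -EFin_Rint//; exact: itg_norm.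
have := fatou mu measurableT mg_ (fun _ _ _ => normr_ge0 _).
have cE n : (\int[mu]_x `|g_ n x|%:E = (\int[mu]_x g_ n x)%:E)%E.
  rewrite -EFin_Rint//; apply: ae_eq_integral => //.
    by apply/measurable_EFinP; exact: itg_measurable.
  by apply: filterS g_0 => x /(_ n) g0' _; rewrite ger0_norm.
under [X in limn_einf X]eq_fun do rewrite cE.
move=> fat; apply: (@le_trans _ _ (\int[mu]_x limn_einf (fun k => `|g_ k x|%:E))%E).
  apply: ae_ge0_le_integral => //.
  - by apply/measurable_EFinP; exact: measurableT_comp.
  - by move=> x _; apply: limn_einf_ge => e e0; apply: nearW => k; rewrite lee_fin; have := normr_ge0 (g_ k x); lra.
  - rewrite /limn_einf; apply: measurableT_comp => //.
    apply: measurable_fun_limn_esup => k /=.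
    by apply/measurable_EFinP; apply: measurableT_comp => //; exact: measurableT_comp (itg_measurable (ig k)).
  - move: g0 lsc; apply: filterS2 => x g0 lsc _.
    rewrite ger0_norm//; apply: limn_einf_ge => e e0.
    by apply: filterS (lsc e e0) => k; rewrite lee_fin => /le_trans; apply; exact: ler_norm.
apply: (le_trans fat).
apply: (@le_trans _ _ (limn_einf (EFin \o c_))).
  by apply: le_limn_einf => k; rewrite lee_fin.
rewrite (@cvg_limn_einf_sup _ _ c%:E _).1 //.
by apply: cvg_EFin => //; exact: nearW.
Qed.

End real_integral.

(** * Almost everywhere convergence of near-minimizers *)

Lemma cvg_quasi_cauchy (R : realType) (u : R^nat) (B : R) :
  (forall k, `|u k.+1 - u k| <= B * 2^-1 ^+ k) -> cvgn u.
Proof.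
move=> uB.
have cvg_tel : cvgn (series (telescope u)).
  apply: normed_cvg.
  apply: (@series_le_cvg _ _ (geometric B 2^-1)).
  - by move=> k /=.
  - by move=> k /=; apply: le_trans (uB k); rewrite normr_ge0.
  - by move=> k /=; exact: uB.
  - apply: is_cvg_geometric_series; rewrite ger0_norm; lra.
rewrite (_ : u = (fun n => u 0%N + series (telescope u) n)).
  exact: is_cvgD (is_cvg_cst _) cvg_tel.
by apply/funext => n; rewrite [LHS]eq_sum_telescope.
Qed.

Lemma ae_forall_fin disp (X : measurableType disp) (R : realType)
    (mu : {measure set X -> \bar R}) (I : finType) (P : I -> X -> Prop) :
  (forall i, \forall x \ae mu, P i x) -> \forall x \ae mu, forall i, P i x.
Proof. by move=> aeP; exact: filter_forall. Qed.

Section komlos.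
Context disp (X : measurableType disp) (R : realType).
Variable mu : {finite_measure set X -> \bar R}.
Local Notation itg f := (mu.-integrable setT (EFin \o f)).

Lemma itg_cst (k : R) : itg (fun=> k).
Proof. exact: finite_measure_integrable_cst. Qed.

(** By monotone convergence the series of the [D k] is integrable, hence finite almost everywhere,
    and it dominates each of its terms. *)
Lemma ae_summable_bound (D : nat -> X -> R) (c : R) :
  (forall k, itg (D k)) -> (forall k x, 0 <= D k x) ->
  (forall k, \int[mu]_x D k x <= c * 2^-1 ^+ k) ->
  \forall x \ae mu, exists B : R, forall k, D k x <= B.
Proof.
move=> iD D0 Dc.
have mD k : measurable_fun setT (fun x => (D k x)%:E).
  by apply/measurable_EFinP; exact: itg_measurable.
have fin : (\int[mu]_x (\sum_(k <oo) (D k x)%:E) < +oo)%E.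
  rewrite integral_nneseries//; last by move=> k x _; rewrite lee_fin.
  apply: (@le_lt_trans _ _ (\sum_(k <oo) (c * 2^-1 ^+ k)%:E)%E).
    apply: lee_nneseries => k _.
      by move=> _; apply: integral_ge0 => x _; rewrite lee_fin.
    by rewrite EFin_Rint// lee_fin.
  have c0 : 0 <= c.
    have := Dc 0%N; rewrite expr0 mulr1; apply: le_trans.
    by apply: Rintegral_ge0.
  rewrite (_ : limn _ = (c * (1 - 2^-1)^-1)%:E) ?ltry//.
  apply/cvg_lim => //.
  rewrite (_ : (fun n => _) = EFin \o series (geometric c 2^-1)).
    apply: cvg_EFin; first exact: nearW.
    by apply: cvg_geometric_series; rewrite ger0_norm; lra.
  by apply/funext => n /=; rewrite /series/= -sumEFin.
have S0 x : (0 <= \sum_(k <oo) (D k x)%:E)%E.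
  by apply: nneseries_ge0 => k _ _; rewrite lee_fin.
have : mu.-integrable setT (fun x => (\sum_(k <oo) (D k x)%:E)%E).
  apply/integrableP; split.
    apply: ge0_emeasurable_sum => // k x _ _; by rewrite lee_fin.
  by under eq_integral do rewrite gee0_abs//.
move=> /integrable_ae => /(_ measurableT); apply: filterS => x /(_ I) xfin.
exists (fine (\sum_(k <oo) (D k x)%:E)%E) => k.
rewrite -lee_fin fineK//.
apply: (@le_trans _ _ (\sum_(0 <= i < k.+1) (D i x)%:E)%E); last first.
  by apply: nneseries_lim_ge => i _ _; rewrite lee_fin.
rewrite big_nat_recr//= leeDr//; apply: sume_ge0 => i _; by rewrite lee_fin.
Qed.

Lemma expR_midpoint (a b : R) :
  expR (- a) + expR (- b) - 2 * expR (- ((a + b) / 2)) =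
  (expR (- a / 2) - expR (- b / 2)) ^+ 2.
Proof.
have E (x : R) : expR (- x) = expR (- x / 2) ^+ 2.
  by rewrite -expRM_natl; congr expR; field.
rewrite (E a) (E b) (_ : - ((a + b) / 2) = - a / 2 + - b / 2); last by field.
rewrite expRD; ring.
Qed.

(** The infima of J over C k increase to a finite limit A. Each g k is taken nearly minimal in some
    C m with m >= k whose infimum exceeds A - e k. A midpoint of successive choices lies in the
    larger of the two sets, so J exceeds A - e k there, and the defect is at most (A + e k) + (A + e
    k.+1) - 2 (A - e k). *)
Lemma midpoint_minimizing (V : Type) (C : nat -> set V) (mid : V -> V -> V)
    (J : V -> R) (Jmax : R) (e : nat -> R) :
  (forall k, C k.+1 `<=` C k) -> (forall k, C k !=set0) ->
  (forall k f g, C k f -> C k g -> C k (mid f g)) ->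
  (forall k f, C k f -> 0 <= J f <= Jmax) ->
  (forall k, 0 < e k) -> (forall k, e k.+1 <= e k) ->
  exists g : nat -> V, forall k, C k (g k) /\
    J (g k) + J (g k.+1) - 2 * J (mid (g k) (g k.+1)) <= 4 * e k.
Proof.
move=> C1 C0 Cmid CJ e0 e1.
have Cle k m : (k <= m)%N -> C m `<=` C k.
  elim: m => [|m IH]; first by rewrite leqn0 => /eqP ->.
  by rewrite leq_eqVlt => /predU1P[-> //|/IH]; apply: subset_trans (C1 m).
have JC0 k : J @` C k !=set0 by case: (C0 k) => f Cf; exists (J f), f.
have JClb k : has_lbound (J @` C k).
  by exists 0 => _ [f /CJ/andP[? _] <-].
pose a k := inf (J @` C k).
have aJ k f : C k f -> a k <= J f by move=> Cf; apply: ge_inf => //; exists f.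
have ale k m : (k <= m)%N -> a k <= a m.
  move=> km; apply: lb_le_inf => // _ [f /(Cle _ _ km) Cf <-]; exact: aJ.
have supa : has_sup (range a).
  split; first by exists (a 0%N), 0%N.
  exists Jmax => _ [k _ <-]; case: (C0 k) => f Cf.
  by apply: le_trans (aJ _ _ Cf) _; have /andP[] := CJ _ _ Cf.
pose A := sup (range a).
have aA k : a k <= A by apply: sup_upper_bound => //; exists k.
have pick k : exists mf : nat * V, [/\ (k <= mf.1)%N, A - e k < a mf.1,
    C mf.1 mf.2 & J mf.2 < A + e k].
  have [_ [m _ <-] Am] := sup_adherent (e0 k) supa.
  pose m' := maxn k m.
  have [_ [f Cf <-] Jf] := inf_adherent (e0 k) (conj (JC0 m') (JClb m')).
  exists (m', f); split=> //=; first exact: leq_maxl.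
    by apply: lt_le_trans Am _; apply: ale; exact: leq_maxr.
  by apply: (lt_le_trans Jf); rewrite lerD2r; exact: aA.
have [mf mfP] := choice pick.
exists (fun k => (mf k).2) => k.
have [km Am Cm Jm] := mfP k; have [km' Am' Cm' Jm'] := mfP k.+1.
split; first exact: Cle Cm.
suff : A - e k < J (mid (mf k).2 (mf k.+1).2) by have := e1 k; lra.
have [le|/ltnW le] := leqP (mf k).1 (mf k.+1).1.
  by apply: lt_le_trans Am _; apply: aJ; apply: Cmid => //; exact: Cle Cm'.
apply: (@lt_le_trans _ _ (a (mf k.+1).1)); first by have := e1 k; lra.
by apply: aJ; apply: Cmid => //; exact: Cle Cm.
Qed.

(* The functional f |-> \sum_i \int exp(- f i) is bounded on nonnegative functions and its
   convexity defect at a midpoint is the square of an L^2 distance, so near-minimizers over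
   decreasing convex sets are Cauchy after the change of variable f |-> exp(- f / 2). *)
Lemma komlos (I : finType) (C : nat -> set (I -> X -> R)) (M : R) :
  (forall k, C k.+1 `<=` C k) -> (forall k, C k !=set0) ->
  (forall k f g, C k f -> C k g -> C k (fun i x => (f i x + g i x) / 2)) ->
  (forall k f, C k f -> forall i,
     [/\ itg (f i), (forall x, 0 <= f i x) & \int[mu]_x f i x <= M]) ->
  exists (g : nat -> I -> X -> R) (G : I -> X -> R),
    [/\ (forall k, C k (g k)), (forall i, measurable_fun setT (G i)) &
     \forall x \ae mu, forall i, g k i x @[k --> \oo] --> G i x].
Proof.
move=> C1 C0 Cmid CP.
have mexp (f : X -> R) (c : R) : measurable_fun setT f ->
    measurable_fun setT (fun x => expR (c * f x)).
  move=> mf; apply: (measurableT_comp (f := expR)) => //; exact: measurable_funM.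
have iexp (f : X -> R) (c : R) : c <= 0 -> measurable_fun setT f ->
    (forall x, 0 <= f x) -> itg (fun x => expR (c * f x)).
  move=> c0 mf f0; apply: (le_itg (mexp f c mf) (itg_cst 1)) => x.
  by rewrite ger0_norm ?expR_ge0// expR_le1 mulr_le0_ge0.
have iexpN (f : X -> R) : measurable_fun setT f ->
    (forall x, 0 <= f x) -> itg (fun x => expR (- f x)).
  move=> mf f0; rewrite (_ : (fun x => _) = fun x => expR (-1 * f x)).
    by apply: iexp => //; lra.
  by apply/funext => x; rewrite mulN1r.
pose J (f : I -> X -> R) := \sum_i \int[mu]_x expR (- f i x).
have CJ k f : C k f -> 0 <= J f <= \sum_(i : I) \int[mu]_x 1.
  move=> Cf; apply/andP; split; first by apply: sumr_ge0 => i _; apply: Rintegral_ge0 => x _; exact: expR_ge0.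
  apply: ler_sum => i _; have [fi fi0 _] := CP _ _ Cf i.
  apply: le_Rintegral => //.
  - by apply: iexpN => //; exact: itg_measurable fi.
  - exact: itg_cst.
  - by move=> x _; rewrite expR_le1 oppr_le0.
(* The rate 8^-k beats the weight 4^k put into [D] below and leaves a summable 2^-k. *)
pose e k : R := 8^-1 ^+ k.
have [g gP] := @midpoint_minimizing _ C _ J _ e C1 C0 Cmid CJ
  (fun k => exprn_gt0 k (ltac:(lra) : 0 < 8^-1 :> R))
  (fun k => ltac:(rewrite /e exprS; have := exprn_gt0 k (ltac:(lra) : 0 < 8^-1 :> R); lra)).
pose h k i x := expR (- g k i x / 2).
have Cg k : C k (g k) by have [] := gP k.
have mg k i : measurable_fun setT (g k i).
  by have [/itg_measurable] := CP _ _ (Cg k) i.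
have g0 k i x : 0 <= g k i x by have [_ ->] := CP _ _ (Cg k) i.
have mh k i : measurable_fun setT (h k i).
  rewrite (_ : h k i = fun x => expR (- 2^-1 * g k i x)); first exact: mexp.
  by apply/funext => x; rewrite /h; congr expR; field.
have h1 k i x : 0 < h k i x <= 1.
  by rewrite expR_gt0 expR_le1; have := g0 k i x; lra.
(* With the weight 4^k, a bound on [D] uniform in k makes the increments of [h] of order 2^-k, hence
   summable. *)
pose D k i x := 4 ^+ k * (h k i x - h k.+1 i x) ^+ 2.
have mD k i : measurable_fun setT (D k i).
  by apply: measurable_funM => //; apply: measurable_funX; exact: measurable_funB.
have D0 k i x : 0 <= D k i x by apply: mulr_ge0; [exact: exprn_ge0|exact: sqr_ge0].
have iE k i : itg (fun x => expR (- g k i x)).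
  exact: iexpN.
have iM k i : itg (fun x => expR (- ((g k i x + g k.+1 i x) / 2))).
  apply: (@iexpN (fun x => (g k i x + g k.+1 i x) / 2)).
    by apply: measurable_funM => //; exact: measurable_funD.
  by move=> x; have := g0 k i x; have := g0 k.+1 i x; lra.
have iD k i : itg (D k i).
  rewrite (_ : D k i = fun x => 4 ^+ k * (expR (- g k i x) + expR (- g k.+1 i x) - 2 * expR (- ((g k i x + g k.+1 i x) / 2)))).
    by apply: itgZ; apply: itgB; [exact: itgD|exact: itgZ].
  by apply/funext => x; rewrite expR_midpoint.
have Dc k : \int[mu]_x (\sum_i D k i x) <= 4 * 2^-1 ^+ k.
  rewrite Rint_sum//.
  have -> : \sum_i \int[mu]_x D k i x = 4 ^+ k *
      (J (g k) + J (g k.+1) - 2 * J (fun i x => (g k i x + g k.+1 i x) / 2)).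
    rewrite /J !mulrBr mulrDr !mulr_sumr -big_split/= -sumrB; apply: eq_bigr => i _.
    rewrite -mulrDr -!mulrBr -RintegralZl// -RintegralD// -RintegralB//; last 2 first.
    - exact: itgD.
    - exact: itgZ.
    rewrite -RintegralZl//; last by apply: itgB; [exact: itgD|exact: itgZ].
    by congr fine; apply: eq_integral => x _; rewrite expR_midpoint.
  have [_ Je] := gP k.
  apply: (@le_trans _ _ (4 ^+ k * (4 * e k))); first by rewrite ler_pM2l ?exprn_gt0.
  by rewrite mulrCA -exprMn (_ : 4 * 8^-1 = 2^-1 :> R)//; lra.
have hcvg : \forall x \ae mu, forall i, cvgn (fun k => h k i x).
  have := @ae_summable_bound (fun k x => \sum_i D k i x) 4 _ _ Dc.
  move=> /(_ (fun k => itg_sum (fun i _ => iD k i))).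
  move=> /(_ (fun k x => sumr_ge0 _ (fun i _ => D0 k i x))).
  apply: filterS => x [B BP] i.
  have B0 : 0 <= B by apply: le_trans (BP 0%N); apply: sumr_ge0.
  (* B + 1 stands in for the square root of B. *)
  apply: (@cvg_quasi_cauchy _ _ (B + 1)) => k.
  have DB : D k i x <= B.
    by apply: le_trans (BP k); rewrite (bigD1 i)//= lerDl; apply: sumr_ge0.
  rewrite -(@ler_pXn2r _ 2)// ?nnegrE ?normr_ge0 ?mulr_ge0 ?exprn_ge0//; try lra.
  rewrite real_normK ?num_real// exprMn -exprM mulnC exprM.
  have -> : (2^-1 ^+ 2 : R) = 4^-1 by field.
  rewrite exprVn ler_pdivlMr ?exprn_gt0// mulrC -sqrrN opprB.
  by apply: le_trans DB _; rewrite expr2; nra.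
have mL i : measurable_fun setT (fun x => limn_einf (fun k => (g k i x)%:E)).
  rewrite /limn_einf; apply: measurableT_comp => //.
  apply: measurable_fun_limn_esup => k /=.
  by apply/measurable_EFinP; exact: measurableT_comp (mg k i).
(* Convergence of exp(- g / 2) does not prevent g from tending to infinity; the L^1 bound and
   Fatou's lemma do, almost everywhere. *)
have gfin : \forall x \ae mu, forall i, limn_einf (fun k => (g k i x)%:E) \is a fin_num.
  apply/ae_forall_fin => i.
  have mEg k : measurable_fun setT (fun x => (g k i x)%:E) by exact/measurable_EFinP.
  have Eg0 k x : setT x -> (0 <= (g k i x)%:E)%E by rewrite lee_fin.
  have fat := fatou mu measurableT mEg Eg0.
  have L0 x : (0 <= limn_einf (fun k => (g k i x)%:E))%E.
    by apply: limn_einf_ge => r r0; apply: nearW => k; rewrite lee_fin; have := g0 k i x; lra.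
  suff : mu.-integrable setT (fun x => limn_einf (fun k => (g k i x)%:E)).
    by move=> /integrable_ae => /(_ measurableT); apply: filterS => x; apply.
  apply/integrableP; split; first exact: mL.
  under eq_integral do rewrite gee0_abs//.
  apply: (le_lt_trans fat); apply: (@le_lt_trans _ _ M%:E); last exact: ltry.
  rewrite -(cvg_limn_einf_sup (@cvg_cst _ M%:E _ \oo _)).1.
  apply: le_limn_einf => k; have [ig _ gM] := CP _ _ (Cg k) i.
  by rewrite EFin_Rint// lee_fin.
exists g, (fun i x => fine (limn_einf (fun k => (g k i x)%:E))); split=> //.
  by move=> i; apply: measurableT_comp (mL i).
apply: filterS2 hcvg gfin => x hc gf i.
have /cvg_ex[/= H hH] := hc i.
(* A limit H <= 0 would drive g to infinity, against its finite lower limit. *)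
have [H0|H0] := ltP 0 H; last first.
  exfalso; move: (gf i) => /fineK; set l := fine _ => lE.
  suff : ((l + 1)%:E <= limn_einf (fun k => (g k i x)%:E))%E by rewrite -lE lee_fin; lra.
  apply: limn_einf_ge => r r0.
  have : \forall k \near \oo, h k i x < expR (- (l + 1) / 2).
    by apply: cvgr_lt hH _ _; apply: (le_lt_trans H0); exact: expR_gt0.
  by apply: filterS => k; rewrite ltr_expR lee_fin; lra.
have gH : g k i x @[k --> \oo] --> - 2 * ln H.
  rewrite (_ : (fun k => _) = fun k => -2 * ln (h k i x)); last first.
    by apply/funext => k; rewrite /h expRK; field.
  apply: cvgM; first exact: cvg_cst.
  by apply: continuous_cvg hH; exact: continuous_ln.
suff -> : limn_einf (fun k => (g k i x)%:E) = (- 2 * ln H)%:E by [].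
by apply: (cvg_limn_einf_sup _).1; apply: cvg_EFin gH; exact: nearW.
Qed.

End komlos.

(** * Frobenius product and quadratic forms *)

Section frobenius.
Context {R : realType}.

Lemma frobC m n (A B : 'M[R]_(m, n)) : frob A B = frob B A.
Proof. by apply: eq_bigr => i _; apply: eq_bigr => j _; rewrite mulrC. Qed.

Lemma frobDl m n (A B C : 'M[R]_(m, n)) : frob (A + B) C = frob A C + frob B C.
Proof.
rewrite /frob -big_split; apply: eq_bigr => i _; rewrite -big_split.
by apply: eq_bigr => j _; rewrite mxE mulrDl.
Qed.

Lemma frobZl m n a (A B : 'M[R]_(m, n)) : frob (a *: A) B = a * frob A B.
Proof.
rewrite /frob mulr_sumr; apply: eq_bigr => i _; rewrite mulr_sumr.
by apply: eq_bigr => j _; rewrite mxE mulrA.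
Qed.

Lemma frobDr m n (A B C : 'M[R]_(m, n)) : frob C (A + B) = frob C A + frob C B.
Proof. by rewrite frobC frobDl ![frob _ C]frobC. Qed.

Lemma frobZr m n a (A B : 'M[R]_(m, n)) : frob B (a *: A) = a * frob B A.
Proof. by rewrite frobC frobZl frobC. Qed.

Lemma frobNl m n (A B : 'M[R]_(m, n)) : frob (- A) B = - frob A B.
Proof. by rewrite -scaleN1r frobZl mulN1r. Qed.

Lemma frobNr m n (A B : 'M[R]_(m, n)) : frob B (- A) = - frob B A.
Proof. by rewrite frobC frobNl frobC. Qed.

Lemma frobBl m n (A B C : 'M[R]_(m, n)) : frob (A - B) C = frob A C - frob B C.
Proof. by rewrite frobDl frobNl. Qed.

Lemma frobBr m n (A B C : 'M[R]_(m, n)) : frob C (A - B) = frob C A - frob C B.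
Proof. by rewrite frobDr frobNr. Qed.

Lemma frob0l m n (A : 'M[R]_(m, n)) : frob 0 A = 0.
Proof. by rewrite -(scale0r A) frobZl mul0r. Qed.

Lemma frob0r m n (A : 'M[R]_(m, n)) : frob A 0 = 0.
Proof. by rewrite frobC frob0l. Qed.

Lemma frob_ge0 m n (A : 'M[R]_(m, n)) : 0 <= frob A A.
Proof. by apply: sumr_ge0 => i _; apply: sumr_ge0 => j _; rewrite -expr2 sqr_ge0. Qed.

Lemma frob_eq0 m n (A : 'M[R]_(m, n)) : frob A A = 0 -> A = 0.
Proof.
have sq_ge0 i j : 0 <= A i j * A i j by rewrite -expr2 sqr_ge0.
move=> /psumr_eq0P A0; apply/matrixP => i j; rewrite mxE; apply/eqP.
have /psumr_eq0P/(_ j isT)/eqP := A0 (fun k _ => sumr_ge0 _ (fun q _ => sq_ge0 k q)) i isT.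
by rewrite mulf_eq0 orbb; apply.
Qed.

Lemma frob_scalarr N (A : 'M[R]_N) a : frob A a%:M = a * \tr A.
Proof.
rewrite /frob /mxtrace mulr_sumr; apply: eq_bigr => i _.
rewrite (bigD1 i)//= !mxE eqxx mulr1n big1 ?addr0; first by rewrite mulrC.
by move=> j ji; rewrite mxE eq_sym (negPf ji) mulr0n mulr0.
Qed.

Lemma frob_scalarl N (A : 'M[R]_N) a : frob a%:M A = a * \tr A.
Proof. by rewrite frobC frob_scalarr. Qed.

Lemma frob_rV n (v w : 'rV[R]_n) : frob v w = \sum_j v ord0 j * w ord0 j.
Proof. by rewrite /frob big_ord1. Qed.

Lemma frob_CauchySchwarz m n (A B : 'M[R]_(m, n)) :
  frob A B <= frob_norm A * frob_norm B.
Proof.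
have [B0|B0] := eqVneq (frob B B) 0.
  rewrite (frob_eq0 B0).
  by rewrite frob0r mulr_ge0 ?sqrtr_ge0.
have Bp : 0 < frob B B by rewrite lt_def B0 frob_ge0.
have := frob_ge0 (frob B B *: A - frob A B *: B).
rewrite frobBl !frobBr !frobZl !frobZr (frobC B A) => H.
have H2 : frob A B ^+ 2 <= frob A A * frob B B.
  have : 0 <= frob B B * (frob A A * frob B B - frob A B ^+ 2) by apply: le_trans H _; rewrite expr2; lra.
  by rewrite pmulr_rge0// subr_ge0.
rewrite /frob_norm -sqrtrM ?frob_ge0//; apply: le_trans (ler_norm _) _.
by rewrite -sqrtr_sqr ler_wsqrtr.
Qed.

Lemma le_norm_frob m n (A B : 'M[R]_(m, n)) (c : R) :
  (forall i j, `|B i j| <= c) -> `|frob A B| <= c * \sum_i \sum_j `|A i j|.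
Proof.
move=> Bc; apply: le_trans (ler_norm_sum _ _ _) _.
rewrite mulr_sumr; apply: ler_sum => i _; apply: le_trans (ler_norm_sum _ _ _) _.
rewrite mulr_sumr; apply: ler_sum => j _; rewrite normrM mulrC.
by rewrite ler_wpM2r.
Qed.

Definition bform N (A : 'M[R]_N) (x y : 'rV[R]_N) : R := (x *m A *m y^T) ord0 ord0.

Lemma bformDl N (A : 'M[R]_N) x y z : bform A (x + y) z = bform A x z + bform A y z.
Proof. by rewrite /bform !mulmxDl mxE. Qed.

Lemma bformZl N (A : 'M[R]_N) a x z : bform A (a *: x) z = a * bform A x z.
Proof. by rewrite /bform -!scalemxAl mxE. Qed.

Lemma bformDr N (A : 'M[R]_N) x y z : bform A x (y + z) = bform A x y + bform A x z.
Proof. by rewrite /bform linearD mulmxDr mxE. Qed.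

Lemma bformZr N (A : 'M[R]_N) a x z : bform A x (a *: z) = a * bform A x z.
Proof. by rewrite /bform linearZ -scalemxAr mxE. Qed.

Lemma bform_mxDl N (A B : 'M[R]_N) x y : bform (A + B) x y = bform A x y + bform B x y.
Proof. by rewrite /bform mulmxDr mulmxDl mxE. Qed.

Lemma bform_mxZl N (A : 'M[R]_N) a x y : bform (a *: A) x y = a * bform A x y.
Proof. by rewrite /bform -scalemxAr -scalemxAl mxE. Qed.

Lemma bform_scalar N (a : R) x : bform (a%:M : 'M[R]_N) x x = a * frob x x.
Proof.
rewrite /bform mul_mx_scalar -scalemxAl mxE mxE frob_rV; congr (_ * _).
by apply: eq_bigr => i _; rewrite mxE.
Qed.

Lemma bformE N (A : 'M[R]_N) x y : bform A x y = \sum_i \sum_j x ord0 i * A i j * y ord0 j.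
Proof.
rewrite /bform mxE exchange_big; apply: eq_bigr => j _; rewrite !mxE mulr_suml.
by apply: eq_bigr => i _.
Qed.

Lemma bform_delta N (A : 'M[R]_N) i j :
  bform A (delta_mx ord0 i) (delta_mx ord0 j) = A i j.
Proof. by rewrite /bform -rowE trmx_delta -colE !mxE. Qed.

Lemma bform_sym N (A : 'M[R]_N) x y : symm_mx A -> bform A x y = bform A y x.
Proof.
move=> As; rewrite /bform.
have -> : x *m A *m y^T = (y *m A *m x^T)^T by rewrite !trmx_mul trmxK As mulmxA.
by rewrite mxE.
Qed.

(** The form at e_i + e_j and at e_i - e_j gives 2 |A_ij| <= A_ii + A_jj. *)
Lemma psd_entry_le_tr N (A : 'M[R]_N) i j : psd_mx A -> `|A i j| <= \tr A.
Proof.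
move=> [As A0].
have Ad k : 0 <= A k k by rewrite -bform_delta; exact: A0.
have [->|ij] := eqVneq i j.
  by rewrite ger0_norm// /mxtrace (bigD1 j)//= lerDl; apply: sumr_ge0.
have Aji : A j i = A i j by rewrite -[in LHS]As mxE.
have : A i i + A j j <= \tr A.
  rewrite /mxtrace (bigD1 i)//= (bigD1 j) 1?eq_sym//= addrA lerDl.
  exact: sumr_ge0.
have P := A0 (delta_mx ord0 i + 1 *: delta_mx ord0 j).
have M := A0 (delta_mx ord0 i + (-1) *: delta_mx ord0 j).
move: P M; rewrite -!/(bform _ _ _) !(bformDl, bformDr, bformZl, bformZr) !bform_delta Aji.
move=> P M S; rewrite ler_norml; apply/andP; split; have := Ad i; have := Ad j; lra.
Qed.

(** Entrywise, |A_ij| <= tr A and 2 |x_i x_j| <= x_i^2 + x_j^2; summing over both indices produces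
    the factor N. This is cruder than a bound by the largest eigenvalue but uses no spectral
    theory. *)
Lemma psd_bform_ub N (A : 'M[R]_N) x : psd_mx A -> bform A x x <= N%:R * \tr A * frob x x.
Proof.
move=> pA; rewrite bformE frob_rV.
apply: (@le_trans _ _ (\sum_i \sum_j (\tr A / 2 * (x ord0 i ^+ 2 + x ord0 j ^+ 2)))).
  apply: ler_sum => i _; apply: ler_sum => j _.
  have := psd_entry_le_tr i j pA; set a := A i j; set t := \tr A.
  set u := x ord0 i; set v := x ord0 j; rewrite ler_norml => /andP[a1 a2].
  have p1 : 0 <= (t - a) * (u - v) ^+ 2 by apply: mulr_ge0; [lra|exact: sqr_ge0].
  have p2 : 0 <= (t + a) * (u + v) ^+ 2 by apply: mulr_ge0; [lra|exact: sqr_ge0].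
  have -> : u * a * v = (t / 2 * (u ^+ 2 + v ^+ 2)) - ((t - a) * (u + v) ^+ 2 + (t + a) * (u - v) ^+ 2) / 4 by field.
  have p3 : 0 <= (t - a) * (u + v) ^+ 2 by apply: mulr_ge0; [lra|exact: sqr_ge0].
  have p4 : 0 <= (t + a) * (u - v) ^+ 2 by apply: mulr_ge0; [lra|exact: sqr_ge0].
  lra.
rewrite le_eqVlt; apply/orP; left; apply/eqP.
under eq_bigr do rewrite -mulr_sumr big_split/= sumr_const card_ord.
rewrite -mulr_sumr big_split/= sumr_const card_ord sumrMnl.
under [in RHS]eq_bigr do rewrite -expr2.
rewrite -mulr_natl; set S := (\sum_(i < N) _); by field.
Qed.

Lemma psd_scalar_tr N (A : 'M[R]_N) : psd_mx A -> psd_mx ((N%:R * \tr A)%:M - A).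
Proof.
move=> pA; split.
  by rewrite /symm_mx /= linearB/= tr_scalar_mx; have [-> _] := pA.
move=> x; rewrite -/(bform _ _ _) bform_mxDl bform_scalar -scaleN1r bform_mxZl mulN1r subr_ge0.
exact: psd_bform_ub.
Qed.

Lemma continuous_fD (T : topologicalType) (f g : T -> R) :
  continuous f -> continuous g -> continuous (fun x => f x + g x).
Proof. by move=> cf cg x; apply: (@continuousD _ _ _ f g); [exact: cf|exact: cg]. Qed.

Lemma continuous_fM (T : topologicalType) (f g : T -> R) :
  continuous f -> continuous g -> continuous (fun x => f x * g x).
Proof. by move=> cf cg x; apply: (@continuousM _ _ f g); [exact: cf|exact: cg]. Qed.

Lemma continuous_sum (T : topologicalType) (I : finType) (f : I -> T -> R) :
  (forall i, continuous (f i)) -> continuous (fun x => \sum_i f i x).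
Proof.
move=> cf; have cs (s : seq I) : continuous (fun x => \sum_(i <- s) f i x).
  elim: s => [|i s IH].
    by under eq_fun do rewrite big_nil; exact: cst_continuous.
  by under eq_fun do rewrite big_cons; apply: continuous_fD.
exact: cs.
Qed.

Lemma continuous_entry (T : topologicalType) m n (f : T -> 'M[R]_(m, n)) i j :
  continuous f -> continuous (fun x => f x i j).
Proof.
move=> cf x; apply: (@continuous_comp _ _ _ f (fun M : 'M[R]_(m, n) => M i j)); first exact: cf.
exact: coord_continuous.
Qed.

Lemma continuous_frob (T : topologicalType) m n (f g : T -> 'M[R]_(m, n)) :
  continuous f -> continuous g -> continuous (fun x => frob (f x) (g x)).
Proof.
move=> cf cg; apply: continuous_sum => i; apply: continuous_sum => j.
by apply: continuous_fM; exact: continuous_entry.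
Qed.

Lemma continuous_frobl m n (B : 'M[R]_(m, n)) : continuous (fun A => frob A B).
Proof.
apply: continuous_sum => i; apply: continuous_sum => j.
by apply: continuous_fM; [exact: coord_continuous|exact: cst_continuous].
Qed.

Lemma continuous_frobr m n (A : 'M[R]_(m, n)) : continuous (fun B => frob A B).
Proof. by under eq_fun do rewrite frobC; exact: continuous_frobl. Qed.

Lemma continuous_bform N (A : 'M[R]_N) : continuous (fun x => bform A x x).
Proof.
under eq_fun do rewrite bformE.
apply: continuous_sum => i; apply: continuous_sum => j.
by do 2?apply: continuous_fM; [exact: coord_continuous|exact: cst_continuous|exact: coord_continuous].
Qed.

(* The maximum M of the quadratic form on the unit sphere is attained at an eigenvector: M I - G
   is nonnegative and its form vanishes there. *)
Lemma symm_eigenvalue_tr N (G : 'M[R]_N) (m : R) : symm_mx G ->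
  (forall a, eigenvalue G a -> a <= m) -> \tr G <= N%:R * m.
Proof.
(* In dimension 0 the unit sphere is empty and there is no maximizer. *)
move=> Gs Gm; case: N => [|N] in G Gs Gm *.
  by rewrite mul0r /mxtrace big_ord0.
pose S := [set x : 'rV[R]_N.+1 | frob x x = 1].
have cS : compact S.
  apply: (@subclosed_compact _ _ [set v : 'rV[R]_N.+1 | forall i, v ord0 i \in `[(-1 : R), 1]]).
  - have -> : S = (fun x => bform 1%:M x x) @^-1` [set 1].
      by apply/seteqP; split=> x; rewrite /S/= bform_scalar mul1r.
    apply: preimage_closed; [by move=> x _; exact: continuous_bform|exact: closed_eq].
  - apply: (@rV_compact _ _ (fun=> `[(-1 : R), 1]%classic)) => _; exact: segment_compact.
  - move=> x; rewrite /S/= frob_rV => x1 i; rewrite in_itv/= -ler_norml.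
    rewrite -(@ler_pXn2r _ 2)// ?nnegrE// expr1n real_normK ?num_real// -x1 (bigD1 i)//= expr2 lerDl.
    by apply: sumr_ge0 => j _; rewrite -expr2 sqr_ge0.
have S0 : S !=set0.
  by exists (delta_mx ord0 ord0); rewrite /S/= -[frob _ _]mul1r -bform_scalar bform_delta mxE.
have [x0 /set_mem x0S x0max'] := compact_EVT_max S0 cS (continuous_subspaceT (@continuous_bform _ G)).
have x0max x : S x -> bform G x x <= bform G x0 x0 by move=> Sx; apply: x0max'; rewrite inE.
pose M := bform G x0 x0.
have HM x : bform G x x <= M * frob x x.
  have [/frob_eq0 ->|xn0] := eqVneq (frob x x) 0.
    by rewrite -(scale0r 0) bformZl frobZl !mul0r mulr0.
  have xp : 0 < frob x x by rewrite lt_def xn0 frob_ge0.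
  pose c := (Num.sqrt (frob x x))^-1.
  have c2 : c ^+ 2 = (frob x x)^-1 by rewrite exprVn sqr_sqrtr// ltW.
  have /x0max : S (c *: x).
    by rewrite /S/= frobZl frobZr mulrA -expr2 c2 mulVf.
  by rewrite bformZl bformZr mulrA -expr2 c2 mulrC ler_pdivrMr.
(* First-order condition at the maximizer: moving from x0 to x0 + t y gives 2 t b <= t^2 c for every
   t, which forces b = 0. *)
have ev y : bform G x0 y = M * frob x0 y.
  have Ht (t : R) : 2 * t * bform G x0 y + t ^+ 2 * bform G y y <= M * (2 * t * frob x0 y + t ^+ 2 * frob y y).
    have := HM (x0 + t *: y).
    rewrite !(bformDl, bformDr, bformZl, bformZr, frobDl, frobDr, frobZl, frobZr).
    rewrite (bform_sym y x0 Gs) (frobC y x0) (x0S : frob x0 x0 = 1) -/M => H.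
    rewrite -subr_ge0; rewrite -subr_ge0 in H; apply: le_trans H _; rewrite le_eqVlt; apply/orP; left; apply/eqP; ring.
  apply/eqP; rewrite -subr_eq0; set b := bform G x0 y - _; apply/negP => /negP b0.
  pose c := M * frob y y - bform G y y.
  have Hc (t : R) : 0 <= t ^+ 2 * c - 2 * t * b.
    have -> : t ^+ 2 * c - 2 * t * b = M * (2 * t * frob x0 y + t ^+ 2 * frob y y) -
        (2 * t * bform G x0 y + t ^+ 2 * bform G y y) by rewrite /b/c; ring.
    by rewrite subr_ge0; exact: Ht.
  (* For this t the inequality reads 0 <= t^2 (c - 2 (1 + |c|)), where the second factor is
     negative. *)
  pose t := b / (1 + `|c|).
  have d0 : 0 < 1 + `|c| by rewrite ltr_pwDl.
  have := Hc t; have bE : b = t * (1 + `|c|) by rewrite /t divfK// gt_eqF.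
  have t0 : t != 0 by apply: contra_neq b0 => tz; rewrite bE tz mul0r.
  have t2 : 0 < t ^+ 2 by rewrite exprn_even_gt0.
  rewrite bE (_ : _ - _ = t ^+ 2 * (c - 2 * (1 + `|c|))); last by ring.
  by rewrite pmulr_rge0//; have := ler_norm c; lra.
have evM : x0 *m G = M *: x0.
  apply/rowP => j; have := ev (delta_mx ord0 j).
  rewrite /bform trmx_delta -colE mxE => ->; rewrite mxE; congr (_ * _).
  rewrite frob_rV (bigD1 j)//= mxE !eqxx mulr1 big1 ?addr0// => k kj.
  by rewrite mxE (negPf kj) andbF mulr0.
have x0n0 : x0 != 0 by apply/eqP => x00; move: x0S; rewrite /S/= x00 frob0l => /esym/eqP; rewrite oner_eq0.
have Mm : M <= m by apply: Gm; apply/eigenvalueP; exists x0.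
apply: (@le_trans _ _ (\sum_(i < N.+1) m)); last by rewrite sumr_const card_ord mulr_natl.
apply: ler_sum => i _; rewrite -bform_delta; apply: le_trans (HM _) _.
rewrite -[frob _ _]mul1r -bform_scalar bform_delta mxE eqxx mulr1; exact: Mm.
Qed.

End frobenius.

(** * Topology and measurability on matrix spaces *)

Section matrix_topology_facts.
Context {R : realType}.

Lemma continuous_mx (T : topologicalType) m n (f : T -> 'M[R]_(m, n)) :
  (forall i j, continuous (fun x => f x i j)) -> continuous f.
Proof.
move=> cf x A [P Pn PA]; rewrite /nbhs/=.
apply: filterS (_ : nbhs x [set y | forall i j, P i j (f y i j)]).
  by move=> y Py; apply: PA.
apply: filter_forall => i; apply: filter_forall => j.
exact: (cf i j x _ (Pn i j)).
Qed.

Lemma continuous_pair (T U V : topologicalType) (f : T -> U) (g : T -> V) :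
  continuous f -> continuous g -> continuous (fun x => (f x, g x)).
Proof. by move=> cf cg x; apply: cvg_pair; [exact: cf|exact: cg]. Qed.

Definition ratr_rV n (q : 'rV[rat]_n) : 'rV[R]_n := map_mx ratr q.

Lemma rat_approx_rV n (x : 'rV[R]_n) (e : R) : 0 < e ->
  exists q : 'rV[rat]_n, forall j, `|x ord0 j - ratr (q ord0 j)| < e.
Proof.
move=> e0.
have ap j : exists r : rat, `|x ord0 j - ratr r| < e.
  have /rat_in_itvoo[r] : x ord0 j - e < x ord0 j + e by lra.
  by rewrite in_itv/= => /andP[r1 r2]; exists r; rewrite ltr_norml; apply/andP; split; lra.
have [r rP] := choice ap.
by exists (\row_j r j) => j; rewrite mxE.
Qed.

Lemma open_box_rV n (U : set 'rV[R]_n) x : open U -> U x ->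
  exists2 k : nat, (0 < k)%N & forall y : 'rV[R]_n,
    (forall j, `|x ord0 j - y ord0 j| < k%:R^-1) -> U y.
Proof.
move=> oU Ux; have : nbhs x U by exact: open_nbhs_nbhs.
move=> /nbhs_ballP[e /= e0 eU].
have [k k0 ke] : exists2 k : nat, (0 < k)%N & k%:R^-1 < e.
  have [k _ /(_ k (leqnn k)) ke] := near_infty_natSinv_lt (PosNum e0).
  by exists k.+1.
exists k => // y xy; apply: eU; split=> // i j; rewrite ord1.
by apply: lt_trans ke; exact: xy.
Qed.

(** The sigma-algebra is the one generated by the entries, so an open set is written as the
    countable union of the boxes with rational centre and radius 1/k that it contains. *)
Lemma measurable_open_rV n (U : set 'rV[R]_n) : open U -> measurable U.
Proof.
move=> oU.
pose box (p : 'rV[rat]_n * nat) := [set y : 'rV[R]_n | forall j, `|ratr (p.1 ord0 j) - y ord0 j| < p.2%:R^-1].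
have -> : U = \bigcup_(p in [set p | box p `<=` U]) box p.
  apply/seteqP; split=> [x Ux|x [p pU]]; last exact: pU.
  have [k k0 kU] := open_box_rV oU Ux.
  (* Half the radius: a box this small around a rational point near x stays within 1/k of x. *)
  have k20 : 0 < (2 * k)%:R^-1 :> R by rewrite invr_gt0 ltr0n muln_gt0.
  have [q qx] := rat_approx_rV x k20.
  have k2 : (k%:R^-1 : R) = (2 * k)%:R^-1 + (2 * k)%:R^-1.
    by rewrite natrM invfM -mulrDl -[LHS]mul1r; congr (_ * _); lra.
  exists (q, (2 * k)%N) => /=; last by move=> j; rewrite distrC.
  move=> y; rewrite /box/= => yq; apply: kU => j.
  rewrite k2 -(subrK (ratr (q ord0 j)) (x ord0 j)) -addrA.
  by apply: le_lt_trans (ler_normD _ _) _; apply: ltrD.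
rewrite bigcup_mkcond; apply: countable_bigcupT_measurable => [|p]; first exact: countableP.
case: ifPn => // _.
have -> : box p = \bigcap_(j in [set: 'I_n])
    ((fun x : 'rV[R]_n => x ord0 j) @^-1` [set r | `|ratr (p.1 ord0 j) - r| < p.2%:R^-1]).
  by apply/seteqP; split=> [x bx j _|x bx j]; [exact: bx|exact: (bx j)].
apply: fin_bigcap_measurable => // j _.
rewrite -[X in measurable X]setTI; apply: (@measurable_entry _ _ 1 n ord0 j) => //.
rewrite (_ : [set r | _] = `]ratr (p.1 ord0 j) - p.2%:R^-1, ratr (p.1 ord0 j) + p.2%:R^-1[%classic); first exact: measurable_itv.
apply/seteqP; split=> r /=; rewrite in_itv/= ltr_norml => /andP[? ?]; apply/andP; split; lra.
Qed.

Lemma continuous_measurable_rV n (f : 'rV[R]_n -> R) :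
  continuous f -> measurable_fun setT f.
Proof.
move=> cf; apply: (measurability _ (RGenOpens.measurableE R)) => _ [_ [a [b ->]] <-].
rewrite setTI; apply: measurable_open_rV.
by apply: open_comp; [move=> x _; exact: cf|exact: interval_open].
Qed.

(** The product R x R^n is transported to R^(n+1) by [rv_cons], where open sets are already known to
    be measurable. *)
Lemma continuous_measurable_R_rV n (f : R * 'rV[R]_n -> R) :
  continuous f -> measurable_fun setT f.
Proof.
move=> cf.
pose g (y : 'rV[R]_n.+1) := f (y ord0 ord0, \row_j y ord0 (lift ord0 j)).
have -> : f = g \o @rv_cons R n.
  apply/funext => -[t x]; rewrite /g /= /rv_cons; congr (f (_, _)).
    by rewrite mxE unlift_none.
  by apply/rowP => j; rewrite !mxE liftK.
apply: measurableT_comp; last exact: measurable_rv_cons.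
apply: continuous_measurable_rV.
have cp : continuous (fun y : 'rV[R]_n.+1 => (y ord0 ord0, \row_j y ord0 (lift ord0 j))).
  apply: continuous_pair; first exact: coord_continuous.
  apply: continuous_mx => i j.
  by under eq_fun do rewrite mxE; exact: coord_continuous.
by move=> y; apply: (continuous_comp (cp y)); exact: cf.
Qed.

End matrix_topology_facts.

(** * Legendre transform of an N-function *)

Section legendre_transform.
Context {R : realType} {n : nat} (K : 'rV[R]_n -> R).
Hypotheses (K_strict : strictly_convex K) (K_N : N_function K) (K0 : K 0 = 0).
Hypothesis (K_cont : continuous K).

Let K_ge0 v : 0 <= K v. Proof. by have [_ _ ->] := K_N. Qed.
Let KN v : K (- v) = K v. Proof. by have [_ -> _] := K_N. Qed.

(** Superlinear growth gives a radius beyond which K(v) >= |w| |v|, so that v.w - K(v) <= 0 there;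
    inside it Cauchy-Schwarz suffices. *)
Lemma legendre_has_sup w : has_sup [set frob v w - K v | v in [set: 'rV[R]_n]].
Proof.
split; first by exists (frob 0 w - K 0), 0.
have [_ _ _ [P1 [P2 [[_ _ _ _ P1y] _ KP]]]] := K_N.
have /(cvgryPge _).1/(_ (frob_norm w)) := P1y.
move=> [A [_ PA]]; pose A' := Num.max A 0.
exists (A' * frob_norm w + 1) => _ [v _ <-].
have w0 : 0 <= frob_norm w by exact: sqrtr_ge0.
have v0 : 0 <= frob_norm v by exact: sqrtr_ge0.
have vw := frob_CauchySchwarz v w.
have [vA|Av] := leP (frob_norm v) A'.
  have := ler_wpM2r w0 vA; have := K_ge0 v; lra.
have AA' : A <= A' by rewrite le_max lexx.
have A'0 : 0 <= A' by rewrite le_max lexx orbT.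
have vp : 0 < frob_norm v by exact: le_lt_trans Av.
have := PA (frob_norm v) (le_lt_trans AA' Av); rewrite ler_pdivlMr// => Pv.
have /andP[K1 _] := KP v.
have := mulr_ge0 A'0 w0; rewrite mulrC in Pv; lra.
Qed.

Lemma young_ineq v w : frob v w <= K v + legendre K w.
Proof.
by rewrite -lerBlDl; apply: sup_upper_bound; [exact: legendre_has_sup|exists v].
Qed.

Lemma legendre_le w c : (forall v, frob v w - K v <= c) -> legendre K w <= c.
Proof.
move=> vc; apply: ge_sup; first by have [] := legendre_has_sup w.
by move=> _ [v _ <-].
Qed.

Lemma legendre_ge0 w : 0 <= legendre K w.
Proof. by have := young_ineq 0 w; rewrite frob0l K0 add0r. Qed.

Lemma legendre0 : legendre K 0 = 0.
Proof.
apply/eqP; rewrite eq_le legendre_ge0 andbT; apply: legendre_le => v.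
by rewrite frob0r sub0r oppr_le0.
Qed.

Lemma legendreN w : legendre K (- w) = legendre K w.
Proof.
have le u : legendre K (- u) <= legendre K u.
  apply: legendre_le => v; rewrite frobNr -frobNl -KN lerBlDl; exact: young_ineq.
by apply/eqP; rewrite eq_le le -{1}(opprK w) le.
Qed.

Lemma legendre_convex (a : R) w w' : 0 <= a <= 1 ->
  legendre K (a *: w + (1 - a) *: w') <= a * legendre K w + (1 - a) * legendre K w'.
Proof.
move=> /andP[a0 a1]; apply: legendre_le => v; rewrite frobDr !frobZr.
have h1 := ler_wpM2l a0 (young_ineq v w).
have a1' : 0 <= 1 - a by lra.
have h2 := ler_wpM2l a1' (young_ineq v w'); lra.
Qed.

Lemma legendre_scale (t : R) w : `|t| <= 1 -> legendre K (t *: w) <= legendre K w.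
Proof.
have pos s : 0 <= s <= 1 -> legendre K (s *: w) <= legendre K w.
  move=> s01; have := legendre_convex w 0 s01; rewrite scaler0 addr0 legendre0 mulr0 addr0.
  move=> /le_trans; apply; have /andP[s0 s1] := s01; have := ler_wpM2r (legendre_ge0 w) s1; lra.
have [t0|t0] := leP 0 t; first by rewrite ger0_norm// => t1; apply: pos; rewrite t0.
rewrite ltr0_norm// => t1; rewrite -legendreN -scaleNr; apply: pos; apply/andP; split=> //; lra.
Qed.

Lemma N_function_scale (t : R) v : `|t| <= 1 -> K (t *: v) <= K v.
Proof.
have pos s : 0 <= s <= 1 -> K (s *: v) <= K v.
  move=> /andP[]; rewrite le_eqVlt => /predU1P[<- _|s0]; first by rewrite scale0r K0.
  rewrite le_eqVlt => /predU1P[->|s1]; first by rewrite scale1r.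
  have [->|vn0] := eqVneq v 0; first by rewrite scaler0.
  have := K_strict vn0 s0 s1; rewrite scaler0 addr0 K0 mulr0 addr0 => /ltW/le_trans; apply.
  by have := ler_wpM2r (K_ge0 v) (ltW s1); lra.
have [t0|t0] := leP 0 t; first by rewrite ger0_norm// => t1; apply: pos; rewrite t0.
rewrite ltr0_norm// => t1; rewrite -KN -scaleNr; apply: pos; apply/andP; split=> //; lra.
Qed.

(** v - w is the midpoint of 2v and -2w. Strict convexity speaks of distinct points only, hence the
    separate case 2v = -2w. *)
Lemma N_function_sub v w : K (v - w) <= K (2 *: v) + K (2 *: w).
Proof.
have [vw|vw] := eqVneq (2 *: v) (- (2 *: w)).
  have -> : v - w = 2 *: v.
    apply: (@scalerI _ _ (2 : R)) => //; rewrite scalerBr -(opprK (2 *: w)) -vw opprK.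
    by rewrite -mulr2n -scaler_nat.
  by rewrite lerDl.
have h0 : 0 < 2^-1 :> R by lra.
have h1 : 2^-1 < 1 :> R by lra.
have := K_strict vw h0 h1; rewrite KN.
have -> : 2^-1 *: (2 *: v) + (1 - 2^-1) *: - (2 *: w) = v - w.
  have -> : 1 - 2^-1 = 2^-1 :> R by lra.
  by rewrite scalerN !scalerA mulVf// !scale1r.
by have := K_ge0 (2 *: v); have := K_ge0 (2 *: w); lra.
Qed.

(** Doubling is iterated k times with |s| <= 2^k. A general f is taken so that the result serves
    both K and its Legendre transform. *)
Lemma Delta2_scale m (f : 'rV[R]_m -> R) : (forall v, 0 <= f v) ->
  (forall t v, `|t| <= 1 -> f (t *: v) <= f v) -> Delta2 f ->
  forall s : R, exists2 C, 0 < C & forall v, f (s *: v) <= C * (f v + 1).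
Proof.
move=> f0 fs [C fC] s.
have C0 : 0 <= C by have := fC 0; rewrite scaler0; have := f0 0; nra.
have pw k : exists2 D, 0 < D & forall v, f (2 ^+ k *: v) <= D * (f v + 1).
  elim: k => [|k [D D0 IH]].
    by exists 1 => // v; rewrite expr0 scale1r mul1r; lra.
  exists (C * (D + 1) + 1); first by rewrite ltr_wpDl// mulr_ge0//; lra.
  move=> v; rewrite exprS -scalerA; apply: le_trans (fC _) _.
  have := IH v; set a := f (_ *: v); set b := f v; have b0 : 0 <= b by exact: f0.
  move=> ab; have := ler_wpM2l C0 (ltac:(lra) : a + 1 <= (D + 1) * (b + 1)).
  by lra.
have [k sk] : exists k, `|s| <= 2 ^+ k.
  exists (Num.truncn `|s|).+1; apply: ltW; apply: lt_le_trans (truncnS_gt _) _.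
  by rewrite -natrX ler_nat; apply: ltnW; exact: ltn_expl.
have [D D0 fD] := pw k; exists D => // v; apply: le_trans (fD v).
have -> : s *: v = (s / 2 ^+ k) *: (2 ^+ k *: v) by rewrite scalerA divfK// expf_neq0.
by apply: fs; rewrite normrM normfV (ger0_norm (exprn_ge0 _ _))// ler_pdivrMr ?exprn_gt0// mul1r.
Qed.

Definition rational_point (k : nat) : 'rV[R]_n := ratr_rV (odflt 0 (unpickle k)).

(** The start 0 is the value of v.w - K(v) at v = 0, since K(0) = 0; it keeps the approximations
    nonnegative. *)
Fixpoint legendre_seq (k : nat) (w : 'rV[R]_n) : R :=
  if k is k'.+1 then
    Num.max (legendre_seq k' w) (frob (rational_point k') w - K (rational_point k'))
  else 0.

(** A measurable selection with finitely many values of a point attaining [legendre_seq], later used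
    as a test function. *)
Fixpoint legendre_arg (k : nat) (w : 'rV[R]_n) : 'rV[R]_n :=
  if k is k'.+1 then
    if legendre_seq k' w < frob (rational_point k') w - K (rational_point k')
    then rational_point k' else legendre_arg k' w
  else 0.

Lemma legendre_argE k w :
  legendre_seq k w = frob (legendre_arg k w) w - K (legendre_arg k w).
Proof.
elim: k => [|k IH] /=; first by rewrite frob0l K0 subr0.
by case: ltP => // _.
Qed.

(** The sequence is nondecreasing and below the supremum; by continuity of K and density of the
    rational points it comes within any e of it. *)
Lemma legendre_seq_cvg w : legendre_seq k w @[k --> \oo] --> legendre K w.
Proof.
have nd : nondecreasing_seq (legendre_seq ^~ w).
  by apply/nondecreasing_seqP => k /=; rewrite le_max lexx.
have ub k : legendre_seq k w <= legendre K w.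
  by rewrite legendre_argE lerBlDl; exact: young_ineq.
apply/cvgrPdist_lt => e e0.
have [_ [v _ <-]] := sup_adherent (ltac:(lra) : 0 < e / 2) (legendre_has_sup w).
rewrite -/(legendre K w) => vK.
have cg : continuous (fun v => frob v w - K v).
  move=> u; apply: (@continuousB _ _ _ (fun v => frob v w) K); last exact: K_cont.
  exact: continuous_frobl.
have [k kv] : exists k, legendre K w - e < frob (rational_point k) w - K (rational_point k).
  have oU : open [set v | legendre K w - e < frob v w - K v].
    by apply: (@open_comp _ _ (fun v => frob v w - K v) [set r | legendre K w - e < r]);
      [move=> ? _; exact: cg|exact: open_gt].
  have [|k k0 kU] := open_box_rV oU (x := v); first by rewrite /=; lra.
  have [q qv] := rat_approx_rV v (ltac:(by rewrite invr_gt0 ltr0n) : 0 < k%:R^-1 :> R).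
  by exists (pickle q); rewrite /rational_point pickleK/=; apply: kU => j; rewrite mxE.
exists k.+1 => // m /= km; rewrite ger0_norm ?subr_ge0//.
have := nd _ _ km; rewrite /= ge_max => /andP[_]; lra.
Qed.

Lemma measurable_legendre : measurable_fun setT (legendre K).
Proof.
have ms k : measurable_fun setT (legendre_seq k).
  elim: k => [|k IH] /=; first exact: measurable_cst.
  apply: measurable_maxr => //; apply: measurable_funB; last exact: measurable_cst.
  by apply: continuous_measurable_rV; exact: continuous_frobr.
apply: (measurable_fun_cvg (h := legendre_seq)) => // w _; exact: legendre_seq_cvg.
Qed.

End legendre_transform.

(** * Smooth test functions *)

Section smoothness.
Context {R : realType}.

Lemma smooth_continuous {V W : normedModType R} (f : V -> W) : smooth f -> continuous f.
Proof. by move=> /(_ 0%N). Qed.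

Lemma smooth_derivable {V W : normedModType R} (f : V -> W) x v : smooth f -> derivable f x v.
Proof. by move=> /(_ 1%N)[_ /(_ v)[]]. Qed.

Lemma smooth_derive {V W : normedModType R} (f : V -> W) v : smooth f -> smooth ('D_v f).
Proof. by move=> sf k; have [_ /(_ v)[]] := sf k.+1. Qed.

Lemma class_CD k {V W : normedModType R} (f g : V -> W) :
  class_C k f -> class_C k g -> class_C k (fun x => f x + g x).
Proof.
elim: k f g => [|k IH] f g /=.
  by move=> cf cg x; apply: (@continuousD _ _ _ f g); [exact: cf|exact: cg].
move=> [cf df] [cg dg]; split.
  by move=> x; apply: (@continuousD _ _ _ f g); [exact: cf|exact: cg].
move=> v; have [dfv Cf] := df v; have [dgv Cg] := dg v; split.
  by move=> x; apply: (@derivableD _ _ _ f g).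
rewrite (_ : 'D_v _ = fun x => 'D_v f x + 'D_v g x); first exact: IH.
by apply/funext => x; rewrite -deriveD.
Qed.

Lemma class_CZ k {V W : normedModType R} (c : R) (f : V -> W) :
  class_C k f -> class_C k (fun x => c *: f x).
Proof.
elim: k f => [|k IH] f /=.
  by move=> cf x; apply: cvgZr; exact: cf.
move=> [cf df]; split; first by move=> x; apply: cvgZr; exact: cf.
move=> v; have [dfv Cf] := df v; split; first by move=> x; exact: derivableZ.
rewrite (_ : 'D_v _ = fun x => c *: 'D_v f x); first exact: IH.
by apply/funext => x; rewrite -deriveZ.
Qed.

Lemma class_C_cst k {V W : normedModType R} (c : W) : class_C k (fun _ : V => c).
Proof.
elim: k c => [|k IH] c /=; first exact: cst_continuous.
split; first exact: cst_continuous.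
move=> v; split; first by move=> x; exact: derivable_cst.
rewrite (_ : 'D_v _ = fun=> 0); first exact: IH.
by apply/funext => x; rewrite derive_cst.
Qed.

Lemma is_derive_scale_prod {V W : normedModType R} (phi : R -> R) (psi : V -> W)
    (a t : R) (v x : V) :
  derivable phi t a -> derivable psi x v -> continuous psi ->
  is_derive (t, x) (a, v) (fun p : R * V => phi p.1 *: psi p.2)
    ('D_a phi t *: psi x + phi t *: 'D_v psi x).
Proof.
move=> dphi dpsi cpsi.
suff cvgD : (fun h : R => h^-1 *: (((fun p : R * V => phi p.1 *: psi p.2) \o shift (t, x)) (h *: (a, v)) - phi t *: psi x)) @ 0^' --> 'D_a phi t *: psi x + phi t *: 'D_v psi x.
  apply: DeriveDef; first by apply/cvg_ex; eexists; exact: cvgD.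
  exact: cvg_lim cvgD.
rewrite (_ : (fun h => _) = fun h => (h^-1 *: (phi (h *: a + t) - phi t)) *: psi (h *: v + x)
   + phi t *: (h^-1 *: (psi (h *: v + x) - psi x))); last first.
  apply/funext => h /=.
  rewrite -scalerA (scalerA (phi t)) (mulrC (phi t)) -scalerA -scalerDr; congr (_ *: _).
  by rewrite scalerBl scalerBr addrA subrK.
apply: cvgD.
  apply: cvgZ; first exact: dphi.
  have cl : (fun h : R => h *: v + x) @ 0^' --> x.
    apply: cvg_within_filter.
    have : (fun h : R => h *: v + x) @ 0 --> 0 *: v + x.
      by apply: cvgD; [apply: cvgZr_tmp; exact: cvg_id|exact: cvg_cst].
    by rewrite scale0r add0r.
  exact: (cvg_comp _ _ cl (cpsi x)).
apply: cvgZr; exact: dpsi.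
Qed.

Lemma continuous_scale_prod {V W : normedModType R} (phi : R -> R) (psi : V -> W) :
  continuous phi -> continuous psi -> continuous (fun p : R * V => phi p.1 *: psi p.2).
Proof.
move=> cphi cpsi p.
have cf : continuous (fst : R * V -> R) by move=> q; exact: cvg_fst.
have cs : continuous (snd : R * V -> V) by move=> q; exact: cvg_snd.
apply: (@cvgZ _ _ _ _ _ (fun p : R * V => phi p.1) (fun p : R * V => psi p.2)).
  exact: (continuous_comp (cf p) (cphi _)).
exact: (continuous_comp (cs p) (cpsi _)).
Qed.

(** The induction runs over all pairs of smooth factors at once, because a directional derivative of
    the product is a sum of two such products. *)
Lemma smooth_scale_prod {V W : normedModType R} (phi : R -> R) (psi : V -> W) :
  smooth phi -> smooth psi -> smooth (fun p : R * V => phi p.1 *: psi p.2).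
Proof.
move=> sphi spsi k; elim: k phi psi sphi spsi => [|k IH] phi psi sphi spsi.
  by apply: continuous_scale_prod; exact: smooth_continuous.
have c := continuous_scale_prod (smooth_continuous sphi) (smooth_continuous spsi).
split=> // -[a v].
have D t x := is_derive_scale_prod (@smooth_derivable _ _ phi t a sphi)
  (@smooth_derivable _ _ psi x v spsi) (smooth_continuous spsi).
split; first by move=> [t x]; have [] := D t x.
rewrite (_ : 'D_(a, v) _ = fun p => 'D_a phi p.1 *: psi p.2 + phi p.1 *: 'D_v psi p.2).
  apply: (@class_CD k _ _ (fun p : R * V => 'D_a phi p.1 *: psi p.2)
    (fun p : R * V => phi p.1 *: 'D_v psi p.2)).
    exact: (IH _ _ (smooth_derive a sphi) spsi).
  exact: (IH _ _ sphi (smooth_derive v spsi)).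
by apply/funext => -[t x]; have [_ ->] := D t x.
Qed.

Section slices.
Context {d : nat} {W : normedModType R}.
Implicit Types (Phi : R * 'rV[R]_d -> W) (psi : 'rV[R]_d -> W).

Lemma derive_slice Phi t (v x : 'rV[R]_d) :
  'D_v (fun y => Phi (t, y)) x = 'D_((0, v) : R * 'rV[R]_d) Phi (t, x).
Proof.
rewrite /derive (_ : (fun h : R => h^-1 *: (((fun y => Phi (t, y)) \o shift x) (h *: v) - Phi (t, x))) =
  fun h : R => h^-1 *: ((Phi \o shift (t, x)) (h *: ((0, v) : R * 'rV[R]_d)) - Phi (t, x)))//.
apply/funext => h /=; congr (_ *: (_ - _)); congr (Phi _).
by apply: injective_projections => /=; rewrite ?scaler0 ?add0r.
Qed.

(** Spatial derivatives at frozen time, taken as derivatives of the function of (t, x) in directions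
    (0, e_i): this yields their joint continuity in time and space. *)
Definition slice_multi_deriv q (al : {ffun 'I_d -> 'I_q.+1}) Phi : R * 'rV[R]_d -> W :=
  foldr (fun i g => iter (al i)
    (fun f => 'D_((0, delta_mx ord0 i) : R * 'rV[R]_d) f) g) Phi (enum 'I_d).

Lemma multi_deriv_slice q (al : {ffun 'I_d -> 'I_q.+1}) Phi t x :
  multi_deriv al (fun y => Phi (t, y)) x = slice_multi_deriv al Phi (t, x).
Proof.
rewrite /multi_deriv /slice_multi_deriv.
elim: (enum 'I_d) x => [//|i s IH] /=.
elim: (nat_of_ord (al i)) => [//|k IHk] x /=.
rewrite /partial -derive_slice; congr ('D_ _ _ _); apply/funext => y; exact: IHk.
Qed.

Lemma smooth_slice_multi_deriv q (al : {ffun 'I_d -> 'I_q.+1}) Phi :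
  smooth Phi -> smooth (slice_multi_deriv al Phi).
Proof.
move=> sP; rewrite /slice_multi_deriv; elim: (enum 'I_d) => [//|i s IH] /=.
elim: (nat_of_ord (al i)) => [//|k IHk] /=; exact: smooth_derive.
Qed.

Lemma smooth_multi_deriv q (al : {ffun 'I_d -> 'I_q.+1}) psi :
  smooth psi -> smooth (multi_deriv al psi).
Proof.
move=> sP; rewrite /multi_deriv; elim: (enum 'I_d) => [//|i s IH] /=.
elim: (nat_of_ord (al i)) => [//|k IHk] /=; exact: smooth_derive.
Qed.

Lemma multi_derivZ q (al : {ffun 'I_d -> 'I_q.+1}) (c : R) psi : smooth psi ->
  multi_deriv al (fun x => c *: psi x) = fun x => c *: multi_deriv al psi x.
Proof.
move=> sP; rewrite /multi_deriv.
(* Smoothness is carried through the fold so that each differentiation may pull out the scalar. *)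
pose P (g h : 'rV[R]_d -> W) := smooth h /\ g = fun x => c *: h x.
suff : P (foldr (fun i g => iter (al i) (partial i) g) (fun x => c *: psi x) (enum 'I_d))
         (foldr (fun i g => iter (al i) (partial i) g) psi (enum 'I_d)) by case.
elim: (enum 'I_d) => [|i s IH] //=.
elim: (nat_of_ord (al i)) => [//|k [sk IHk]] /=.
split; first exact: smooth_derive.
rewrite IHk; apply/funext => x; rewrite /partial deriveZ//; exact: smooth_derivable.
Qed.

End slices.

Section operator.
Context {d n N : nat} (L : diff_operator R d n N).

Lemma continuous_op_apply_slice (Psi : R * 'rV[R]_d -> 'M[R]_N) : smooth Psi ->
  continuous (fun p => op_apply L (fun x => Psi (p.1, x)) p.2).
Proof.
move=> sP; apply: continuous_mx => i j.
under eq_fun do rewrite mxE.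
apply: continuous_sum => al.
under eq_fun => p do rewrite (multi_deriv_slice al Psi p.1 p.2) -surjective_pairing.
have c := smooth_continuous (smooth_slice_multi_deriv al sP).
apply: continuous_sum => a; apply: continuous_sum => b; apply: continuous_fM.
  exact: cst_continuous.
exact: continuous_entry.
Qed.

Lemma continuous_op_apply (psi : 'rV[R]_d -> 'M[R]_N) : smooth psi ->
  continuous (op_apply L psi).
Proof.
move=> sP; apply: continuous_mx => i j; rewrite /op_apply.
under eq_fun do rewrite mxE.
apply: continuous_sum => al.
have c := smooth_continuous (smooth_multi_deriv al sP).
apply: continuous_sum => a; apply: continuous_sum => b; apply: continuous_fM.
  exact: cst_continuous.
exact: continuous_entry.
Qed.

Lemma op_applyZ (c : R) (psi : 'rV[R]_d -> 'M[R]_N) x : smooth psi ->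
  op_apply L (fun y => c *: psi y) x = c *: op_apply L psi x.
Proof.
move=> sP; apply/rowP => j; rewrite !mxE mulr_sumr; apply: eq_bigr => al _.
by rewrite multi_derivZ// frobZr.
Qed.

End operator.

End smoothness.

(** * Sigmoids and localization in time *)

Section sigmoid.
Context {R : realType}.

Lemma derive_direction (f : R -> R) (t v : R) : derivable f t 1 ->
  derivable f t v /\ 'D_v f t = v * 'D_1 f t.
Proof.
move=> /derivable1_diffP df; split; first exact: diff_derivable.
by rewrite !deriveE// -[v in LHS]mulr1 -[v * 1]/(v *: 1) linearZ.
Qed.

Definition sigmoid (a s t : R) : R := (1 + expR (- (a * (t - s))))^-1.

(** An antiderivative of [sigmoid a s]; differences of two of these are the time factors of the test
    functions. *)
Definition softplus (a s t : R) : R := ln (1 + expR (a * (t - s))) / a.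

Lemma sigmoid_den_gt0 a s t : 0 < 1 + expR (- (a * (t - s))) :> R.
Proof. by rewrite ltr_pwDl// expR_ge0. Qed.

Lemma sigmoid_gt0_lt1 a s t : 0 < sigmoid a s t < 1.
Proof.
rewrite /sigmoid invr_gt0 sigmoid_den_gt0/= invf_lt1 ?sigmoid_den_gt0//.
by rewrite ltrDl expR_gt0.
Qed.

Lemma is_derive_expR_affine (a s t : R) :
  is_derive t (1 : R) (fun t => expR (a * (t - s))) (a * expR (a * (t - s))).
Proof.
have H : is_derive t (1 : R) (fun t => a * (t - s)) a.
  have : is_derive t (1 : R) (a \*: (id - cst s : R -> R)) (a *: (1 - 0)) by apply: is_deriveZ.
  by rewrite subr0 [_ *: 1]mulr1.
rewrite mulrC; exact: (@is_derive1_comp _ expR (fun t => a * (t - s))).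
Qed.

Lemma is_derive_sigmoid (a s t : R) :
  is_derive t (1 : R) (sigmoid a s) (a * (sigmoid a s t * (1 - sigmoid a s t))).
Proof.
pose f t := 1 + expR (- a * (t - s)).
have fE t' : 1 + expR (- (a * (t' - s))) = f t' by rewrite /f mulNr.
have f0 t' : f t' != 0 by rewrite -fE gt_eqF// sigmoid_den_gt0.
have [d E] : is_derive t (1 : R) f (0 + - a * expR (- a * (t - s))).
  by apply: is_deriveD; exact: is_derive_expR_affine.
have -> : sigmoid a s = fun t => (f t)^-1 by apply/funext => t'; rewrite /sigmoid fE.
apply: DeriveDef; first exact: derivableV.
rewrite deriveV// E add0r /f.
have := f0 t; rewrite /f; set e := expR _ => e0.
by rewrite /GRing.scale/=; field.
Qed.

Lemma is_derive_softplus (a s t : R) : 0 < a ->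
  is_derive t (1 : R) (softplus a s) (sigmoid a s t).
Proof.
move=> a0; pose f t := 1 + expR (a * (t - s)).
have f0 t' : 0 < f t' by rewrite /f ltr_pwDl// expR_ge0.
have D : is_derive t (1 : R) f (0 + a * expR (a * (t - s))).
  by apply: is_deriveD; exact: is_derive_expR_affine.
have L := is_derive1_comp (is_derive1_ln (f0 t)) D.
have -> : softplus a s = fun t => a^-1 *: (@ln R \o f) t.
  by apply/funext => t'; rewrite /softplus /GRing.scale/= mulrC.
suff <- : a^-1 *: ((f t)^-1 * (0 + a * expR (a * (t - s))) : R) = sigmoid a s t by apply: is_deriveZ.
rewrite add0r /sigmoid expRN /f; set e := expR _.
have e0 : 0 < e by exact: expR_gt0.
rewrite /GRing.scale/=; field; rewrite ?gt_eqF//=; lra.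
Qed.

(** Since the derivative of the sigmoid f is a f (1 - f), polynomials in f are stable under
    differentiation, so induction over all polynomials at once gives every order. *)
Lemma class_C_sigmoid k (a s : R) (p : {poly R}) : class_C k (fun t : R => p.[sigmoid a s t]).
Proof.
have D q t : is_derive t (1 : R) (fun t : R => q.[sigmoid a s t])
    ((a *: (q^`() * 'X * (1 - 'X))).[sigmoid a s t]).
  apply: is_derive_eq.
    exact: (@is_derive1_comp _ (horner q) (sigmoid a s) t _ _ (is_derive_poly _ _) (is_derive_sigmoid a s t)).
  by rewrite hornerZ !hornerM hornerX hornerD hornerN hornerX hornerC mulrCA !mulrA.
have C q : continuous (fun t : R => q.[sigmoid a s t]).
  by move=> t; apply/differentiable_continuous/derivable1_diffP; have [] := D q t.
elim: k p => [|k IH] p /=; first exact: C.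
split=> // v.
have [dv Dv] : (forall t, derivable (fun t : R => p.[sigmoid a s t]) t v) /\
    'D_v (fun t : R => p.[sigmoid a s t]) = fun t => (v *: (a *: (p^`() * 'X * (1 - 'X)))).[sigmoid a s t].
  split.
    by move=> t; have [d1 _] := D p t; have [] := derive_direction v d1.
  apply/funext => t; have [d1 E1] := D p t; have [_ ->] := derive_direction v d1.
  by rewrite E1 [in RHS]hornerZ.
by split=> //; rewrite Dv.
Qed.

Lemma smooth_softplus a s : 0 < a -> smooth (softplus a s).
Proof.
move=> a0.
have C : continuous (softplus a s).
  by move=> t; apply/differentiable_continuous/derivable1_diffP; have [] := is_derive_softplus s t a0.
case=> [|k] //=; split=> // v; split.
  by move=> t; have [d1 _] := is_derive_softplus s t a0; have [] := derive_direction v d1.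
rewrite (_ : 'D_v _ = fun t => (v *: 'X).[sigmoid a s t]); first exact: class_C_sigmoid.
apply/funext => t; have [d1 E1] := is_derive_softplus s t a0; have [_ ->] := derive_direction v d1.
by rewrite E1 hornerZ hornerX.
Qed.

(** Only exp(x) >= 1 + x is used: the decay 1/x is crude but enough for pointwise convergence. *)
Lemma sigmoid_far (a s t : R) :
  (0 < a * (t - s) -> 1 - sigmoid a s t <= (a * (t - s))^-1) /\
  (0 < a * (s - t) -> sigmoid a s t <= (a * (s - t))^-1).
Proof.
have E : sigmoid a s t * (1 + expR (- (a * (t - s)))) = 1.
  by rewrite /sigmoid mulVf// gt_eqF// sigmoid_den_gt0.
have /andP[s0 s1] := sigmoid_gt0_lt1 a s t.
split=> x0.
  set x := a * (t - s) in E x0 *; have := expR_ge1Dx x; have := expR_gt0 x; have := expRN x.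
  set e := expR x; set e' := expR (- x) in E *; set g := sigmoid a s t in E s0 s1 * => e'E e0 ex.
  rewrite -[leRHS]mul1r ler_pdivlMr//.
  have e'1 : e' * e = 1 by rewrite e'E mulVf// gt_eqF.
  have -> : 1 - g = g * e' by rewrite -E; ring.
  have ge : 0 <= g * e' by apply: mulr_ge0; [exact: ltW|rewrite e'E invr_ge0; exact: ltW].
  have : g * e' * x <= g * e' * e by apply: ler_wpM2l => //; lra.
  by rewrite -[X in _ <= X -> _]mulrA e'1 mulr1; lra.
have xE : - (a * (t - s)) = a * (s - t) by ring.
rewrite xE in E; set x := a * (s - t) in E x0 *; have := expR_ge1Dx x.
set e := expR x in E *; set g := sigmoid a s t in E s0 s1 * => ex.
rewrite -[leRHS]mul1r ler_pdivlMr// -E.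
apply: ler_wpM2l; lra.
Qed.

(** The switching points move with k because they will be rational approximations of s. *)
Lemma sigmoid_cvg (s t : R) (s_ : R^nat) : t != s -> s_ @ \oo --> s ->
  sigmoid k.+1%:R (s_ k) t @[k --> \oo] --> (if s < t then 1 else 0 : R).
Proof.
move=> ts sc; apply/cvgrPdist_lt => e e0.
(* Half the distance: once s_ k is within del of s, it stays at distance at least del from t, on the
   same side as s. *)
pose del := `|t - s| / 2.
have del0 : 0 < del by rewrite divr_gt0// normr_gt0 subr_eq0.
have /cvgrPdist_lt/(_ _ del0) sd := sc.
have ed : 0 < e * del by rewrite mulr_gt0.
have kd := near_infty_natSinv_lt (PosNum ed).
near=> k.
have sk : `|s - s_ k| < del by near: k.
have ke : k.+1%:R^-1 < e * del by near: k.
have k0 : 0 < k.+1%:R :> R by [].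
have big u : del <= u -> 0 < k.+1%:R * u /\ (k.+1%:R * u)^-1 < e.
  move=> du; have u0 := lt_le_trans del0 du; split; first by rewrite mulr_gt0.
  rewrite invfM ltr_pdivrMr//; apply: (lt_le_trans ke); rewrite ler_pM2l//.
have /andP[g0 g1] := sigmoid_gt0_lt1 k.+1%:R (s_ k) t.
have [f1 f2] := sigmoid_far k.+1%:R (s_ k) t.
move: sk; rewrite ltr_norml => /andP[sk1 sk2].
case: (ltgtP s t) => st.
- have delE : del = (t - s) / 2 by rewrite /del ger0_norm// subr_ge0 ltW.
  have [b1 b2] := big (t - s_ k) (ltac:(lra)).
  rewrite ger0_norm; last lra.
  exact: le_lt_trans (f1 b1) b2.
- have delE : del = (s - t) / 2 by rewrite /del distrC ger0_norm// subr_ge0 ltW.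
  have [b1 b2] := big (s_ k - t) (ltac:(lra)).
  rewrite sub0r normrN ger0_norm; last lra.
  exact: le_lt_trans (f2 b1) b2.
- by rewrite st eqxx in ts.
Unshelve. all: by end_near. Qed.

End sigmoid.

(** * Nonnegativity almost everywhere on a time interval *)

Lemma ae_imp disp (X : measurableType disp) (R : realType) (mu : {measure set X -> \bar R})
    (P Q : X -> Prop) : (\forall x \ae mu, P x) -> (forall x, P x -> Q x) ->
  \forall x \ae mu, Q x.
Proof. by move=> aeP PQ; apply: filterS aeP. Qed.

Lemma ae_and disp (X : measurableType disp) (R : realType) (mu : {measure set X -> \bar R})
    (P Q : X -> Prop) : (\forall x \ae mu, P x) -> (\forall x \ae mu, Q x) ->
  \forall x \ae mu, P x /\ Q x.
Proof. exact: filterI. Qed.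

Lemma integrable_cst_on disp (X : measurableType disp) (R : realType) (D : set X)
    (mu : {measure set X -> \bar R}) (c : R) : measurable D -> (mu D < +oo)%E ->
  mu.-integrable D (EFin \o cst c).
Proof.
move=> mD Dy; apply/integrableP; split; first by apply/measurable_EFinP; exact: measurable_cst.
rewrite (_ : (fun y => _) = cst (`|c|%:E)) //= integral_cst//=.
by rewrite lte_mul_pinfty.
Qed.

Lemma eq_integral_patch disp (X : measurableType disp) (R : realType)
    (mu : {measure set X -> \bar R}) (A B : set X) (f g : X -> \bar R) :
  (forall x, (f \_ A) x = (g \_ B) x) ->
  (\int[mu]_(x in A) f x = \int[mu]_(x in B) g x)%E.
Proof.
by move=> fg; rewrite integral_mkcond [RHS]integral_mkcond; congr integral; apply/funext.
Qed.

(** Used with c = f(x) < 0 on small balls around x, where it keeps the mean deviation from f(x)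
    above the positive number -f(x). *)
Lemma integral_deviation_ge disp (X : measurableType disp) (R : realType) (D : set X)
    (mu : {measure set X -> \bar R}) (f : X -> R) (c m : R) :
  measurable D -> mu D = m%:E -> mu.-integrable D (EFin \o f) ->
  0 <= \int[mu]_(y in D) f y ->
  ((- c * m)%:E <= \int[mu]_(y in D) `|(f y - c)%:E|)%E.
Proof.
move=> mD Dm itf f0.
have itc : mu.-integrable D (EFin \o cst c) by apply: integrable_cst_on; rewrite // Dm ltry.
have itd : mu.-integrable D (EFin \o (fun y => f y - c)) by exact: (integrableB mD itf itc).
have itn : mu.-integrable D (EFin \o (fun y => `|f y - c|)) by exact: integrable_norm itd.
have -> : (\int[mu]_(y in D) `|(f y - c)%:E| = (\int[mu]_(y in D) `|f y - c|)%:E)%E.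
  by rewrite /Rintegral fineK//; exact: (integrable_fin_num mD itn).
rewrite lee_fin; apply: (@le_trans _ _ (\int[mu]_(y in D) (f y - c))).
  by rewrite RintegralB// (Rintegral_cst mu mD) Dm/= mulNr; lra.
by apply: le_Rintegral => // y _; exact: ler_norm.
Qed.

Lemma measurable_patch disp (X : measurableType disp) (R : realType) (D : set X)
    (f : X -> \bar R) : measurable D -> measurable_fun setT f ->
  measurable_fun setT (f \_ D).
Proof. by move=> mD mf; apply/(measurable_restrictT _ mD).1; exact: measurable_funTS. Qed.

Lemma measurable_sigmoid (R : realType) (a s : R) :
  measurable_fun (setT : set (measurableTypeR R)) (sigmoid a s).
Proof.
apply: continuous_measurable_fun => t; apply/differentiable_continuous/derivable1_diffP.
by have [] := is_derive_sigmoid a s t.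
Qed.

Section interval_measure.
Context {R : realType} (T : R).
Local Notation RT := (measurableTypeR R).
Local Notation lam := (lebesgue_measure : {measure set RT -> \bar R}).
Local Notation mu := (lebesgue_oitv T : {finite_measure set RT -> \bar R}).
Local Notation D := (`]0%R, T[%classic : set RT).

Lemma lebesgue_oitvE (A : set RT) : mu A = lam (A `&` D).
Proof. by []. Qed.

Lemma ae_lebesgue_oitv (P : set RT) :
  (\forall t \ae lam, D t -> P t) -> \forall t \ae mu, P t.
Proof.
move=> [N [mN N0 NP]]; exists (N `|` ~` D); split.
- by apply: measurableU => //; apply: measurableC; exact: measurable_itv.
- rewrite lebesgue_oitvE setIUl setICl setU0.
  apply/eqP; rewrite eq_le measure_ge0 andbT -[leRHS]N0.
  by apply: le_measure; rewrite ?inE//; apply: measurableI => //; exact: measurable_itv.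
- move=> t /= nPt; have [Dt|nDt] := pselect (D t); last by right.
  by left; apply: NP => /= H; apply: nPt; exact: H.
Qed.

Lemma ae_lebesgue_oitv_dom : \forall t \ae mu, 0 < t < T.
Proof. by apply: ae_lebesgue_oitv; apply: aeW => t; rewrite /= in_itv. Qed.

Lemma integral_lebesgue_oitv (f : RT -> \bar R) : measurable_fun setT f ->
  (\int[mu]_t f t = \int[lam]_(t in D) f t)%E.
Proof.
move=> mf; have mD : measurable (D : set RT) by exact: measurable_itv.
transitivity (\int[mu]_t (f \_ D) t)%E.
  apply: ae_eq_integral => //.
    exact: measurable_patch.
  apply: (@ae_imp _ _ _ mu _ _ ae_lebesgue_oitv_dom) => t tD _; rewrite patchE ifT//.
  by rewrite inE /= in_itv.
rewrite -integral_mkcond; apply: eq_measure_integral => A mA AD.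
by rewrite /= /lebesgue_oitv /mfrestr /mrestr setIidl.
Qed.

Lemma integrable_lebesgue_oitv (f : RT -> R) : mu.-integrable setT (EFin \o f) ->
  lam.-integrable D (EFin \o f).
Proof.
move=> /integrableP[mf fy]; apply/integrableP; split; first exact: measurable_funS mf.
by rewrite -integral_lebesgue_oitv//; exact: measurableT_comp.
Qed.

Lemma ae_neq_lebesgue_oitv (s : R) : \forall t \ae mu, t != s.
Proof.
apply: ae_lebesgue_oitv; exists [set s]; split => //; first exact: lebesgue_measure_set1.
by move=> t /= /not_implyP[_ /negP]; rewrite negbK => /eqP.
Qed.

(** At a Lebesgue point x with f(x) < 0 the mean of |f - f(x)| over small balls tends to 0, while
    nonnegative integrals over intervals keep it at least -f(x). *)
Lemma ae_ge0_of_intervals (f : RT -> R) : mu.-integrable setT (EFin \o f) ->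
  (forall s r, s < r -> 0 <= \int[mu]_t (\1_(`]s, r[%classic : set RT) t * f t)) ->
  \forall t \ae mu, 0 <= f t.
Proof.
move=> itf fI; apply: ae_lebesgue_oitv.
have mD : measurable (D : set RT) by exact: measurable_itv.
have itfD := integrable_lebesgue_oitv itf.
have leb : \forall x \ae lam, lebesgue_pt (f \_ D : R -> R) x.
  exact: lebesgue_differentiation (integrable_locally_restrict mD itfD).
apply: (@ae_imp _ _ _ lam _ _ leb) => x; rewrite /lebesgue_pt => lpt Dx.
rewrite leNgt; apply/negP => fx0.
pose f0 := f \_ D.
have f0x : f0 x = f x by rewrite /f0 patchE mem_set.
have : \forall r \near (0:R)^'+, (davg f0 x r < (- f x)%:E)%E.
  apply: (lpt [set y : \bar R | (y < (- f x)%:E)%E]).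
  apply: open_nbhs_nbhs; split; first exact: open_ereal_lt_ereal.
  by rewrite /= lte_fin; lra.
have r0 : \forall r \near (0:R)^'+, 0 < r by exact: nbhs_right_gt.
move=> /(filterI r0)/filter_ex[r [{}r0 davgr]].
have mB : measurable (ball x r : set RT) by exact: measurable_ball.
have muB : lam (ball x r : set RT) = (r *+ 2)%:E := lebesgue_measure_ball x (ltW r0).
have itf0 : lam.-integrable setT (EFin \o f0).
  by rewrite /f0 -restrict_EFin; apply/(integrable_mkcond _ mD).
have itB : lam.-integrable (ball x r) (EFin \o f0) by exact: integrableS itf0.
have int0 : 0 <= \int[lam]_(y in ball x r) f0 y.
  have := fI (x - r) (x + r) (ltac:(lra)).
  have -> : \int[mu]_t (\1_(`](x - r), (x + r)[%classic : set RT) t * f t) = \int[lam]_(y in ball x r) f0 y.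
    rewrite /Rintegral integral_lebesgue_oitv; last first.
      apply/measurable_EFinP; apply: measurable_funM; last exact: itg_measurable itf.
      exact: measurable_indic.
    congr fine; apply: (@eq_integral_patch _ RT R lam) => y.
    rewrite !patchE /f0 patchE ball_itv indicE.
    case: ifPn => yD; case: ifPn => yB //=; rewrite ?mul1r ?mul0r//.
  by [].
have : ((- f x)%:E <= davg f0 x r)%E.
  rewrite /davg /iavg muB.
  have rr : (0 < r *+ 2)%R by rewrite mulrn_wgt0.
  have E : ((- f x * (r *+ 2))%:E <= \int[lam]_(y in ball x r) `|(f0 y - f x)%:E|)%E.
    exact: (@integral_deviation_ge _ RT R _ lam _ _ _ mB muB itB int0).
  rewrite -[X in (X <= _)%E](_ : ((r *+ 2)^-1%:E * (- f x * (r *+ 2))%:E)%E = _); last first.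
    by rewrite -EFinM mulrC mulfK// gt_eqF.
  rewrite inver gt_eqF// f0x; apply: lee_wpmul2l; last exact: E.
  by rewrite lee_fin invr_ge0 ltW.
by rewrite leNgt davgr.
Qed.

(** Differences g_k of sigmoids tend to the indicator of an interval away from its endpoints.
    Fatou's lemma for |f| - g_k f, which is nonnegative as |g_k| <= 1, carries the sign of the
    integrals to the limit. *)
Lemma ae_ge0_of_sigmoids (f : RT -> R) : mu.-integrable setT (EFin \o f) ->
  (forall (k : nat) (s r : rat), ratr s < ratr r :> R ->
    0 <= \int[mu]_t ((sigmoid k.+1%:R (ratr s) t - sigmoid k.+1%:R (ratr r) t) * f t)) ->
  \forall t \ae mu, 0 <= f t.
Proof.
move=> itf fS; apply: ae_ge0_of_intervals => // s r sr.
have k1 (k : nat) : 0 < k.+1%:R^-1 :> R by rewrite invr_gt0.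
(* The endpoints are approached from outside the interval, which keeps the rational parameters in
   strict order. *)
have exs k : exists q : rat, s - k.+1%:R^-1 < ratr q < s.
  have /rat_in_itvoo[q] : s - k.+1%:R^-1 < s by rewrite ltrBlDr ltrDl.
  by rewrite in_itv; exists q.
have exr k : exists q : rat, r < ratr q < r + k.+1%:R^-1.
  have /rat_in_itvoo[q] : r < r + k.+1%:R^-1 by rewrite ltrDl.
  by rewrite in_itv; exists q.
have [s_ s_P] := choice exs; have [r_ r_P] := choice exr.
have cs : (fun k => ratr (s_ k) : R) @ \oo --> s.
  apply/cvgrPdist_lt => e e0; have := near_infty_natSinv_lt (PosNum e0); apply: filterS => k /= ke.
  have /andP[s1 s2] := s_P k; apply: lt_trans ke.
  by rewrite ger0_norm ?subr_ge0 ?(ltW s2)// ltrBlDr addrC -ltrBlDr.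
have cr : (fun k => ratr (r_ k) : R) @ \oo --> r.
  apply/cvgrPdist_lt => e e0; have := near_infty_natSinv_lt (PosNum e0); apply: filterS => k /= ke.
  have /andP[r1 r2] := r_P k; apply: lt_trans ke.
  by rewrite distrC ger0_norm ?subr_ge0 ?(ltW r1)// ltrBlDr addrC.
pose g (k : nat) (t : RT) : R := sigmoid k.+1%:R (ratr (s_ k)) t - sigmoid k.+1%:R (ratr (r_ k)) t.
have mg k : measurable_fun setT (g k).
  by apply: measurable_funB; exact: measurable_sigmoid.
have g1 k t : `|g k t| <= 1.
  have /andP[? ?] := sigmoid_gt0_lt1 k.+1%:R (ratr (s_ k)) t.
  have /andP[? ?] := sigmoid_gt0_lt1 k.+1%:R (ratr (r_ k)) t.
  by rewrite /g ler_norml; apply/andP; split; lra.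
have itg_ k : mu.-integrable setT (EFin \o (fun t => g k t * f t)).
  apply: (le_itg _ (itg_norm itf)); first by apply: measurable_funM => //; exact: itg_measurable itf.
  by move=> t; rewrite normrM ler_piMl.
have iti : mu.-integrable setT (EFin \o (fun t => \1_(`]s, r[%classic : set RT) t * f t)).
  apply: (le_itg _ (itg_norm itf)).
    apply: measurable_funM; last exact: itg_measurable itf.
    exact: measurable_indic.
  move=> t; rewrite normrM ler_piMl// indicE; case: (_ \in _) => /=; rewrite ?normr1 ?normr0//.
pose G (t : RT) : R := `|f t| - \1_(`]s, r[%classic : set RT) t * f t.
suff [_] : mu.-integrable setT (EFin \o G) /\ \int[mu]_t G t <= \int[mu]_t `|f t|.
  by rewrite /G RintegralB//; [rewrite gerBl|exact: itg_norm].
apply: (@fatou_lsc _ _ _ mu (fun k t => `|f t| - g k t * f t) _ (fun=> \int[mu]_t `|f t|)).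
- by move=> k; apply: itgB => //; exact: itg_norm.
- apply: measurable_funB; last exact: itg_measurable iti.
  by apply: measurableT_comp => //; exact: itg_measurable itf.
- apply: aeW => t k; rewrite subr_ge0; apply: le_trans (ler_norm _) _.
  by rewrite normrM ler_piMl.
- apply: aeW => t; rewrite subr_ge0; apply: le_trans (ler_norm _) _.
  by rewrite normrM ler_piMl// indicE; case: (_ \in _) => /=; rewrite ?normr1 ?normr0.
- apply: (@ae_imp _ _ _ mu _ _ (ae_and (ae_neq_lebesgue_oitv s) (ae_neq_lebesgue_oitv r))).
  move=> t [ts tr] e e0.
  pose ind : R := \1_(`]s, r[%classic : set RT) t.
  have gc : g k t @[k --> \oo] --> ind.
    rewrite (_ : ind = (if s < t then 1 else 0) - (if r < t then 1 else 0)).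
      by apply: cvgB; exact: sigmoid_cvg.
    have indE (b : bool) : (t \in (`]s, r[%classic : set RT)) = b -> ind = b%:R.
      by move=> tb; rewrite /ind indicE tb.
    case: (ltP s t) => st; case: (ltP r t) => rt.
    - rewrite (indE false) ?subrr//; apply: memNset; rewrite /= in_itv/= => /andP[_].
      by rewrite ltNge (ltW rt).
    - rewrite (indE true) ?subr0//; apply: mem_set; rewrite /= in_itv/= st.
      by rewrite lt_neqAle tr rt.
    - by exfalso; lra.
    - rewrite (indE false) ?subrr//; apply: memNset; rewrite /= in_itv/= => /andP[].
      by rewrite ltNge st.
  have : `|f t| - g k t * f t @[k --> \oo] --> `|f t| - ind * f t.
    by apply: cvgB; [exact: cvg_cst|apply: cvgM => //; exact: cvg_cst].
  move=> /cvgr_gt/(_ (`|f t| - ind * f t - e)).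
  by rewrite gtrBl e0 => /(_ isT); apply: filterS => k /ltW.
- move=> k; rewrite RintegralB//; last exact: itg_norm.
  by rewrite gerBl; apply: fS; have /andP[_ ?] := s_P k; have /andP[? _] := r_P k; lra.
- exact: cvg_cst.
Qed.

End interval_measure.

(** * Fubini for real-valued integrals and null sets of products *)

Section real_fubini.
Context d1 d2 (X1 : measurableType d1) (X2 : measurableType d2) (R : realType).
Variables (m1 : {finite_measure set X1 -> \bar R}) (m2 : {finite_measure set X2 -> \bar R}).
Local Notation m12 := (m1 \x m2)%E.

Lemma ae_slice_itg (f : X1 * X2 -> R) : m12.-integrable setT (EFin \o f) ->
  \forall y \ae m2, m1.-integrable setT (EFin \o (fun x => f (x, y))).
Proof. exact: ae_integrable2. Qed.

Lemma measurable_slice_Rint (f : X1 * X2 -> R) : m12.-integrable setT (EFin \o f) ->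
  measurable_fun setT (fun y => \int[m1]_x f (x, y)).
Proof. by move=> /measurable_fubini_G mf; apply: measurableT_comp mf. Qed.

Lemma itg_slice_Rint (f : X1 * X2 -> R) : m12.-integrable setT (EFin \o f) ->
  m2.-integrable setT (EFin \o (fun y => \int[m1]_x f (x, y))).
Proof.
move=> itf; have itn := itg_norm itf.
have itg_n : m2.-integrable setT (EFin \o (fun y => \int[m1]_x `|f (x, y)|)).
  apply: ge0_itg.
  - exact: (measurable_slice_Rint itn).
  - by move=> y; apply: Rintegral_ge0.
  - have /(integrable21ltyP _ _) := itn; move=> /(_ (measurable_int _ itn)).
    apply: le_lt_trans; apply: ge0_le_integral => //.
    + by move=> y _; rewrite lee_fin; apply: Rintegral_ge0.
    + by apply/measurable_EFinP; exact: (measurable_slice_Rint itn).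
    + apply: (measurable_fun_fubini_tonelli_G (fun p => `|(`|f p|)%:E|)%E) => //.
      by apply: measurableT_comp => //; exact: measurable_int itn.
    (* Where the slice integral is infinite, its real version is 0 and the inequality still
       holds. *)
    + move=> y _; rewrite /Rintegral; under [in leRHS]eq_integral do rewrite /= normr_id.
      have : (0 <= \int[m1]_x `|f (x, y)|%:E)%E by apply: integral_ge0 => x _; rewrite lee_fin.
      by case: (\int[m1]_x _)%E => [r||] //= _; rewrite leey.
apply: (ae_le_itg (measurable_slice_Rint itf) itg_n).
by have := ae_slice_itg itf; apply: filterS => y ity; exact: le_normr_Rintegral.
Qed.

Lemma Rint_fubini (f : X1 * X2 -> R) : m12.-integrable setT (EFin \o f) ->
  \int[m2]_y (\int[m1]_x f (x, y)) = \int[m12]_p f p.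
Proof.
move=> itf; rewrite [RHS]/Rintegral -(integral21_prod_meas1 itf); congr fine.
apply: ae_eq_integral => //.
- by apply/measurable_EFinP; exact: measurable_slice_Rint.
- exact: (measurable_fubini_G itf).
- have := ae_slice_itg itf; apply: filterS => y ity _.
  by rewrite /fubini_G EFin_Rint.
Qed.

(** A nonnegative function vanishes almost everywhere exactly when its integral does, and Tonelli's
    theorem writes this integral as an iterated one. *)
Lemma ae_slices_eq0 (f : X1 * X2 -> \bar R) : measurable_fun setT f -> (forall p, 0 <= f p)%E ->
  (\forall p \ae m12, f p = 0%E) <-> (\forall y \ae m2, \forall x \ae m1, f (x, y) = 0%E).
Proof.
move=> mf f0.
have msl y : measurable_fun setT (fun x => f (x, y)) by exact: measurableT_comp.
have sl0 y : (\int[m1]_x f (x, y) = 0)%E <-> (\forall x \ae m1, f (x, y) = 0%E).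
  have := ae_eq_integral_abs m1 measurableT (msl y).
  under eq_integral do rewrite gee0_abs//.
  by move=> H; split=> [/H|aef]; [apply: filterS => x; apply|apply/H; apply: filterS aef].
have tot0 : (\int[m12]_p f p = 0)%E <-> (\forall p \ae m12, f p = 0%E).
  have := ae_eq_integral_abs m12 measurableT mf.
  under eq_integral do rewrite gee0_abs//.
  by move=> H; split=> [/H|aef]; [apply: filterS => x; apply|apply/H; apply: filterS aef].
have mG : measurable_fun setT (fun y => \int[m1]_x f (x, y))%E.
  exact: measurable_fun_fubini_tonelli_G.
have dbl0 : (\int[m2]_y \int[m1]_x f (x, y) = 0)%E <->
    (\forall y \ae m2, \int[m1]_x f (x, y) = 0)%E.
  have := ae_eq_integral_abs m2 measurableT mG.
  under eq_integral do rewrite gee0_abs ?integral_ge0//.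
  by move=> H; split=> [/H|aef]; [apply: filterS => x; apply|apply/H; apply: filterS aef].
rewrite -tot0 fubini_tonelli2//= dbl0; split; apply: filterS => y; exact: (sl0 y).1 || exact: (sl0 y).2.
Qed.

Lemma ae_prod_slices (P : X1 * X2 -> Prop) : (\forall p \ae m12, P p) ->
  \forall y \ae m2, \forall x \ae m1, P (x, y).
Proof.
move=> [N [mN N0 NP]].
have mI : measurable_fun setT (fun p => (\1_N p)%:E : \bar R).
  by apply/measurable_EFinP; exact: measurable_indic.
have I0 p : (0 <= (\1_N p)%:E :> \bar R)%E by rewrite lee_fin.
have : \forall p \ae m12, (\1_N p)%:E = 0%E :> \bar R.
  exists N; split=> // p /= Np; apply: contrapT => nNp; apply: Np.
  by rewrite indicE memNset.
move=> /(ae_slices_eq0 mI I0); apply: filterS => y; apply: filterS => x.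
rewrite indicE => /eqP; rewrite eqe pnatr_eq0 eqb0 => /negP nN.
by apply: contrapT => nP; apply: nN; apply: mem_set; apply: NP.
Qed.

(** The converse passage from slices to the product needs measurability, so it is stated for an
    inequality between measurable functions and proved on the negative part. *)
Lemma ae_slices_prod_ge0 (f : X1 * X2 -> R) : measurable_fun setT f ->
  (\forall y \ae m2, \forall x \ae m1, 0 <= f (x, y)) -> \forall p \ae m12, 0 <= f p.
Proof.
move=> mf f0.
have mg : measurable_fun setT (fun p => (Num.max 0 (- f p))%:E : \bar R).
  apply/measurable_EFinP; apply: measurable_maxr; first exact: measurable_cst.
  exact: measurableT_comp.
have g0 p : (0 <= (Num.max 0 (- f p))%:E :> \bar R)%E by rewrite lee_fin le_max lexx.
have : \forall p \ae m12, (Num.max 0 (- f p))%:E = 0%E :> \bar R.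
  apply/(ae_slices_eq0 mg g0); apply: filterS f0 => y; apply: filterS => x fxy.
  by rewrite max_l// oppr_le0.
by apply: filterS => p [] /eqP; rewrite eq_maxl oppr_le0.
Qed.

End real_fubini.

Section matrix_integral.
Context disp (X : measurableType disp) (R : realType) (mu : {measure set X -> \bar R}).
Context (m n : nat).
Local Notation itg f := (mu.-integrable setT (EFin \o f)).

Definition mx_int (F : X -> 'M[R]_(m, n)) : 'M[R]_(m, n) :=
  \matrix_(i, j) \int[mu]_x F x i j.

Definition itg_mx (F : X -> 'M[R]_(m, n)) := forall i j, itg (fun x => F x i j).

Lemma itg_frob (F : X -> 'M[R]_(m, n)) A : itg_mx F -> itg (fun x => frob (F x) A).
Proof.
move=> iF; apply: itg_sum => i _; apply: itg_sum => j _.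
by under eq_fun do rewrite mulrC; apply: itgZ.
Qed.

Lemma frob_mx_int (F : X -> 'M[R]_(m, n)) A : itg_mx F ->
  frob (mx_int F) A = \int[mu]_x frob (F x) A.
Proof.
move=> iF; have iFA i j : itg (fun x => F x i j * A i j).
  by under eq_fun do rewrite mulrC; apply: itgZ.
rewrite /frob Rint_sum; last by move=> i; apply: itg_sum.
apply: eq_bigr => i _; rewrite Rint_sum//; apply: eq_bigr => j _.
by rewrite mxE RintegralZr.
Qed.

End matrix_integral.

Section averages.
Context {R : realType} (T : R) disp (X : measurableType disp).
Variable nu : {finite_measure set X -> \bar R}.
Local Notation RT := (measurableTypeR R).
Local Notation mT := (lebesgue_oitv T : {finite_measure set RT -> \bar R}).

(** The null set in the hypothesis depends on (k, s, r); with rational s and r these are countably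
    many, so one null set of x serves all of them. *)
Lemma ae_ge0_of_slices (f : RT * X -> R) : (mT \x nu)%E.-integrable setT (EFin \o f) ->
  (forall (k : nat) (s r : rat), ratr s < ratr r :> R -> \forall x \ae nu,
    0 <= \int[mT]_t ((sigmoid k.+1%:R (ratr s) t - sigmoid k.+1%:R (ratr r) t) * f (t, x))) ->
  \forall p \ae (mT \x nu)%E, 0 <= f p.
Proof.
move=> itf fS; apply: ae_slices_prod_ge0; first exact: itg_measurable itf.
(* The triples are enumerated through [unpickle], numbers that code none being sent to a default
   triple with s = r, for which the premise fails. *)
have all : \forall x \ae nu, forall q : nat,
    let u := odflt (0%N, (0, 0)) (unpickle q) : nat * (rat * rat) in
    ratr u.2.1 < ratr u.2.2 :> R ->
    0 <= \int[mT]_t ((sigmoid u.1.+1%:R (ratr u.2.1) t - sigmoid u.1.+1%:R (ratr u.2.2) t) * f (t, x)).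
  apply: ae_foralln => q; set u := odflt _ _ => /=.
  have [sr|sr] := boolP (ratr u.2.1 < ratr u.2.2 :> R).
    by have := fS u.1 _ _ sr; apply: filterS => x.
  exact: aeW.
move: (ae_slice_itg itf) all; apply: filterS2 => x itx fx.
apply: ae_ge0_of_sigmoids => // k s r sr.
by have := fx (pickle (k, (s, r))); rewrite pickleK/=; apply.
Qed.

End averages.

(** * Orlicz classes *)

Section orlicz_class.
Context disp (X : measurableType disp) {R : realType} {n : nat}.
Variables (mu : {finite_measure set X -> \bar R}) (K : 'rV[R]_n -> R).
Hypotheses (K_strict : strictly_convex K) (K_N : N_function K) (K0 : K 0 = 0).
Hypotheses (K_cont : continuous K) (K_D2 : Delta2 K) (KL_D2 : Delta2 (legendre K)).
Local Notation itg f := (mu.-integrable setT (EFin \o f)).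
Local Notation KL := (legendre K).

Lemma N_function_ge0 v : 0 <= K v. Proof. by have [_ _ ->] := K_N. Qed.

Lemma measurable_N_function : measurable_fun setT K.
Proof. exact: continuous_measurable_rV. Qed.

Lemma orliczP (J : 'rV[R]_n -> R) (f : X -> 'rV[R]_n) : measurable_fun setT J ->
  (forall v, 0 <= J v) ->
  orlicz mu J f <-> measurable_fun setT f /\ itg (fun x => J (f x)).
Proof.
move=> mJ J0; split=> -[mf].
  by move=> Jy; split=> //; apply: ge0_itg => //; exact: measurableT_comp.
by move=> Jf; split=> //; exact: itg_lty.
Qed.

Lemma orlicz_N f : orlicz mu K f <-> measurable_fun setT f /\ itg (fun x => K (f x)).
Proof. by apply: orliczP; [exact: measurable_N_function|exact: N_function_ge0]. Qed.

Lemma orlicz_legendre f :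
  orlicz mu KL f <-> measurable_fun setT f /\ itg (fun x => KL (f x)).
Proof.
apply: orliczP; [exact: measurable_legendre|exact: legendre_ge0].
Qed.

Lemma measurable_frob m k (f g : X -> 'M[R]_(m, k)) : measurable_fun setT f ->
  measurable_fun setT g -> measurable_fun setT (fun x => frob (f x) (g x)).
Proof.
move=> /measurable_fun_mxP mf /measurable_fun_mxP mg.
apply: measurable_sum => i; apply: measurable_sum => j.
by apply: measurable_funM; [exact: mf|exact: mg].
Qed.

Lemma young_norm v w : `|frob v w| <= K v + KL w.
Proof.
rewrite ler_norml; apply/andP; split; last exact: young_ineq.
rewrite lerNl -frobNr -(legendreN K_N w).
exact: young_ineq.
Qed.

Lemma itg_young z E : orlicz mu K z -> orlicz mu KL E -> itg (fun x => frob (z x) (E x)).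
Proof.
move=> /orlicz_N[mz iz] /orlicz_legendre[mE iE].
apply: (le_itg (measurable_frob mz mE) (itgD iz iE)) => x; exact: young_norm.
Qed.

Lemma N_function_bounded (C : R) :
  exists D, forall v : 'rV[R]_n, (forall j, `|v ord0 j| <= C) -> K v <= D.
Proof.
(* For C < 0 the bound is contradictory unless n = 0, where the only vector is 0. *)
have [C0|C0] := ltP C 0.
  exists (K 0) => v vC; rewrite (_ : v = 0)//; apply/rowP => j.
  by have := vC j; have := normr_ge0 (v ord0 j); lra.
pose S := [set v : 'rV[R]_n | forall i, v ord0 i \in `[- C, C]].
have cS : compact S.
  by apply: (@rV_compact _ _ (fun=> `[- C, C]%classic)) => _; exact: segment_compact.
have S0 : S !=set0 by exists 0 => i; rewrite mxE in_itv/= oppr_le0 C0.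
have [c _ cmax] := compact_EVT_max S0 cS (continuous_subspaceT K_cont).
exists (K c) => v vC; apply: cmax; rewrite inE => i.
by rewrite in_itv/= -ler_norml.
Qed.

Lemma orlicz_bounded (C : R) (z : X -> 'rV[R]_n) : measurable_fun setT z ->
  (\forall x \ae mu, forall j, `|z x ord0 j| <= C) -> orlicz mu K z.
Proof.
move=> mz zC; apply/orlicz_N; split=> //.
have [D KD] := N_function_bounded C.
apply: (ae_le_itg _ (itg_cst mu D)); first exact: measurableT_comp measurable_N_function mz.
by apply: filterS zC => x xC; rewrite ger0_norm ?N_function_ge0//; exact: KD.
Qed.

Lemma measurable_scale m k (s : R) (f : X -> 'M[R]_(m, k)) : measurable_fun setT f ->
  measurable_fun setT (fun x => s *: f x).
Proof.
move=> /measurable_fun_mxP mf; apply/measurable_fun_mxP => i j.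
by under eq_fun do rewrite mxE; apply: measurable_funM; [exact: measurable_cst|exact: mf].
Qed.

Lemma measurable_mxD m k (f g : X -> 'M[R]_(m, k)) : measurable_fun setT f ->
  measurable_fun setT g -> measurable_fun setT (fun x => f x + g x).
Proof.
move=> /measurable_fun_mxP mf /measurable_fun_mxP mg; apply/measurable_fun_mxP => i j.
by under eq_fun do rewrite mxE; apply: measurable_funD; [exact: mf|exact: mg].
Qed.

Lemma orlicz_scale s z : orlicz mu K z -> orlicz mu K (fun x => s *: z x).
Proof.
move=> /orlicz_N[mz iz]; apply/orlicz_N; split; first exact: measurable_scale.
have [C C0 KC] := Delta2_scale N_function_ge0 (N_function_scale K_strict K_N K0) K_D2 s.
apply: (le_itg _ (itgZ C (itgD iz (itg_cst mu 1)))).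
  by apply: (measurableT_comp measurable_N_function); exact: measurable_scale.
by move=> x; rewrite ger0_norm ?N_function_ge0.
Qed.

Lemma orlicz_sub z w : orlicz mu K z -> orlicz mu K w -> orlicz mu K (fun x => z x - w x).
Proof.
move=> oz ow; have [mz _] := oz; have [mw _] := ow.
have /orlicz_N[_ iz] := orlicz_scale 2 oz; have /orlicz_N[_ iw] := orlicz_scale 2 ow.
have mzw : measurable_fun setT (fun x => z x - w x).
  have -> : (fun x => z x - w x) = fun x => z x + (-1) *: w x.
    by apply/funext => x; rewrite scaleN1r.
  by apply: measurable_mxD => //; exact: measurable_scale.
apply/orlicz_N; split=> //.
apply: (le_itg _ (itgD iz iw)); first exact: measurableT_comp measurable_N_function mzw.
move=> x; rewrite ger0_norm ?N_function_ge0//; exact: N_function_sub.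
Qed.

(** Young's inequality against the constant function e_j, which is in the Orlicz class because the
    measure is finite. *)
Lemma itg_legendre_entry E j : orlicz mu KL E -> itg (fun x => E x ord0 j).
Proof.
move=> oE; have oz : orlicz mu K (fun=> delta_mx ord0 j).
  apply: (@orlicz_bounded 1); first exact: measurable_cst.
  apply: aeW => x k; rewrite mxE; case: (_ && _); by rewrite ?normr1 ?normr0.
have := itg_young oz oE; congr (mu.-integrable _ (EFin \o _)); apply/funext => x.
rewrite frob_rV (bigD1 j)//= mxE !eqxx mul1r big1 ?addr0// => k kj.
by rewrite mxE (negPf kj) andbF mul0r.
Qed.

Lemma Lp_symm1P N (M : X -> 'M[R]_N) : Lp_symm mu 1%E M <->
  (forall x, symm_mx (M x)) /\ itg_mx mu M.
Proof.
by split=> -[Ms iM]; split=> // i j; apply/Lfun1_integrable; exact: iM.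
Qed.

(** Positive total mass ensures that the L^infinity norm is the essential supremum. The finitely
    many entrywise bounds merge into one. *)
Lemma Lp_symmyP N (B : X -> 'M[R]_N) : (0 < mu setT)%E -> Lp_symm mu +oo%E B <->
  [/\ forall x, symm_mx (B x), (forall i j, measurable_fun setT (fun x => B x i j)) &
   exists C, \forall x \ae mu, forall i j, `|B x i j| <= C].
Proof.
move=> mu0; split=> [[Bs LB]|[Bs mB [C BC]]].
  have LBP i j : measurable_fun setT (fun x => B x i j) /\
      exists C, \forall x \ae mu, `|B x i j| <= C.
    have /andP[] := LB i j; rewrite !inE/= => mB Bn; split=> //.
    move: Bn; rewrite /finite_norm unlock /Lnorm mu0.
    exact: ess_supr_bounded.
  split=> //; first by move=> i j; have [] := LBP i j.
  have [C CP] := choice (fun ij : 'I_N * 'I_N => (LBP ij.1 ij.2).2).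
  exists (\sum_ij `|C ij|).
  have : \forall x \ae mu, forall ij, `|B x ij.1 ij.2| <= C ij by exact: ae_forall_fin.
  apply: filterS => x xC i j; apply: le_trans (xC (i, j)) _; apply: le_trans (ler_norm _) _.
  by rewrite (bigD1 (i, j))//= lerDl; apply: sumr_ge0.
split=> // i j; apply/andP; rewrite !inE/=; split; first exact: mB.
rewrite /finite_norm unlock /Lnorm mu0; apply: (@le_lt_trans _ _ C%:E); last exact: ltry.
by apply/ess_supP; apply: filterS BC => x xC; rewrite /= lee_fin.
Qed.

Lemma itg_boundedM (f g : X -> R) (C : R) : itg f -> measurable_fun setT g ->
  (\forall x \ae mu, `|g x| <= C) -> itg (fun x => f x * g x).
Proof.
move=> itf mg gC; apply: (ae_le_itg _ (itgZ `|C| (itg_norm itf))).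
  by apply: measurable_funM => //; exact: itg_measurable itf.
apply: filterS gC => x xC; rewrite normrM mulrC; apply: ler_wpM2r => //.
exact: le_trans xC (ler_norm _).
Qed.

Lemma itg_frob_bounded m k (M B : X -> 'M[R]_(m, k)) (C : R) : itg_mx mu M ->
  (forall i j, measurable_fun setT (fun x => B x i j)) ->
  (\forall x \ae mu, forall i j, `|B x i j| <= C) -> itg (fun x => frob (M x) (B x)).
Proof.
move=> iM mB BC; apply: itg_sum => i _; apply: itg_sum => j _.
by apply: (itg_boundedM (C := C)) => //; apply: filterS BC => x; apply.
Qed.

Lemma cvg_mx (F : set_system nat) {FF : Filter F} m k (f : nat -> 'M[R]_(m, k)) (L : 'M[R]_(m, k)) :
  (forall i j, f q i j @[q --> F] --> L i j) -> f @ F --> L.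
Proof.
move=> cf A [P Pn PA]; rewrite /nbhs/=.
apply: filterS (_ : F [set q | forall i j, P i j (f q i j)]).
  by move=> q Pq; apply: PA.
apply: filter_forall => i; apply: filter_forall => j.
exact: (cf i j _ (Pn i j)).
Qed.

Lemma cvg_frobr m k (A : 'M[R]_(m, k)) (f : nat -> 'M[R]_(m, k)) (L : 'M[R]_(m, k)) :
  (forall i j, f q i j @[q --> \oo] --> L i j) -> frob A (f q) @[q --> \oo] --> frob A L.
Proof.
by move=> /cvg_mx cf; apply: (cvg_comp _ _ cf); exact: continuous_frobr.
Qed.

(* Upper semicontinuity of the linear functionals along almost everywhere convergent
   sequences: Fatou for [e K(z/e) + e K*(E_k) - z.E_k + C|M| - M:B_k], then e -> 0. *)
Lemma pairing_usc N (z : X -> 'rV[R]_n) (M : X -> 'M[R]_N)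
    (E_ : nat -> X -> 'rV[R]_n) (B_ : nat -> X -> 'M[R]_N) (E : X -> 'rV[R]_n)
    (B : X -> 'M[R]_N) (C D a : R) (a_ : nat -> R) :
  orlicz mu K z -> itg_mx mu M ->
  (forall k, orlicz mu KL (E_ k)) -> orlicz mu KL E ->
  (forall k i j, measurable_fun setT (fun x => B_ k x i j)) ->
  (forall i j, measurable_fun setT (fun x => B x i j)) ->
  (\forall x \ae mu, forall k i j, `|B_ k x i j| <= C) ->
  (\forall x \ae mu, forall i j, `|B x i j| <= C) ->
  (forall k, \int[mu]_x KL (E_ k x) <= D) ->
  (\forall x \ae mu, forall j, E_ k x ord0 j @[k --> \oo] --> E x ord0 j) ->
  (\forall x \ae mu, forall i j, B_ k x i j @[k --> \oo] --> B x i j) ->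
  (forall k, a_ k <= \int[mu]_x (frob (z x) (E_ k x) + frob (M x) (B_ k x))) ->
  a_ @ \oo --> a ->
  a <= \int[mu]_x (frob (z x) (E x) + frob (M x) (B x)).
Proof.
move=> oz iM oE_ oE mB_ mB B_C BC ED cE cB a_w ca.
pose w_ k x := frob (z x) (E_ k x) + frob (M x) (B_ k x).
pose w x := frob (z x) (E x) + frob (M x) (B x).
pose M1 x := \sum_i \sum_j `|M x i j|.
have iM1 : itg M1 by apply: itg_sum => i _; apply: itg_sum => j _; exact: itg_norm.
have iw_ k : itg (w_ k).
  apply: itgD; first exact: itg_young.
  by apply: (itg_frob_bounded (C := C)) => //; apply: filterS B_C => x; apply.
have iw : itg w by apply: itgD; [exact: itg_young|exact: (itg_frob_bounded (C := C))].
have iKL_ k : itg (fun x => KL (E_ k x)) by have /orlicz_legendre[] := oE_ k.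
have iKL : itg (fun x => KL (E x)) by have /orlicz_legendre[] := oE.
have D0 : 0 <= D by apply: le_trans (ED 0%N); apply: Rintegral_ge0 => x _; exact: legendre_ge0.
suff main e : 0 < e -> a <= \int[mu]_x w x + e * D.
  apply/ler_addgt0Pr => e e0; have e'0 : 0 < e / (D + 1) by rewrite divr_gt0// ltr_wpDl.
  apply: le_trans (main _ e'0) _; rewrite lerD2l -mulrA ler_piMr ?ltW//.
  by rewrite mulrC ltr_pdivrMr ?mul1r ?ltrDl// ltr_wpDl.
move=> e0.
pose P x := e * K (e^-1 *: z x) + C * M1 x.
have iP : itg P.
  apply: itgD; last exact: itgZ.
  by apply: itgZ; have /orlicz_N[] := orlicz_scale e^-1 oz.
have young_e x v : frob (z x) v <= e * K (e^-1 *: z x) + e * KL v.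
  rewrite -mulrDr -ler_pdivrMl// -frobZl; exact: young_ineq.
pose g_ k x := P x + e * KL (E_ k x) - w_ k x.
pose g x := P x + e * KL (E x) - w x.
have ig_ k : itg (g_ k) by apply: itgB => //; apply: itgD => //; exact: itgZ.
have ig : itg g by apply: itgB => //; apply: itgD => //; exact: itgZ.
have MB x (Q : 'M[R]_N) : (forall i j, `|Q i j| <= C) -> frob (M x) Q <= C * M1 x.
  by move=> QC; apply: le_trans (ler_norm _) _; exact: le_norm_frob.
have RI (f u : X -> R) : itg f -> itg u ->
    \int[mu]_x (P x + e * f x - u x) = \int[mu]_x P x + e * \int[mu]_x f x - \int[mu]_x u x.
  move=> itf iu; rewrite RintegralB//; last by apply: itgD => //; exact: itgZ.
  rewrite RintegralD//; last exact: itgZ.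
  by rewrite RintegralZl.
have Ig_ k : \int[mu]_x g_ k x = \int[mu]_x P x + e * \int[mu]_x KL (E_ k x) - \int[mu]_x w_ k x.
  exact: RI.
have Ig : \int[mu]_x g x = \int[mu]_x P x + e * \int[mu]_x KL (E x) - \int[mu]_x w x.
  exact: RI.
have [_] : itg g /\ \int[mu]_x g x <= \int[mu]_x P x + e * D - a.
  apply: (@fatou_lsc _ _ _ mu g_ g (fun k => \int[mu]_x P x + e * D - a_ k)) => //.
  - exact: itg_measurable ig.
  - apply: filterS B_C => x xC k; rewrite /g_ /P /w_.
    by have := young_e x (E_ k x); have := MB x _ (xC k); lra.
  - apply: filterS BC => x xC; rewrite /g /P /w.
    by have := young_e x (E x); have := MB x _ xC; lra.
  - move: cE cB; apply: filterS2 => x cEx cBx d d0.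
    have d2 : 0 < d / 2 / e by rewrite !divr_gt0.
    (* A vector v nearly attaining K^*(E x) gives an affine minorant of K^*, which passes to the
       limit pointwise. *)
    have [_ [v _ <-]] := sup_adherent d2 (legendre_has_sup K_N (E x)).
    rewrite -/(legendre K (E x)) ltrBlDr -ltrBlDl ltr_pdivlMr// => vE.
    have cL : e * (frob v (E_ k x) - K v) - w_ k x @[k --> \oo] --> e * (frob v (E x) - K v) - w x.
      have cfr (u : 'rV[R]_n) : frob u (E_ k x) @[k --> \oo] --> frob u (E x).
        by apply: cvg_frobr => i j; rewrite ord1; exact: cEx.
      apply: cvgB; first by apply: cvgM; [exact: cvg_cst|apply: cvgB; [exact: cfr|exact: cvg_cst]].
      by apply: cvgD; [exact: cfr|exact: cvg_frobr].
    have lt : e * KL (E x) - w x - d < e * (frob v (E x) - K v) - w x by lra.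
    move/cvgr_gt : cL => /(_ _ lt); apply: filterS => k Lk; rewrite /g /g_.
    have := ler_wpM2l (ltW e0) (young_ineq K_N v (E_ k x)); lra.
  - move=> k; rewrite Ig_; have := a_w k; rewrite -/(w_ k).
    have := ler_wpM2l (ltW e0) (ED k); lra.
  - by apply: cvgB => //; exact: cvg_cst.
rewrite Ig.
have : 0 <= e * \int[mu]_x KL (E x).
  by apply: mulr_ge0; [exact: ltW|apply: Rintegral_ge0 => x _; exact: legendre_ge0].
lra.
Qed.

(** K^* is a supremum of affine functions, hence lower semicontinuous along the sequence, and
    Fatou's lemma applies. *)
Lemma legendre_fatou (E_ : nat -> X -> 'rV[R]_n) (E : X -> 'rV[R]_n) (D : R) :
  (forall k, orlicz mu KL (E_ k)) -> measurable_fun setT E ->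
  (forall k, \int[mu]_x KL (E_ k x) <= D) ->
  (\forall x \ae mu, forall j, E_ k x ord0 j @[k --> \oo] --> E x ord0 j) ->
  orlicz mu KL E.
Proof.
move=> oE_ mE ED cE; apply/orlicz_legendre; split=> //.
have iKL_ k : itg (fun x => KL (E_ k x)) by have /orlicz_legendre[] := oE_ k.
have [//] : itg (fun x => KL (E x)) /\ \int[mu]_x KL (E x) <= D.
apply: (@fatou_lsc _ _ _ mu (fun k x => KL (E_ k x)) _ (fun=> D)) => //.
- by apply: measurableT_comp mE; exact: measurable_legendre.
- by apply: aeW => x k; exact: legendre_ge0.
- by apply: aeW => x; exact: legendre_ge0.
- move: cE; apply: filterS => x cEx d d0.
  have [_ [v _ <-]] := sup_adherent d0 (legendre_has_sup K_N (E x)).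
  rewrite -/(legendre K (E x)) => vE.
  have cL : frob v (E_ k x) - K v @[k --> \oo] --> frob v (E x) - K v.
    apply: cvgB; last exact: cvg_cst.
    by apply: cvg_frobr => i j; rewrite ord1; exact: cEx.
  move/cvgr_gt : cL => /(_ _ vE); apply: filterS => k Lk.
  have := young_ineq K_N v (E_ k x); lra.
- exact: cvg_cst.
Qed.

End orlicz_class.

(** * Bounding the integral of the Legendre transform by duality *)

Section dual_norm_bound.
Context disp (X : measurableType disp) {R : realType} {n : nat}.
Variables (mu : {finite_measure set X -> \bar R}) (K : 'rV[R]_n -> R).
Hypotheses (K_N : N_function K) (K0 : K 0 = 0) (K_cont : continuous K).
Hypothesis (KL_D2 : Delta2 (legendre K)).
Local Notation itg f := (mu.-integrable setT (EFin \o f)).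
Local Notation KL := (legendre K).

Lemma measurable_legendre_seq k : measurable_fun setT (legendre_seq K k).
Proof.
elim: k => [|k IH] /=; first exact: measurable_cst.
apply: measurable_maxr => //; apply: measurable_funB; last exact: measurable_cst.
by apply: continuous_measurable_rV; exact: continuous_frobr.
Qed.

Lemma measurable_legendre_arg k : measurable_fun setT (legendre_arg K k).
Proof.
elim: k => [|k IH] /=; first exact: measurable_cst.
apply: measurable_fun_ifT => //.
apply: measurable_fun_ltr; first exact: measurable_legendre_seq.
apply: measurable_funB; last exact: measurable_cst.
by apply: continuous_measurable_rV; exact: continuous_frobr.
Qed.

(** Boundedness puts the selected test functions into the Orlicz class whatever E is. *)
Lemma legendre_arg_bounded k : exists C : R, forall w j, `|legendre_arg K k w ord0 j| <= C.
Proof.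
elim: k => [|k [C IH]] /=; first by exists 0 => w j; rewrite mxE normr0.
exists (C + \sum_j `|(rational_point k : 'rV[R]_n) ord0 j|) => w j.
have C0 : 0 <= C by exact: le_trans (IH w j).
case: ifP => _; last by apply: le_trans (IH w j) _; rewrite lerDl; apply: sumr_ge0.
by rewrite (bigD1 j)//= ler_wpDl// lerDl; apply: sumr_ge0.
Qed.

(* Duality with test functions taking finitely many values: [legendre_arg K k] selects the best
   of the first k rational points pointwise. *)
Lemma legendre_bound_of_pairing (E : X -> 'rV[R]_n) (c A : R) : 0 < c ->
  orlicz mu KL E ->
  (forall w, orlicz mu K w -> \int[mu]_x frob (w x) (E x) <= A + c * \int[mu]_x K (w x)) ->
  \int[mu]_x KL (c^-1 *: E x) <= A / c.
Proof.
move=> c0 oE EA; have [mE _] := oE.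
have mcE : measurable_fun setT (fun x => c^-1 *: E x) by exact: measurable_scale.
pose w k x := legendre_arg K k (c^-1 *: E x).
have mw k : measurable_fun setT (w k) by exact: measurableT_comp (measurable_legendre_arg k) mcE.
have ow k : orlicz mu K (w k).
  have [C wC] := legendre_arg_bounded k.
  by apply: (orlicz_bounded K_N K_cont (C := C) (mw k)); apply: aeW => x j; exact: wC.
pose g k x := legendre_seq K k (c^-1 *: E x).
have gE k x : g k x = c^-1 * frob (w k x) (E x) - K (w k x).
  by rewrite /g legendre_argE// frobZr.
have iwE k : itg (fun x => frob (w k x) (E x)) by exact: (itg_young K_N K0 K_cont).
have iKw k : itg (fun x => K (w k x)) by have /(orlicz_N mu K_N K_cont)[] := ow k.
have gfE k : g k = fun x => c^-1 * frob (w k x) (E x) - K (w k x) by apply/funext.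
have ig k : itg (g k) by rewrite gfE; apply: itgB => //; exact: itgZ.
have g0 k x : 0 <= g k x.
  by rewrite /g; elim: k => [|k IH] /=; rewrite ?le_max ?IH.
have [] // : itg (fun x => KL (c^-1 *: E x)) /\ \int[mu]_x KL (c^-1 *: E x) <= A / c.
apply: (@fatou_lsc _ _ _ mu g _ (fun=> A / c)) => //.
- by apply: measurableT_comp mcE; exact: measurable_legendre.
- exact: aeW.
- by apply: aeW => x; exact: legendre_ge0.
- apply: aeW => x e e0; have := @legendre_seq_cvg _ _ K K_N K0 K_cont (c^-1 *: E x).
  by move/cvgr_gt => /(_ (KL (c^-1 *: E x) - e)); rewrite gtrBl e0 => /(_ isT); apply: filterS => k /ltW.
- move=> k; rewrite gfE RintegralB//; last exact: itgZ.
  rewrite RintegralZl// lerBlDr ler_pdivrMl// mulrDr mulrCA mulfV ?gt_eqF// mulr1.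
  exact: EA.
- exact: cvg_cst.
Qed.

End dual_norm_bound.

(** * The fundamental cell and its measure *)

Section cell.
Context {R : realType} {d : nat} (l T : R).
Hypotheses (hl : 0 < l) (hT : 0 < T).
Local Notation RT := (measurableTypeR R).
Local Notation nu := (torus_measure d l).
Local Notation mT := (lebesgue_oitv T : {finite_measure set RT -> \bar R}).
Local Notation mu := (spacetime_measure l T : {finite_measure set (RT * 'rV[R]_d)%type -> \bar R}).
Local Notation box := [set x : 'rV[R]_d | forall i, `]0%R, l[%classic (x ord0 i)].

Lemma measurable_box : measurable box.
Proof.
have -> : box = \bigcap_(i in [set: 'I_d]) ((fun x : 'rV[R]_d => x ord0 i) @^-1` `]0%R, l[%classic).
  by apply/seteqP; split=> [x Ax i _|x Ax i]; [exact: Ax|exact: (Ax i)].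
apply: fin_bigcap_measurable => // i _; rewrite -[X in measurable X]setTI.
by apply: (@measurable_entry _ _ 1 d ord0 i) => //; exact: measurable_itv.
Qed.

Lemma ae_torus_cell : \forall x \ae nu, forall i : 'I_d, 0 < (x : 'rV[R]_d) ord0 i < l.
Proof.
exists (~` box); split; first by apply: measurableC; exact: measurable_box.
- have nub : nu box = (l ^+ d)%:E.
    rewrite (@torus_measure_box _ d l (fun=> `]0%R, l[%classic)); last by move=> i; exact: measurable_itv.
    under eq_bigr do rewrite setIid lebesgue_measure_itv/= lte_fin hl sube0.
    by rewrite prodEFin prodr_const card_ord.
  have nuT : nu setT = (l ^+ d)%:E by exact: torus_measureT (ltW hl).
  rewrite -setTD measureD//; last 2 first.
    exact: measurable_box.
    by rewrite -ge0_fin_numE ?fin_num_measure.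
  transitivity (nu setT - nu box)%E; first by rewrite setTI.
  by rewrite nub nuT subee.
- by move=> x /= H Hb; apply: H => i; have := Hb i; rewrite /= in_itv.
Qed.

Lemma lebesgue_oitvT : mT setT = T%:E.
Proof.
rewrite lebesgue_oitvE setTI.
by have := @lebesgue_measure_itv R `]0, T[; rewrite /= lte_fin hT sube0.
Qed.

Lemma spacetime_measureT : mu setT = (T * l ^+ d)%:E.
Proof.
transitivity ((mT \x nu)%E (setT `*` setT)); first by rewrite setXTT.
transitivity (mT setT * nu setT)%E; first exact: product_measure1E.
by rewrite lebesgue_oitvT (torus_measureT d (ltW hl)) EFinM.
Qed.

Lemma ae_spacetime_cell :
  \forall p \ae mu, 0 < p.1 < T /\ forall i : 'I_d, 0 < (p.2 : 'rV[R]_d) ord0 i < l.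
Proof.
have mS : measurable ((`]0%R, T[%classic : set RT) `*` box).
  by apply: measurableX; [exact: measurable_itv|exact: measurable_box].
(* Membership in the cell is phrased as nonnegativity of a measurable function so that it can be
   checked on slices. *)
pose f (p : RT * 'rV[R]_d) : R := \1_((`]0%R, T[%classic : set RT) `*` box) p - 1.
have mf : measurable_fun setT f.
  by apply: measurable_funB; [exact: measurable_indic|exact: measurable_cst].
have : \forall p \ae (mT \x nu)%E, 0 <= f p.
  apply: ae_slices_prod_ge0 mf _; apply: (ae_imp ae_torus_cell) => x xb.
  apply: (@ae_imp _ _ _ mT _ _ (ae_lebesgue_oitv_dom T)) => t tT.
  have tx : ((`]0%R, T[%classic : set RT) `*` box) (t, x).
    by split=> [|i] /=; rewrite in_itv//=; exact: xb.
  by rewrite /f indicE mem_set// subrr.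
move=> H; apply: (@ae_imp _ _ _ mu _ _ H) => -[t x]; rewrite /f indicE.
case: (boolP (_ \in _)) => /=; last by rewrite sub0r oppr_ge0 ler10.
move=> /set_mem[/=]; rewrite in_itv/= => tT xb _.
by split.
Qed.

Lemma continuous_bounded_cell (f : R * 'rV[R]_d -> R) : continuous f ->
  exists C, forall p : R * 'rV[R]_d, 0 <= p.1 <= T -> (forall i, 0 <= p.2 ord0 i <= l) -> `|f p| <= C.
Proof.
move=> cf.
pose S := (`[0%R, T]%classic : set R) `*` [set x : 'rV[R]_d | forall i, x ord0 i \in `[0, l]].
have cS : compact S.
  apply: compact_setX; first exact: segment_compact.
  by apply: (@rV_compact _ _ (fun=> `[0, l]%classic)) => _; exact: segment_compact.
have S0 : S !=set0.
  by exists (0, 0); split=> [|i] /=; rewrite ?mxE in_itv/= lexx ltW.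
have cn : continuous (fun p => `|f p|).
  by move=> p; exact: (continuous_comp (cf p) (@norm_continuous _ _ (f p))).
have [c _ cmax] := compact_EVT_max S0 cS (continuous_subspaceT cn).
exists `|f c| => p p1 p2; apply: cmax; rewrite inE; split=> /=; first by rewrite in_itv.
by move=> i; rewrite in_itv/=; exact: p2.
Qed.

Lemma ae_bounded_spacetime (f : R * 'rV[R]_d -> R) : continuous f ->
  exists C, \forall p \ae mu, `|f p| <= C.
Proof.
move=> /continuous_bounded_cell[C fC]; exists C.
apply: (@ae_imp _ _ _ mu _ _ ae_spacetime_cell) => p [/andP[p1 p2] pi].
by apply: fC; [rewrite !ltW|move=> i; have /andP[? ?] := pi i; rewrite !ltW].
Qed.

End cell.

(** * Time averages and the trace bound *)

Section time_average.
Context {R : realType} (T : R) disp (X : measurableType disp) (n : nat).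
Hypothesis hT : 0 < T.
Variable nu : {finite_measure set X -> \bar R}.
Variable K : 'rV[R]_n -> R.
Hypotheses (K_N : N_function K) (K0 : K 0 = 0) (K_cont : continuous K).
Hypothesis (KL_D2 : Delta2 (legendre K)).
Local Notation RT := (measurableTypeR R).
Local Notation mT := (lebesgue_oitv T : {finite_measure set RT -> \bar R}).
Local Notation mu := (oitv_prod nu T : {finite_measure set (RT * X)%type -> \bar R}).
Local Notation KL := (legendre K).
Local Notation itg f := (mu.-integrable setT (EFin \o f)).

Lemma Rint_cst_oitv (c : R) : \int[mT]_t c = c * T.
Proof.
apply: EFin_inj; rewrite -EFin_Rint; last exact: itg_cst.
by rewrite integral_cst//= EFinM; congr (_ * _)%E; exact: lebesgue_oitvT.
Qed.

Definition time_average m k (w : RT -> R) (A : RT * X -> 'M[R]_(m, k)) (x : X) : 'M[R]_(m, k) :=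
  mx_int mT (fun t => w t *: A (t, x)).

Section average.
Context (m k : nat) (w : RT -> R) (A : RT * X -> 'M[R]_(m, k)).
Hypothesis iwA : forall i j, itg (fun p => w p.1 * A p i j).

Lemma itg_time_average i j : nu.-integrable setT (EFin \o (fun x => time_average w A x i j)).
Proof.
have := itg_slice_Rint (iwA i j); congr (nu.-integrable _ (EFin \o _)); apply/funext => x.
by rewrite mxE; apply: eq_Rintegral => t _; rewrite mxE.
Qed.

Lemma measurable_time_average : measurable_fun setT (time_average w A).
Proof. by apply/measurable_fun_mxP => i j; exact: itg_measurable (itg_time_average i j). Qed.

Lemma ae_slice_itg_mx : \forall x \ae nu, itg_mx mT (fun t => w t *: A (t, x)).
Proof.
apply: ae_forall_fin => i; apply: ae_forall_fin => j.
apply: (ae_imp (ae_slice_itg (iwA i j))) => x; congr (mT.-integrable _ (EFin \o _)).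
by apply/funext => t; rewrite mxE.
Qed.

Lemma integral_frob_time_average (psi : X -> 'M[R]_(m, k)) : measurable_fun setT psi ->
  itg (fun p => w p.1 * frob (A p) (psi p.2)) ->
  (\int[nu]_x (frob (time_average w A x) (psi x))%:E =
   (\int[mu]_p (w p.1 * frob (A p) (psi p.2)))%:E)%E.
Proof.
move=> mpsi ip; rewrite -(Rint_fubini ip) -EFin_Rint; last exact: (itg_slice_Rint ip).
apply: ae_eq_integral => //.
- apply/measurable_EFinP; apply: measurable_frob => //; exact: measurable_time_average.
- by apply/measurable_EFinP; exact: measurable_slice_Rint ip.
apply: (ae_imp ae_slice_itg_mx) => x ix _; rewrite frob_mx_int//; congr EFin.
by apply: eq_Rintegral => t _; rewrite frobZl.
Qed.

End average.

(* Jensen's inequality, through Young's inequality tested against each fixed vector. *)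
Lemma orlicz_time_average (w : RT -> R) (C : R) (E : RT * X -> 'rV[R]_n) :
  measurable_fun setT w -> (forall t, 0 < t < T -> `|w t| <= C) ->
  orlicz mu KL E -> orlicz nu KL (time_average w E).
Proof.
move=> mw wC oE; have /(orlicz_legendre mu K_N K0 K_cont)[mE iE] := oE.
have iEj j := itg_legendre_entry K_N K0 K_cont j oE.
have C0 : 0 <= C by apply: le_trans (wC (T / 2) _); rewrite // divr_gt0//= ltr_pdivrMr// ltr_pMr// ltr1n.
(* The factor comes from T w(t) E = (w(t) / (C + 1)) (T (C + 1) E), where the first scalar is at
   most 1 in absolute value; C + 1 instead of C avoids a zero denominator. *)
have [D D0 KD] := Delta2_scale (legendre_ge0 K_N K0) (legendre_scale K_N K0) KL_D2 (T * (C + 1)).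
have mw1 : measurable_fun (setT : set (RT * X)) (fun p => w p.1).
  by apply: (measurableT_comp (f := w)) => //; exact: measurable_fst.
have wC' : \forall p \ae mu, `|w p.1| <= C.
  have mCw : measurable_fun (setT : set (RT * X)) (fun p => C - `|w p.1|).
    by apply: measurable_funB; [exact: measurable_cst|exact: measurableT_comp mw1].
  have : \forall p \ae (mT \x nu)%E, 0 <= C - `|w p.1|.
    apply: (ae_slices_prod_ge0 mCw); apply: aeW => x.
    apply: (@ae_imp _ _ _ mT _ _ (ae_lebesgue_oitv_dom T)) => t tT.
    by rewrite subr_ge0; exact: wC.
  by move=> H; apply: (@ae_imp _ _ _ mu _ _ H) => p; rewrite subr_ge0.
have iwE j : itg (fun p => w p.1 * E p ord0 j).
  by under eq_fun do rewrite mulrC; exact: (itg_boundedM (C := C)).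
have iwE' i j : itg (fun p => w p.1 * E p i j) by rewrite ord1.
have mz := measurable_time_average iwE'.
apply/orlicz_legendre => //; split=> //.
(* Averaging v.(T w E) <= K(v) + D (K^*(E) + 1) over time with density 1/T gives v.zeta <= K(v) +
   g(x) for every v, hence K^*(zeta) <= g. *)
pose g x := T^-1 * \int[mT]_t (D * (KL (E (t, x)) + 1)).
have iDE : itg (fun p => D * (KL (E p) + 1)) by apply: itgZ; apply: itgD => //; exact: itg_cst.
have ig : nu.-integrable setT (EFin \o g) by apply: itgZ; exact: (itg_slice_Rint iDE).
apply: (ae_le_itg _ ig); first exact: measurableT_comp (measurable_legendre K_N K0 K_cont) mz.
have s1 := ae_slice_itg iDE.
move: s1 (ae_slice_itg_mx iwE'); apply: filterS2 => x i1 i2.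
rewrite ger0_norm; last exact: legendre_ge0.
apply: legendre_le => // v; rewrite frobC frob_mx_int//.
rewrite lerBlDl.
have -> : K v + g x = \int[mT]_t (T^-1 * (K v + D * (KL (E (t, x)) + 1))).
  rewrite RintegralZl//; last by apply: itgD => //; exact: itg_cst.
  rewrite RintegralD//; last exact: itg_cst.
  by rewrite Rint_cst_oitv mulrDr mulrCA mulVf ?gt_eqF// mulr1.
apply: ae_le_Rint.
- exact: itg_frob.
- by apply: itgZ; apply: itgD => //; exact: itg_cst.
- apply: (@ae_imp _ _ _ mT _ _ (ae_lebesgue_oitv_dom T)) => t tT.
  have wC1 : `|w t / (C + 1)| <= 1.
    have C1 : 0 < C + 1 by rewrite ltr_wpDl.
    rewrite normrM normfV (gtr0_norm C1) ler_pdivrMr// mul1r.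
    by apply: le_trans (wC _ tT) _; rewrite lerDl.
  have := young_ineq K_N v ((T * w t) *: E (t, x)).
  have -> : (T * w t) *: E (t, x) = (w t / (C + 1)) *: ((T * (C + 1)) *: E (t, x)).
    by rewrite scalerA; congr (_ *: _); field; rewrite gt_eqF// ltr_wpDl.
  move=> Y; have := legendre_scale K_N K0 ((T * (C + 1)) *: E (t, x)) wC1.
  move/(le_trans)/(_ (KD _)); rewrite -(lerD2l (K v)) => /(le_trans Y).
  rewrite scalerA frobZr frobZl [frob v _]frobC => H.
  rewrite -ler_pdivrMl ?invr_gt0// invrK; apply: le_trans H.
  by rewrite le_eqVlt; apply/orP; left; apply/eqP; field; rewrite gt_eqF// ltr_wpDl.
Qed.

End time_average.

(** Exhibits the form as a linear functional of A, so that it commutes with time averages. *)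
Lemma bform_frob (R : realType) N (A : 'M[R]_N) x y :
  bform A x y = frob A (\matrix_(i, j) (x ord0 i * y ord0 j)).
Proof.
rewrite bformE; apply: eq_bigr => i _; apply: eq_bigr => j _.
by rewrite mxE; ring.
Qed.

Lemma sigmoid_ge (R : realType) (a s r t : R) : 0 < a -> s <= r -> sigmoid a r t <= sigmoid a s t.
Proof.
move=> a0 sr; rewrite /sigmoid lef_pV2 ?posrE ?sigmoid_den_gt0// lerD2l ler_expR lerN2.
by rewrite ler_pM2l// lerB.
Qed.

Lemma derive_dir0 (R : realType) (V W : normedModType R) (f : V -> W) x : 'D_0 f x = 0.
Proof.
rewrite /derive; under eq_fun do rewrite scaler0 /= add0r subrr scaler0.
by apply: cvg_lim => //; exact: cvg_cst.
Qed.

Section trace_bound.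
Context {R : realType} {d n N : nat} (l T : R).
Hypotheses (hl : 0 < l) (hT : 0 < T).
Variables (L : diff_operator R d n N) (K : 'rV[R]_n -> R).
Hypotheses (K_N : N_function K) (K0 : K 0 = 0) (K_cont : continuous K).
Hypothesis (KL_D2 : Delta2 (legendre K)).
Local Notation RT := (measurableTypeR R).
Local Notation nu := (torus_measure d l).
Local Notation mT := (lebesgue_oitv T : {finite_measure set RT -> \bar R}).
Local Notation mu := (oitv_prod nu T : {finite_measure set (RT * 'rV[R]_d)%type -> \bar R}).
Local Notation KL := (legendre K).
Local Notation itg f := (mu.-integrable setT (EFin \o f)).
Variables (E : R * 'rV[R]_d -> 'rV[R]_n) (B : R * 'rV[R]_d -> 'M[R]_N).
Hypotheses (oE : orlicz mu KL E) (B_symm : forall p, symm_mx (B p)).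
Hypothesis (B_itg : itg_mx mu B).

Lemma measurable_continuous_mx m k (f : 'rV[R]_d -> 'M[R]_(m, k)) : continuous f -> measurable_fun setT f.
Proof.
move=> cf; apply/measurable_fun_mxP => i j; apply: continuous_measurable_rV.
exact: continuous_entry.
Qed.

Lemma itg_continuousM (f : RT * 'rV[R]_d -> R) (g : R * 'rV[R]_d -> R) :
  itg f -> continuous g -> itg (fun p => f p * g p).
Proof.
move=> itf cg; have [C gC] := ae_bounded_spacetime hl hT cg.
apply: (itg_boundedM (C := C)) => //; exact: continuous_measurable_R_rV.
Qed.

Lemma continuous_fst_comp (f : R -> R) : continuous f -> continuous (fun p : R * 'rV[R]_d => f p.1).
Proof.
move=> cf p; have c1 : continuous (fst : R * 'rV[R]_d -> R) by move=> q; exact: cvg_fst.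
exact: (continuous_comp (c1 p) (cf _)).
Qed.

Lemma continuous_snd_comp (f : 'rV[R]_d -> R) : continuous f -> continuous (fun p : R * 'rV[R]_d => f p.2).
Proof.
move=> cf p; have c2 : continuous (snd : R * 'rV[R]_d -> 'rV[R]_d) by move=> q; exact: cvg_snd.
exact: (continuous_comp (c2 p) (cf _)).
Qed.

Lemma itg_weighted_frob m k (w : R -> R) (A : R * 'rV[R]_d -> 'M[R]_(m, k)) (psi : 'rV[R]_d -> 'M[R]_(m, k)) :
  continuous w -> itg_mx mu A -> continuous psi ->
  itg (fun p => w p.1 * frob (A p) (psi p.2)).
Proof.
move=> cw iA cpsi; under eq_fun do rewrite mulrC.
apply: itg_continuousM; last exact: continuous_fst_comp.
apply: itg_sum => i _; apply: itg_sum => j _; apply: itg_continuousM => //.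
by apply: (continuous_snd_comp (f := fun x => psi x i j)); exact: continuous_entry.
Qed.

Lemma itg_weighted m k (w : R -> R) (A : R * 'rV[R]_d -> 'M[R]_(m, k)) i j :
  continuous w -> itg_mx mu A -> itg (fun p => w p.1 * A p i j).
Proof.
move=> cw iA; under eq_fun do rewrite mulrC.
by apply: itg_continuousM => //; exact: continuous_fst_comp.
Qed.

Lemma itg_orlicz_mx : itg_mx mu E.
Proof. by move=> i j; rewrite ord1; exact: itg_legendre_entry oE. Qed.

(* Testing the constraint with the product w(t) psi(x) gives L^* zeta = G for the averages
   zeta of E against -w and G of B against w'. *)
Lemma weak_adjoint_time_average (w w' : R -> R) : dual_constraint l T L E B ->
  smooth w -> w 0 = 0 -> (forall t, is_derive t (1 : R) w (w' t)) -> continuous w' ->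
  weak_adjoint l L (time_average T (fun t => - w t) E) (time_average T w' B).
Proof.
move=> EB sw w0 dw cw' psi spsi ppsi psi_symm.
have cw := smooth_continuous sw; have cpsi := smooth_continuous spsi.
have cNw : continuous (fun t => - w t) by move=> t; apply: cvgN; exact: cw.
have cLpsi := continuous_op_apply (L := L) spsi.
have iE := itg_orlicz_mx.
have i1 := itg_weighted_frob cNw iE cLpsi; have i2 := itg_weighted_frob cw' B_itg cpsi.
rewrite (integral_frob_time_average _ _ i1); last 2 first.
  by move=> i j; exact: (itg_weighted (w := fun t => - w t)).
  exact: measurable_continuous_mx.
rewrite (integral_frob_time_average _ _ i2); last 2 first.
  by move=> i j; exact: itg_weighted.
  exact: measurable_continuous_mx.
congr EFin; apply/eqP; rewrite eq_sym -subr_eq0 -RintegralB//.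
have := EB (fun p => w p.1 *: psi p.2) (smooth_scale_prod sw spsi).
have Ep (p : R * 'rV[R]_d) : frob (B p) ('D_((1, 0) : R * 'rV[R]_d) (fun p => w p.1 *: psi p.2) p) +
    frob (E p) (op_apply L (fun x => w p.1 *: psi x) p.2) =
    w' p.1 * frob (B p) (psi p.2) - (- w p.1) * frob (E p) (op_apply L psi p.2).
  case: p => t x /=; have [dwt wE] := dw t.
  have [_ ->] := is_derive_scale_prod dwt (smooth_derivable (x := x) (v := 0) spsi) cpsi.
  rewrite derive_dir0 scaler0 addr0 wE op_applyZ// !frobZr; ring.
move=> H; apply/eqP/EFin_inj; rewrite -EFin_Rint; last exact: itgB.
rewrite -[RHS]H.
- by apply: eq_integral => p _; rewrite Ep.
- by move=> t i x /=; rewrite ppsi.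
- by move=> p; rewrite /symm_mx/= linearZ/= (psi_symm p.2).
- by move=> x /=; rewrite w0 scale0r.
Qed.

(* With w' = g >= 0 a difference of sigmoids, the sign condition on hI + 2B bounds the
   eigenvalues of -G by (b/2) \int g, so the trace condition bounds tr G = \int g tr B; letting
   g approximate indicators of intervals localizes this in time. *)
Lemma ae_trace_le (h : R -> R) (b c : R) : dual_constraint l T L E B ->
  (forall t, 0 <= t <= T -> h t <= b) ->
  (\forall p \ae mu, psd_mx ((h p.1)%:M + 2 *: B p)) ->
  (forall zeta G, orlicz nu KL zeta -> Lp_symm nu 1%E G -> weak_adjoint l L zeta G ->
    forall k : R,
      (\forall x \ae nu, forall a, eigenvalue (- G x) a -> a <= k) ->
      (\forall x \ae nu, forall a, eigenvalue (G x) a -> a <= c * k)) ->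
  \forall p \ae mu, \tr (B p) <= N%:R * (c * (b / 2)).
Proof.
move=> EB hb psdQ trace.
have iC : itg (fun p => N%:R * (c * (b / 2)) - \tr (B p)).
  by apply: itgB; [exact: itg_cst|apply: itg_sum => i _; exact: B_itg].
suff H : \forall p \ae (mT \x nu)%E, 0 <= N%:R * (c * (b / 2)) - \tr (B p).
  by apply: (@ae_imp _ _ _ mu _ _ H) => p; rewrite subr_ge0.
apply: (ae_ge0_of_slices iC) => k s r sr.
set a := k.+1%:R : R; have a0 : 0 < a by rewrite ltr0n.
pose g t : R := sigmoid a (ratr s) t - sigmoid a (ratr r) t.
pose w0 t : R := softplus a (ratr s) t + (-1) *: softplus a (ratr r) t.
(* The value at 0 is subtracted to satisfy the initial condition on test functions; the derivative
   is unaffected. *)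
pose w t : R := w0 t + - w0 0.
have sw : smooth w.
  move=> q; apply: class_CD; last exact: class_C_cst.
  by apply: class_CD; [|apply: class_CZ]; exact: smooth_softplus.
have dw t : is_derive t (1 : R) w (g t).
  have D1 := is_derive_softplus (ratr s) t a0; have D2 := is_derive_softplus (ratr r) t a0.
  have : is_derive t (1 : R) w (g t + 0).
    apply: is_deriveD; rewrite /g -[- sigmoid _ _ _]mulN1r; apply: is_deriveD.
  by rewrite addr0.
have cg : continuous g.
  apply: continuous_fD => t.
    by apply/differentiable_continuous/derivable1_diffP; have [] := is_derive_sigmoid a (ratr s) t.
  apply: cvgN.
  by apply/differentiable_continuous/derivable1_diffP; have [] := is_derive_sigmoid a (ratr r) t.
have g0 t : 0 <= g t by rewrite subr_ge0; apply: sigmoid_ge => //; exact: ltW.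
have wa := weak_adjoint_time_average EB sw (subrr _) dw cg.
have cw := smooth_continuous sw.
have cNw : continuous (fun t => - w t) by move=> t; apply: cvgN; exact: cw.
have [C wC] := continuous_bounded_cell hl hT (continuous_fst_comp cNw).
have oz : orlicz nu KL (time_average T (fun t => - w t) E).
  apply: (orlicz_time_average hT K_N K0 K_cont KL_D2 (C := C)) => //.
    exact: continuous_measurable_fun.
  by move=> t /andP[t0 tT]; apply: (wC (t, 0)) => [|i] /=; rewrite ?mxE ?lexx !ltW.
have igB i j := itg_weighted i j cg B_itg.
have LG : Lp_symm nu 1%E (time_average T g B).
  apply/Lp_symm1P; split; last by move=> i j; exact: itg_time_average.
  move=> x; apply/matrixP => i j; rewrite !mxE; apply: eq_Rintegral => t _.
  by rewrite !mxE; congr (_ * _); have /matrixP/(_ i j) := B_symm (t, x); rewrite mxE.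
have ig : mT.-integrable setT (EFin \o g).
  apply: (le_itg _ (itg_cst mT 1)); first exact: continuous_measurable_fun.
  move=> t; rewrite ger0_norm//.
  have /andP[_ s1] := sigmoid_gt0_lt1 a (ratr s) t; have /andP[r0 _] := sigmoid_gt0_lt1 a (ratr r) t.
  rewrite /g; lra.
have := trace _ _ oz LG wa (b / 2 * \int[mT]_t g t).
have sl := ae_slice_itg_mx igB.
(* For an eigenvector v of -G with eigenvalue e, e |v|^2 is the integral of - g B(v, v), and h |v|^2
   + 2 B(v, v) >= 0 with h <= b bounds the integrand by (b/2) |v|^2 g. *)
have up : \forall x \ae nu, forall e, eigenvalue (- time_average T g B x) e -> e <= b / 2 * \int[mT]_t g t.
  apply: (ae_imp (ae_and (ae_prod_slices psdQ) sl)) => x [psd isl] e /eigenvalueP[v ve vn0].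
  have vv : 0 < frob v v by rewrite lt_def frob_ge0 andbT; apply: contra vn0 => /eqP/frob_eq0->.
  have : bform (- time_average T g B x) v v = e * frob v v.
    rewrite /bform ve -scalemxAl mxE mxE frob_rV; congr (_ * _).
    by apply: eq_bigr => i _; rewrite mxE.
  rewrite -scaleN1r bform_mxZl mulN1r bform_frob frob_mx_int// => eE.
  rewrite -(ler_pM2r vv) -eE -subr_ge0 opprK.
  have -> : b / 2 * (\int[mT]_t g t) * frob v v = b / 2 * frob v v * \int[mT]_t g t by ring.
  rewrite -RintegralZl// -RintegralD//; [|exact: itgZ|exact: itg_frob].
  have := ae_le_Rint (itg_cst mT 0) (itgD (itgZ (b / 2 * frob v v) ig) (itg_frob _ isl)).
  rewrite Rint_cst_oitv// mul0r; apply.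
  have := ae_and (ae_lebesgue_oitv_dom T) psd.
  move=> H; apply: (@ae_imp _ _ _ mT _ _ H) => t [/andP[t0 tT] [_ /(_ v)]] /=.
  rewrite -/(bform _ _ _) bform_mxDl bform_scalar bform_mxZl frobZl -bform_frob => Q0.
  have hbt : h t <= b by apply: hb; rewrite !ltW.
  have := ler_wpM2r (ltW vv) hbt => hbv.
  rewrite mulrC -mulrDr mulr_ge0//; lra.
move=> /(_ up); move: sl; apply: filterS2 => x isl Ge.
have Gs : symm_mx (time_average T g B x) by have [] := LG.
have := symm_eigenvalue_tr Gs Ge; rewrite -[\tr _]mul1r -frob_scalarr frob_mx_int// => H.
have -> : \int[mT]_t (g t * (N%:R * (c * (b / 2)) - \tr (B (t, x)))) =
    \int[mT]_t (N%:R * (c * (b / 2)) * g t - frob (g t *: B (t, x)) 1%:M).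
  by apply: eq_Rintegral => t _; rewrite frobZl frob_scalarr; ring.
rewrite RintegralB//; [|exact: itgZ|exact: itg_frob].
by rewrite RintegralZl// subr_ge0 -!mulrA; apply: le_trans H _; rewrite -!mulrA.
Qed.

End trace_bound.

(** * The dual problem *)

Section dual_problem_theory.
Context {R : realType} {d n N : nat} (l T : R).
Hypotheses (hl : 0 < l) (hT : 0 < T).
Variables (F : 'rV[R]_n -> 'M[R]_N) (L : diff_operator R d n N) (h : R -> R).
Variable v0 : 'rV[R]_d -> 'rV[R]_n.
Local Notation RT := (measurableTypeR R).
Local Notation nu := (torus_measure d l).
Local Notation mT := (lebesgue_oitv T : {finite_measure set RT -> \bar R}).
Local Notation X := (RT * 'rV[R]_d)%type.
Local Notation mu := (spacetime_measure l T : {finite_measure set X -> \bar R}).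
Local Notation K := (Kfun F).
Local Notation KL := (legendre (Kfun F)).
Local Notation itg f := (mu.-integrable setT (EFin \o f)).
Hypotheses (F_symm : forall v, symm_mx (F v)) (F_cont : continuous F).
Hypotheses (K_strict : strictly_convex K) (K_N : N_function K).
Hypotheses (K_D2 : Delta2 K) (KL_D2 : Delta2 KL).
Hypothesis (F_cone : forall v, Lambda_cone l L (F v)).
Variables (a b c : R).
Hypotheses (h_meas : measurable_fun setT h) (a0 : 0 < a).
Hypothesis (h_bounds : forall t, 0 <= t <= T -> a <= h t <= b).
Hypothesis (trace : forall zeta G, orlicz nu KL zeta -> Lp_symm nu 1%E G -> weak_adjoint l L zeta G ->
    forall k : R,
      (\forall x \ae nu, forall a, eigenvalue (- G x) a -> a <= k) ->
      (\forall x \ae nu, forall a, eigenvalue (G x) a -> a <= c * k)).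
Hypothesis (v0_orlicz : orlicz nu K v0).

Lemma Kfun0 : K 0 = 0.
Proof. by rewrite /Kfun subrr mxtrace0 mul0r. Qed.

Lemma tr_Kfun v : \tr (F v) = 2 * K v + \tr (F 0).
Proof. by rewrite /Kfun linearB /=; field. Qed.

Lemma continuous_Kfun : continuous K.
Proof.
have -> : K = fun v => 2^-1 * frob (F v - F 0) 1%:M.
  by apply/funext => v; rewrite /Kfun frob_scalarr mul1r mulrC.
apply: continuous_fM; first exact: cst_continuous.
apply: continuous_frob; last exact: cst_continuous.
by move=> v; apply: (@continuousB _ _ _ F (cst (F 0))); [exact: F_cont|exact: cst_continuous].
Qed.
Let K0 := Kfun0.
Let K_cont := continuous_Kfun.

Lemma Lambda_scalar_sub (s : R) P : Lambda l L P -> Lambda l L (s%:M - P).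
Proof.
move=> LP W W1 WL; apply: rpredB; last exact: LP.
by rewrite -[s]mulr1 -scale_scalar_mx; exact: rpredZ.
Qed.

Lemma Lambda1 : Lambda l L 1%:M. Proof. by []. Qed.

Lemma psd1 : psd_mx (1%:M : 'M[R]_N).
Proof.
split; first by rewrite /symm_mx/= tr_scalar_mx.
by move=> x; rewrite -/(bform _ _ _) bform_scalar mul1r frob_ge0.
Qed.

Lemma tr_F_ge0 v : 0 <= \tr (F v).
Proof. by have [_ /(_ _ Lambda1 psd1)] := F_cone v; rewrite frob_scalarr mul1r. Qed.

(* For P in Lambda and P >= 0, the matrix N (tr P) I - P is again nonnegative and in Lambda. *)
Lemma Lambda_le_tr v : Lambda_le l L (F v) (N%:R * \tr (F v))%:M.
Proof.
split; first by rewrite /symm_mx/= linearB/= tr_scalar_mx F_symm.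
move=> P LP psdP; have [_ Fc] := F_cone v.
have := Fc _ (Lambda_scalar_sub (N%:R * \tr P) LP) (psd_scalar_tr psdP).
by rewrite frobBr frobBl frob_scalarr frob_scalarl mulrAC.
Qed.

Definition feasible (z : X -> 'rV[R]_n) (M : X -> 'M[R]_N) :=
  [/\ orlicz mu K z, Lp_symm mu 1%E M & \forall p \ae mu, Lambda_le l L (F (z p)) (M p)].

(** Integrability of M rests on tr F(z) = 2 K(z) + tr F(0), so the Orlicz class of z is exactly what
    is needed. *)
Lemma feasible_scalar z : orlicz mu K z ->
  feasible z (fun p => (N%:R * \tr (F (z p)))%:M).
Proof.
move=> oz; split=> //; last by apply: aeW => p; exact: Lambda_le_tr.
apply/Lp_symm1P; split=> [p|i j]; first by rewrite /symm_mx/= tr_scalar_mx.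
have /(orlicz_N mu K_N K_cont)[_ iz] := oz.
have itr : itg (fun p => N%:R * \tr (F (z p))).
  apply: itgZ; under eq_fun do rewrite tr_Kfun.
  by apply: itgD; [exact: itgZ|exact: itg_cst].
case: (eqVneq i j) => [->|ij].
  by move: itr; congr (mu.-integrable _ (EFin \o _)); apply/funext => p; rewrite mxE eqxx.
move: (itg_cst mu 0); congr (mu.-integrable _ (EFin \o _)); apply/funext => p.
by rewrite mxE (negPf ij).
Qed.

Lemma ae_h_bounds : \forall p \ae mu, a <= h p.1 <= b.
Proof.
apply: (@ae_imp _ _ _ mu _ _ (ae_spacetime_cell (d := d) T hl)) => p [/andP[p1 p2] _].
by apply: h_bounds; rewrite !ltW.
Qed.

Lemma measurable_h_fst : measurable_fun (setT : set X) (fun p => h p.1).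
Proof. by apply: (measurableT_comp (f := (h : RT -> R))) => //; exact: measurable_fst. Qed.

Lemma ae_h_norm : \forall p \ae mu, `|h p.1| <= b.
Proof.
apply: (@ae_imp _ _ _ mu _ _ ae_h_bounds) => p /andP[ha hb].
by rewrite ger0_norm//; exact: le_trans (ltW a0) ha.
Qed.

Lemma itg_snd (f : 'rV[R]_d -> R) : measurable_fun setT f -> (forall x, 0 <= f x) ->
  nu.-integrable setT (EFin \o f) -> itg (fun p => f p.2).
Proof.
move=> mf f0 itf; apply: ge0_itg => //.
  by apply: (measurableT_comp (f := f)) => //; exact: measurable_snd.
have mf2 : measurable_fun setT (fun p : X => (f p.2)%:E).
  apply/measurable_EFinP; apply: (measurableT_comp (f := f)) => //; exact: measurable_snd.
have f20 (p : X) : (0 <= (f p.2)%:E)%E by rewrite lee_fin.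
have := @fubini_tonelli2 _ _ _ _ _ mT nu _ mf2 f20; rewrite /fubini_G/= => H.
apply: le_lt_trans (_ : (\int[nu]_x ((T * f x)%:E) < +oo)%E).
  rewrite H le_eqVlt; apply/orP; left; apply/eqP; apply: eq_integral => x _.
  rewrite integral_cst//= EFinM muleC; congr (_ * _)%E; exact: lebesgue_oitvT.
apply: itg_lty => [x|]; first by rewrite mulr_ge0// ltW.
exact: itgZ.
Qed.

Lemma orlicz_snd : orlicz mu K (fun p => v0 p.2).
Proof.
have /(orlicz_N nu K_N K_cont)[mv iv] := v0_orlicz.
apply/orlicz_N => //; split; first by apply: (measurableT_comp (f := v0)) => //; exact: measurable_snd.
apply: (itg_snd (f := fun x => K (v0 x))) => //; first exact: itg_measurable iv.
by move=> x; exact: N_function_ge0.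
Qed.

(** What makes the pairings of (E, B) with competitors and test functions finite. It is kept apart
    from admissibility so that midpoints and limits can be paired before they are known to satisfy
    the constraint. *)
Definition regular_pair (E : X -> 'rV[R]_n) (B : X -> 'M[R]_N) :=
  [/\ orlicz mu KL E, (forall i j, measurable_fun setT (fun p => B p i j)) &
      exists C, \forall p \ae mu, forall i j, `|B p i j| <= C].

Lemma itg_pairing z M E B : orlicz mu K z -> itg_mx mu M -> regular_pair E B ->
  itg (fun p => frob (z p) (E p) + frob (M p) (B p)).
Proof.
move=> oz iM [oE mB [C BC]]; apply: itgD; first exact: (itg_young K_N K0 K_cont).
exact: (itg_frob_bounded (C := C)).
Qed.

Lemma itg_h_tr (M : X -> 'M[R]_N) : itg_mx mu M -> itg (fun p => h p.1 * \tr (M p) / 2).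
Proof.
move=> iM; have itr : itg (fun p => \tr (M p)) by apply: itg_sum => i _; exact: iM.
have := itgZ 2^-1 (itg_boundedM itr measurable_h_fst ae_h_norm).
by congr (mu.-integrable _ (EFin \o _)); apply/funext => p; field.
Qed.

(** Replaces an extended-real infimum by real inequalities that are linear in (E, B), the form in
    which convexity and closedness of superlevel sets can be read off. *)
Lemma dual_objective_ge E B (r : R) : regular_pair E B ->
  (r%:E <= dual_objective l T F L h v0 E B)%E <->
  forall z M, feasible z M ->
    r - \int[mu]_p (h p.1 * \tr (M p) / 2) <=
    \int[mu]_p (frob (z p - v0 p.2) (E p) + frob (M p) (B p)).
Proof.
move=> rEB; have [oE _ _] := rEB.
have iv : itg (fun p => frob (v0 p.2) (E p)) by exact: (itg_young K_N K0 K_cont orlicz_snd).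
have val z M : feasible z M ->
    (\int[mu]_p (frob (z p) (E p) + frob (M p) ((h p.1)%:M + 2 *: B p) / 2)%:E =
     (\int[mu]_p (frob (z p - v0 p.2) (E p) + frob (M p) (B p)) +
      \int[mu]_p (h p.1 * \tr (M p) / 2) + \int[mu]_p frob (v0 p.2) (E p))%:E)%E.
  move=> [oz /Lp_symm1P[_ iM] _]; have ih := itg_h_tr iM.
  have ip := itg_pairing (orlicz_sub K_strict K_N K0 K_cont K_D2 oz orlicz_snd) iM rEB.
  have ic := itgD (itgD ip ih) iv.
  rewrite -RintegralD// -RintegralD//; last exact: itgD.
  rewrite -EFin_Rint//; apply: eq_integral => p _; congr EFin.
  by rewrite frobDr frobZr frob_scalarr frobBl; field.
rewrite /dual_objective EFin_Rint// addeC leeBrDr//; split.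
  move=> rinf z M zM; have [oz LM zMle] := zM.
  have := le_trans rinf (ereal_inf_lbound _); move/(_ _ (ex_intro _ z (ex_intro _ M (And4 oz LM zMle erefl)))).
  by rewrite val// -EFinD lee_fin; lra.
move=> H; apply: le_ereal_inf_tmp => _ [z [M [oz LM zMle ->]]].
have zM : feasible z M by [].
by rewrite val// -EFinD lee_fin; have := H _ _ zM; lra.
Qed.
(** [Cb] is the bound on tr B from [ae_trace_le]. For [Ce], the entries of hI + 2B are at most its
    trace, hence at most N b + 2 Cb, and removing the diagonal term h costs another b before
    halving. *)
Let Cb : R := N%:R * (c * (b / 2)).
Let Ce : R := (N%:R * b + 2 * Cb + b) / 2.

Lemma h_ub_ge0 : 0 <= b.
Proof.
have /andP[ha hb] : a <= h 0 <= b by apply: h_bounds; rewrite lexx ltW.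
exact: le_trans (ltW a0) (le_trans ha hb).
Qed.

Lemma spacetime_measure_gt0 : (0 < mu setT)%E.
Proof. by rewrite (spacetime_measureT (d := d) hl hT) lte_fin mulr_gt0// exprn_gt0. Qed.

Lemma admissible_regular E B : dual_admissible l T F L h E B -> regular_pair E B.
Proof. by move=> [oE /(Lp_symmyP _ spacetime_measure_gt0)[_ mB BC] _ _]. Qed.

Lemma regular_itg_mx E B : regular_pair E B -> itg_mx mu B.
Proof.
move=> [_ mB [C BC]] i j; apply: (ae_le_itg (mB i j) (itg_cst mu C)).
by apply: filterS BC => p; apply.
Qed.

Lemma admissible_bounds E B : dual_admissible l T F L h E B ->
  \forall p \ae mu, \tr (B p) <= Cb /\ forall i j, `|B p i j| <= Ce.
Proof.
move=> adm; have rEB := admissible_regular adm; have iB := regular_itg_mx rEB.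
have [oE /(Lp_symmyP _ spacetime_measure_gt0)[Bs _ _] EB psdQ] := adm.
have hb t : 0 <= t <= T -> h t <= b by move=> /h_bounds/andP[].
have trB := ae_trace_le hl hT K_N K0 K_cont KL_D2 oE Bs iB EB hb psdQ trace.
have H := ae_and ae_h_bounds (ae_and trB psdQ).
apply: (@ae_imp _ _ _ mu _ _ H) => p [/andP[ha hb'] [tB pQ]]; split=> // i j.
have := psd_entry_le_tr i j pQ; rewrite mxtraceD mxtraceZ mxtrace_scalar !mxE => Qij.
have hij : `|h p.1 *+ (i == j)| <= b.
  case: (i == j); rewrite ?mulr0n ?normr0; last exact: h_ub_ge0.
  by rewrite mulr1n ger0_norm//; exact: le_trans (ltW a0) ha.
have : `|2 * B p i j| <= N%:R * b + 2 * Cb + b.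
  have -> : 2 * B p i j = (h p.1 *+ (i == j) + 2 * B p i j) - h p.1 *+ (i == j) by ring.
  apply: le_trans (ler_normB _ _) _; apply: lerD => //; apply: le_trans Qij _.
  rewrite -[h p.1 *+ N]mulr_natl; apply: lerD; first by rewrite ler_wpM2l.
  by rewrite ler_pM2l.
by rewrite normrM ger0_norm// /Ce; lra.
Qed.

(* Obtained from the competitor z = v0 - w, M = N (tr F(z)) I in the infimum. *)
Lemma dual_objective_estimate : exists A c1 : R, 0 < c1 /\
  forall E B r, dual_admissible l T F L h E B ->
    (r%:E <= dual_objective l T F L h v0 E B)%E ->
  forall w, orlicz mu K w ->
    r + \int[mu]_p frob (w p) (E p) <= A + c1 * \int[mu]_p K (w p).
Proof.
have combine (r i1 i2 i3 i4 i5 m : R) : r - i2 <= i1 -> 0 <= i5 ->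
    i1 + i2 + i3 <= i4 + m * i5 -> r + i3 <= i4 + (m + 1) * i5 by lra.
have [C2 C20 KC2] := Delta2_scale (N_function_ge0 K_N) (N_function_scale K_strict K_N K0) K_D2 2.
have b0 := h_ub_ge0.
(* Bounds the coefficient N (N h / 2 + tr B) that multiplies tr F(z) below; the absolute value is
   there because the sign of Cb is not known. *)
pose k1 : R := N%:R * (b * N%:R / 2 + `|Cb|).
have k10 : 0 <= k1 by rewrite mulr_ge0// addr_ge0// divr_ge0// mulr_ge0.
have ov2 := orlicz_scale K_strict K_N K0 K_cont K_D2 2 orlicz_snd.
have /(orlicz_N mu K_N K_cont)[_ iv2] := ov2.
pose g (p : X) : R := k1 * (2 * K (2 *: v0 p.2) + (2 * C2 + \tr (F 0))).
have ig : itg g by apply: itgZ; apply: itgD; [exact: itgZ|exact: itg_cst].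
(* The added 1 makes the constant positive, k1 being only known to be nonnegative. *)
exists (\int[mu]_p g p), (2 * k1 * C2 + 1); split.
  by rewrite ltr_wpDl// mulr_ge0// ?(ltW C20)// mulr_ge0.
move=> E B r adm robj w ow; have rEB := admissible_regular adm; have [oE _ _] := rEB.
have ovw := orlicz_sub K_strict K_N K0 K_cont K_D2 orlicz_snd ow.
pose z (p : X) := v0 p.2 - w p; pose M (p : X) : 'M[R]_N := (N%:R * \tr (F (z p)))%:M.
have zM : feasible z M := feasible_scalar ovw; have [_ /Lp_symm1P[_ iM] _] := zM.
have /(orlicz_N mu K_N K_cont)[_ iw] := ow.
have iwE := itg_young K_N K0 K_cont ow oE.
have ih := itg_h_tr iM.
have rM := (dual_objective_ge r rEB).1 robj _ _ zM.
have oz := orlicz_sub K_strict K_N K0 K_cont K_D2 ovw orlicz_snd.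
have ip := itg_pairing oz iM rEB.
(* As z - v0 = - w, the pairings with E cancel and the integrand is tr F(z) times N (N h / 2 + tr
   B). *)
have : \int[mu]_p (frob (z p - v0 p.2) (E p) + frob (M p) (B p)) + \int[mu]_p (h p.1 * \tr (M p) / 2)
    + \int[mu]_p frob (w p) (E p) <= \int[mu]_p g p + \int[mu]_p (2 * k1 * C2 * K (w p)).
  rewrite -RintegralD// -RintegralD//; last exact: itgD.
  rewrite -RintegralD//; last exact: itgZ.
  apply: ae_le_Rint.
  - by apply: itgD => //; exact: itgD.
  - by apply: itgD => //; exact: itgZ.
  have H := ae_and ae_h_bounds (admissible_bounds adm).
  apply: (@ae_imp _ _ _ mu _ _ H) => p [/andP[ha hb] [tB _]].
  rewrite frobBl frobBl /M frob_scalarl mxtrace_scalar.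
  set t := \tr (F (z p)).
  have t0 : 0 <= t by exact: tr_F_ge0.
  have tE : t <= 2 * K (2 *: v0 p.2) + (2 * C2 + \tr (F 0)) + 2 * C2 * K (w p).
    have := N_function_sub K_strict K_N (v0 p.2) (w p).
    have := KC2 (w p); rewrite /t /z tr_Kfun; lra.
  have S1 : N%:R * (h p.1 * N%:R / 2 + \tr (B p)) <= k1.
    rewrite ler_wpM2l// lerD//; last exact: le_trans tB (ler_norm _).
    by rewrite ler_wpM2r// ler_wpM2r.
  have S2 := ler_wpM2r t0 S1; have S3 := ler_wpM2l k10 tE.
  rewrite -mulr_natl /g; lra.
have Kw0 : 0 <= \int[mu]_p K (w p) by apply: Rintegral_ge0 => p _; exact: N_function_ge0.
rewrite RintegralZl//; exact: combine rM Kw0.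
Qed.

Lemma dual_objective_coercive (r : R) : exists D : R, forall E B,
  dual_admissible l T F L h E B -> (r%:E <= dual_objective l T F L h v0 E B)%E ->
  \int[mu]_p KL (E p) <= D.
Proof.
have [A [c1 [c10 est]]] := dual_objective_estimate.
have KL_scale := Delta2_scale (legendre_ge0 K_N K0) (legendre_scale K_N K0) KL_D2.
(* Duality bounds K^*(E / c1). C3 undoes the division by c1, and C4 gives the integrability of K^*(E
   / c1). *)
have [C3 C30 KC3] := KL_scale c1; have [C4 C40 KC4] := KL_scale c1^-1.
exists (C3 * ((A - r) / c1) + \int[mu]_p C3) => E B adm robj.
have [oE _ _] := admissible_regular adm.
have /(orlicz_legendre mu K_N K0 K_cont)[mE iE] := oE.
have iEc : itg (fun p => KL (c1^-1 *: E p)).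
  apply: (le_itg _ (itgZ C4 (itgD iE (itg_cst mu 1)))).
    apply: (measurableT_comp (measurable_legendre K_N K0 K_cont)); exact: measurable_scale.
  by move=> p; rewrite ger0_norm ?legendre_ge0.
have := @legendre_bound_of_pairing _ _ _ _ mu K K_N K0 K_cont E c1 (A - r) c10 oE.
have H w : orlicz mu K w -> \int[mu]_p frob (w p) (E p) <= A - r + c1 * \int[mu]_p K (w p).
  by move=> ow; have := est E B r adm robj w ow; lra.
move=> /(_ H) bE.
apply: le_trans (_ : \int[mu]_p (C3 * KL (c1^-1 *: E p) + C3) <= _).
  apply: ae_le_Rint => //; first by apply: itgD; [exact: itgZ|exact: itg_cst].
  by apply: aeW => p; have := KC3 (c1^-1 *: E p); rewrite scalerA divff ?gt_eqF// scale1r; lra.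
rewrite RintegralD//; [|exact: itgZ|exact: itg_cst].
by rewrite RintegralZl// lerD2r ler_wpM2l// ltW.
Qed.

(** The a priori estimate at w = 0. An infinite objective is excluded because the estimate would
    hold for every real r. *)
Lemma dual_value_lty : (dual_value l T F L h v0 < +oo)%E.
Proof.
have [A [c1 [c10 est]]] := dual_objective_estimate.
apply: (@le_lt_trans _ _ (A + c1 * \int[mu]_p (K 0))%:E); last exact: ltry.
apply: ge_ereal_sup => _ [E [B [adm ->]]].
have o0 : orlicz mu K (fun=> 0).
  by apply/orlicz_N => //; split; [exact: measurable_cst|exact: itg_cst].
have bnd r : (r%:E <= dual_objective l T F L h v0 E B)%E -> r <= A + c1 * \int[mu]_p (K 0).
  move=> robj; have := est E B r adm robj _ o0.
  by rewrite /Rintegral; under eq_integral do rewrite frob0l; rewrite integral0 addr0.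
move: bnd; case: dual_objective => [x|/(_ (A + c1 * \int[mu]_p (K 0) + 1) (leey _))|_].
- by move=> /(_ x (lexx _)); rewrite lee_fin.
- by rewrite gerDl ler10.
- exact: leNye.
Qed.

(** * Midpoints and limits in superlevel sets *)

Lemma ae_bounded_mx m k (f : R * 'rV[R]_d -> 'M[R]_(m, k)) : continuous f ->
  exists C, \forall p \ae mu, forall i j, `|f p i j| <= C.
Proof.
move=> cf; have [C fC] := ae_bounded_spacetime hl hT (continuous_frob cf cf).
exists (C + 1); apply: (@ae_imp _ _ _ mu _ _ fC) => p; rewrite ger0_norm ?frob_ge0// => fp i j.
(* By |x| <= x^2 + 1, bounding the single continuous function f : f bounds all entries. *)
apply: le_trans (_ : `|f p i j| ^+ 2 + 1 <= _); first by have := sqr_ge0 (`|f p i j| - 1); nra.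
rewrite lerD2r; apply: le_trans fp; rewrite real_normK ?num_real//.
rewrite /frob (bigD1 i)//= (bigD1 j)//= -expr2 -addrA lerDl addr_ge0//.
  by apply: sumr_ge0 => q _; rewrite -expr2 sqr_ge0.
by apply: sumr_ge0 => q _; apply: sumr_ge0 => q' _; rewrite -expr2 sqr_ge0.
Qed.

Lemma measurable_continuous_mx_prod m k (f : R * 'rV[R]_d -> 'M[R]_(m, k)) i j : continuous f ->
  measurable_fun (setT : set X) (fun p => f p i j).
Proof. by move=> cf; apply: continuous_measurable_R_rV; exact: continuous_entry. Qed.

Definition op_slice Psi (p : R * 'rV[R]_d) := op_apply L (fun x => Psi (p.1, x)) p.2.
Definition time_derivative (Psi : R * 'rV[R]_d -> 'M[R]_N) := 'D_((1, 0) : R * 'rV[R]_d) Psi.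

Lemma orlicz_op_slice Psi : smooth Psi -> orlicz mu K (op_slice Psi).
Proof.
move=> sPsi; have cL := continuous_op_apply_slice (L := L) sPsi.
have [C LC] := ae_bounded_mx cL.
apply: (orlicz_bounded K_N K_cont (C := C)).
  by apply/measurable_fun_mxP => i j; exact: (measurable_continuous_mx_prod i j cL).
by apply: (@ae_imp _ _ _ mu _ _ LC) => p LCp j; exact: LCp.
Qed.

Lemma itg_mx_time_derivative Psi : smooth Psi -> itg_mx mu (time_derivative Psi).
Proof.
move=> sPsi i j.
have cD : continuous (time_derivative Psi) by exact: smooth_continuous (smooth_derive _ sPsi).
have [C DC] := ae_bounded_mx cD.
apply: (ae_le_itg _ (itg_cst mu C)); first exact: measurable_continuous_mx_prod.
by apply: (@ae_imp _ _ _ mu _ _ DC) => p.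
Qed.

(** Brings the constraint into the form of the pairings that occur in the objective, with (z, M) =
    (L Psi, d_t Psi). *)
Lemma dual_constraintP E B : regular_pair E B -> dual_constraint l T L E B <->
  forall Psi, smooth Psi -> (forall t, torus_periodic l (fun x => Psi (t, x))) ->
    (forall p, symm_mx (Psi p)) -> (forall x, Psi (0, x) = 0) ->
    \int[mu]_p (frob (op_slice Psi p) (E p) + frob (time_derivative Psi p) (B p)) = 0.
Proof.
move=> rEB.
have eq Psi : smooth Psi -> (\int[mu]_p
       (frob (B p) ('D_((1, 0) : R * 'rV[R]_d) Psi p) +
        frob (E p) (op_apply L (fun x => Psi (p.1, x)) p.2))%:E =
   (\int[mu]_p (frob (op_slice Psi p) (E p) + frob (time_derivative Psi p) (B p)))%:E)%E.
  move=> sPsi; rewrite -EFin_Rint; last first.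
    by apply: itg_pairing rEB; [exact: orlicz_op_slice|exact: itg_mx_time_derivative].
  by apply: eq_integral => p _; congr EFin; rewrite addrC (frobC (E p)) (frobC (B p)).
split=> H Psi s1 s2 s3 s4.
  by apply: EFin_inj; rewrite -eq//; exact: H.
by rewrite (eq _ s1) (H Psi).
Qed.

Lemma psd_midpoint m (P Q : 'M[R]_m) : psd_mx P -> psd_mx Q -> psd_mx (2^-1 *: (P + Q)).
Proof.
move=> [Ps P0] [Qs Q0]; split; first by rewrite /symm_mx/= linearZ/= linearD/= Ps Qs.
move=> x; rewrite -/(bform _ _ _) bform_mxZl bform_mxDl mulr_ge0 ?invr_ge0// addr_ge0//.
  exact: P0.
exact: Q0.
Qed.

Lemma regular_midpoint E1 B1 E2 B2 : regular_pair E1 B1 -> regular_pair E2 B2 ->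
  regular_pair (fun p => 2^-1 *: (E1 p + E2 p)) (fun p => 2^-1 *: (B1 p + B2 p)).
Proof.
move=> [oE1 mB1 [C1 B1C]] [oE2 mB2 [C2 B2C]]; split.
- have /(orlicz_legendre mu K_N K0 K_cont)[mE1 iE1] := oE1.
  have /(orlicz_legendre mu K_N K0 K_cont)[mE2 iE2] := oE2.
  apply/orlicz_legendre => //; split; first by apply: measurable_scale; exact: measurable_mxD.
  apply: (le_itg _ (itgD (itgZ 2^-1 iE1) (itgZ (1 - 2^-1) iE2))).
    apply: (measurableT_comp (measurable_legendre K_N K0 K_cont)).
    by apply: measurable_scale; exact: measurable_mxD.
  move=> p; rewrite ger0_norm ?legendre_ge0//.
  have -> : 2^-1 *: (E1 p + E2 p) = 2^-1 *: E1 p + (1 - 2^-1) *: E2 p.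
    by rewrite scalerDr; congr (_ + _ *: _); field.
  by apply: legendre_convex => //; apply/andP; split; lra.
- move=> i j; under eq_fun do rewrite !mxE.
  apply: measurable_funM; first exact: measurable_cst.
  by apply: measurable_funD; [exact: mB1|exact: mB2].
- exists ((C1 + C2) / 2); apply: (@ae_imp _ _ _ mu _ _ (ae_and B1C B2C)) => p [b1 b2] i j.
  rewrite !mxE normrM ger0_norm ?invr_ge0// mulrC ler_wpM2r ?invr_ge0//.
  by apply: le_trans (ler_normD _ _) _; apply: lerD.
Qed.

Lemma Rint_pairing_midpoint z M E1 B1 E2 B2 : orlicz mu K z -> itg_mx mu M ->
  regular_pair E1 B1 -> regular_pair E2 B2 ->
  \int[mu]_p (frob (z p) (2^-1 *: (E1 p + E2 p)) + frob (M p) (2^-1 *: (B1 p + B2 p))) =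
  2^-1 * (\int[mu]_p (frob (z p) (E1 p) + frob (M p) (B1 p)) +
          \int[mu]_p (frob (z p) (E2 p) + frob (M p) (B2 p))).
Proof.
move=> oz iM r1 r2; have i1 := itg_pairing oz iM r1; have i2 := itg_pairing oz iM r2.
rewrite -RintegralD// -RintegralZl//; last exact: itgD.
by apply: eq_Rintegral => p _; rewrite !frobZr !frobDr; ring.
Qed.

Definition superlevel (r : R) E B :=
  dual_admissible l T F L h E B /\ (r%:E <= dual_objective l T F L h v0 E B)%E.

Lemma superlevel_midpoint r E1 B1 E2 B2 : superlevel r E1 B1 -> superlevel r E2 B2 ->
  superlevel r (fun p => 2^-1 *: (E1 p + E2 p)) (fun p => 2^-1 *: (B1 p + B2 p)).
Proof.
have half (x y z : R) : x <= y -> x <= z -> x <= 2^-1 * (y + z) by lra.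
move=> [adm1 r1] [adm2 r2].
have reg1 := admissible_regular adm1; have reg2 := admissible_regular adm2.
have reg := regular_midpoint reg1 reg2; have [oE mB BC] := reg.
have [_ /(Lp_symmyP _ spacetime_measure_gt0)[Bs1 _ _] c1 p1] := adm1.
have [_ /(Lp_symmyP _ spacetime_measure_gt0)[Bs2 _ _] c2 p2] := adm2.
split; first split=> //.
- apply/(Lp_symmyP _ spacetime_measure_gt0); split=> // p.
  by rewrite /symm_mx/= linearZ/= linearD/= (Bs1 p) (Bs2 p).
- apply/(dual_constraintP reg) => Psi s1 s2 s3 s4.
  rewrite Rint_pairing_midpoint//; [|exact: orlicz_op_slice|exact: itg_mx_time_derivative].
  by rewrite ((dual_constraintP reg1).1 c1)// ((dual_constraintP reg2).1 c2)// addr0 mulr0.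
- apply: (@ae_imp _ _ _ mu _ _ (ae_and p1 p2)) => p [q1 q2].
  have := psd_midpoint q1 q2; congr psd_mx.
  by apply/matrixP => i j; rewrite !mxE; case: (i == j); rewrite ?mulr1n ?mulr0n; field.
apply/(dual_objective_ge r reg) => z M zM; have [oz /Lp_symm1P[_ iM] _] := zM.
have ozv := orlicz_sub K_strict K_N K0 K_cont K_D2 oz orlicz_snd.
rewrite Rint_pairing_midpoint//.
apply: half; first exact: (dual_objective_ge r reg1).1 r1 _ _ zM.
exact: (dual_objective_ge r reg2).1 r2 _ _ zM.
Qed.

(** Apart from the pointwise positivity of hI + 2B, every condition is a family of inequalities
    between pairings, preserved by [pairing_usc]. *)
Lemma superlevel_closed (r : R) (r_ : nat -> R) (D : R) (E_ : nat -> X -> 'rV[R]_n)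
    (B_ : nat -> X -> 'M[R]_N) (E : X -> 'rV[R]_n) (B : X -> 'M[R]_N) :
  (forall k, superlevel (r_ k) (E_ k) (B_ k)) -> r_ @ \oo --> r ->
  (forall k, \int[mu]_p KL (E_ k p) <= D) ->
  measurable_fun setT E -> (forall i j, measurable_fun setT (fun p => B p i j)) ->
  (forall p, symm_mx (B p)) ->
  (\forall p \ae mu, (forall j, E_ k p ord0 j @[k --> \oo] --> E p ord0 j) /\
     forall i j, B_ k p i j @[k --> \oo] --> B p i j) ->
  superlevel r E B.
Proof.
move=> sup rr KD mE mB Bs cvgEB.
have cE : \forall p \ae mu, forall j, E_ k p ord0 j @[k --> \oo] --> E p ord0 j.
  by apply: (@ae_imp _ _ _ mu _ _ cvgEB) => p [].
have cB : \forall p \ae mu, forall i j, B_ k p i j @[k --> \oo] --> B p i j.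
  by apply: (@ae_imp _ _ _ mu _ _ cvgEB) => p [].
have reg_ k : regular_pair (E_ k) (B_ k) by have [/admissible_regular] := sup k.
have oE_ k : orlicz mu KL (E_ k) by have [] := reg_ k.
have mB_ k i j : measurable_fun setT (fun p => B_ k p i j) by have [_ mBk _] := reg_ k; exact: mBk.
have BC_ : \forall p \ae mu, forall k i j, `|B_ k p i j| <= Ce.
  apply: ae_foralln => k; have [/admissible_bounds H _] := sup k.
  by apply: (@ae_imp _ _ _ mu _ _ H) => p [].
have BC : \forall p \ae mu, forall i j, `|B p i j| <= Ce.
  apply: (@ae_imp _ _ _ mu _ _ (ae_and BC_ cB)) => p [bc cb] i j.
  by apply: (ler_cvg_to (cvg_norm (cb i j)) (cvg_cst Ce)); apply: nearW => k; exact: bc.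
have oE := legendre_fatou K_N K0 K_cont oE_ mE KD cE.
have reg : regular_pair E B by split=> //; exists Ce.
have usc z M a_ a1 : orlicz mu K z -> itg_mx mu M ->
    (forall k, a_ k <= \int[mu]_p (frob (z p) (E_ k p) + frob (M p) (B_ k p))) -> a_ @ \oo --> a1 ->
    a1 <= \int[mu]_p (frob (z p) (E p) + frob (M p) (B p)).
  move=> oz iM le_a cv_a.
  exact: (pairing_usc K_strict K_N K0 K_cont K_D2 oz iM oE_ oE mB_ mB BC_ BC KD cE cB le_a cv_a).
split; first split=> //.
- by apply/(Lp_symmyP _ spacetime_measure_gt0); split=> //; exists Ce.
- apply/(dual_constraintP reg) => Psi s1 s2 s3 s4.
  have oL := orlicz_op_slice s1; have iD := itg_mx_time_derivative s1.
  have con k : \int[mu]_p (frob (op_slice Psi p) (E_ k p) + frob (time_derivative Psi p) (B_ k p)) = 0.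
    by have [[_ _ /(dual_constraintP (reg_ k)) + _] _] := sup k; apply.
  (* Upper semicontinuity gives one inequality only; the other comes from the opposite test
     function. *)
  apply/eqP; rewrite eq_le; apply/andP; split; last first.
    by apply: (usc _ _ (fun=> 0)) => // [k|]; [rewrite con|exact: cvg_cst].
  have oLN := orlicz_scale K_strict K_N K0 K_cont K_D2 (-1) oL.
  have iDN : itg_mx mu (fun p => (-1) *: time_derivative Psi p).
    move=> i j; have := itgZ (-1) (iD i j); congr (mu.-integrable _ (EFin \o _)).
    by apply/funext => p; rewrite mxE.
  have neg E' B' : regular_pair E' B' ->
      \int[mu]_p (frob ((-1) *: op_slice Psi p) (E' p) + frob ((-1) *: time_derivative Psi p) (B' p)) =
      - \int[mu]_p (frob (op_slice Psi p) (E' p) + frob (time_derivative Psi p) (B' p)).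
    move=> reg'; rewrite -[RHS]mulN1r -RintegralZl//; last exact: itg_pairing reg'.
    by apply: eq_Rintegral => p _; rewrite !frobZl mulrDr.
  rewrite -oppr_ge0 -neg//; apply: (usc _ _ (fun=> 0)) => // [k|]; last exact: cvg_cst.
  by rewrite neg// con oppr0.
- have psd_ : \forall p \ae mu, forall k, psd_mx ((h p.1)%:M + 2 *: B_ k p).
    by apply: ae_foralln => k; have [[]] := sup k.
  apply: (@ae_imp _ _ _ mu _ _ (ae_and psd_ cB)) => p [psd cb].
  split; first by rewrite /symm_mx/= linearD/= linearZ/= tr_scalar_mx (Bs p).
  move=> x; rewrite -/(bform _ _ _) bform_mxDl bform_scalar bform_mxZl bform_frob frobC.
  rewrite addrC -lerBlDr sub0r -ler_pdivrMl//.
  apply: (ler_cvg_to (cvg_cst _) (cvg_frobr cb)); apply: nearW => k.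
  have [_ /(_ x)] := psd k; rewrite -/(bform _ _ _) bform_mxDl bform_scalar bform_mxZl bform_frob frobC.
  by rewrite addrC -lerBlDr sub0r -ler_pdivrMl.
apply/(dual_objective_ge r reg) => z M zM; have [oz /Lp_symm1P[_ iM] _] := zM.
have ozv := orlicz_sub K_strict K_N K0 K_cont K_D2 oz orlicz_snd.
apply: (usc _ _ (fun k => r_ k - \int[mu]_p (h p.1 * \tr (M p) / 2))) => // [k|].
  by have [_ rk] := sup k; exact: ((dual_objective_ge (r_ k) (reg_ k)).1 rk).
by apply: cvgB => //; exact: cvg_cst.
Qed.

(** * The zero pair and the lower bound *)

Lemma regular_zero : regular_pair (fun=> 0) (fun=> 0).
Proof.
split.
- apply/orlicz_legendre => //; split; first exact: measurable_cst.
  by have := itg_cst mu (KL 0).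
- by move=> i j; exact: measurable_cst.
- by exists 0; apply: aeW => p i j; rewrite mxE normr0.
Qed.

Lemma admissible_zero : dual_admissible l T F L h (fun=> 0) (fun=> 0).
Proof.
have [oE mB BC] := regular_zero; split=> //.
- apply/(Lp_symmyP _ spacetime_measure_gt0); split=> // p.
  by rewrite /symm_mx/= linear0.
- apply/(dual_constraintP regular_zero) => Psi _ _ _ _.
  by rewrite /Rintegral; under eq_integral do rewrite !frob0r addr0; rewrite integral0.
- apply: (@ae_imp _ _ _ mu _ _ ae_h_bounds) => p /andP[ha _]; rewrite scaler0 addr0.
  split; first by rewrite /symm_mx/= tr_scalar_mx.
  move=> x; rewrite -/(bform _ _ _) bform_scalar mulr_ge0 ?frob_ge0//.
  exact: le_trans (ltW a0) ha.
Qed.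

Lemma itg_h_fst : itg (fun p : X => h p.1).
Proof. exact: (ae_le_itg measurable_h_fst (itg_cst mu b) ae_h_norm). Qed.

Lemma Rint_h_fst : \int[mu]_p h p.1 = Hfun T h 0 * fine (nu setT).
Proof.
have hE : \int[mT]_t h t = Hfun T h 0.
  rewrite /Hfun /Rintegral integral_lebesgue_oitv; last exact/measurable_EFinP.
  by congr fine; rewrite [RHS]integral_itv_bndoo//; exact/measurable_EFinP/measurable_funTS.
by rewrite -(Rint_fubini itg_h_fst) /= hE Rintegral_cst.
Qed.

Lemma Hfun_ge0 : 0 <= Hfun T h 0.
Proof.
apply: Rintegral_ge0 => t; rewrite /= in_itv/= => t0T.
have /andP[ha _] := h_bounds t0T; exact: le_trans (ltW a0) ha.
Qed.

(** The order F(z) <= M tested against the identity gives tr M >= tr F(z) = 2 K(z) + tr F(0) >= tr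
    F(0). *)
Lemma dual_objective_zero :
  ((Hfun T h 0 * fine (nu setT) * \tr (F 0) / 2)%:E <=
   dual_objective l T F L h v0 (fun=> 0%R) (fun=> 0%R))%E.
Proof.
apply/(dual_objective_ge _ regular_zero) => z M [oz /Lp_symm1P[_ iM] zM].
rewrite [leRHS](_ : _ = 0); last first.
  by rewrite /Rintegral; under eq_integral do rewrite !frob0r addr0; rewrite integral0.
rewrite subr_le0 -Rint_h_fst -mulrA mulrC -RintegralZl//; last exact: itg_h_fst.
apply: ae_le_Rint.
- by apply: itgZ; exact: itg_h_fst.
- exact: itg_h_tr.
apply: (@ae_imp _ _ _ mu _ _ (ae_and zM ae_h_bounds)) => p [[_ le] /andP[ha _]].
have := le _ Lambda1 psd1; rewrite frob_scalarr mul1r linearB/= subr_ge0 => H.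
have h0 : 0 <= h p.1 by exact: le_trans (ltW a0) ha.
rewrite mulrAC [_ * h _]mulrC ler_wpM2r ?invr_ge0// ler_wpM2l//.
by apply: le_trans H; rewrite (tr_Kfun (z p)) lerDr mulr_ge0// N_function_ge0.
Qed.

(** * Construction of a maximizer *)

Local Notation coord := (('I_n + 'I_N * 'I_N) * bool)%type.

(** [komlos] handles finite families of nonnegative scalar functions, so a pair (E, B) is
    represented by positive ([true]) and negative ([false]) parts of its entries. *)
Definition decode_rV (f : coord -> X -> R) (p : X) : 'rV[R]_n :=
  \row_j (f (inl j, true) p - f (inl j, false) p).
Definition decode_mx (f : coord -> X -> R) (p : X) : 'M[R]_N :=
  \matrix_(i, j) (f (inr (i, j), true) p - f (inr (i, j), false) p).
Definition encode (E : X -> 'rV[R]_n) (B : X -> 'M[R]_N) (i : coord) (p : X) : R :=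
  let x := match i.1 with inl j => E p ord0 j | inr q => B p q.1 q.2 end in
  Num.max 0 (if i.2 then x else - x).

Lemma maxr0_sub (x : R) : Num.max 0 x - Num.max 0 (- x) = x.
Proof. by have [x0|x0] := leP 0 x; have [y0|y0] := leP 0 (- x); lra. Qed.

Lemma encode_rVK E B : decode_rV (encode E B) = E.
Proof. by apply/funext => p; apply/rowP => j; rewrite mxE /encode/= maxr0_sub. Qed.

Lemma encode_mxK E B : decode_mx (encode E B) = B.
Proof. by apply/funext => p; apply/matrixP => i j; rewrite mxE /encode/= maxr0_sub. Qed.

(** Entries of E are dominated by K^*(E) + K(e_j) through Young's inequality, those of B by the
    uniform bound; both have integrals bounded over the superlevel set. *)
Lemma encode_bound (r : R) : exists m : R, forall E B, superlevel r E B ->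
  forall i, [/\ itg (encode E B i), (forall p, 0 <= encode E B i p) &
                \int[mu]_p encode E B i p <= m].
Proof.
have [D KD] := dual_objective_coercive r.
pose k j := \int[mu]_p K (delta_mx ord0 j : 'rV[R]_n).
have k0 j : 0 <= k j by apply: Rintegral_ge0 => p _; exact: N_function_ge0.
pose m := `|D| + \sum_j k j + \int[mu]_p `|Ce|.
have s0 : 0 <= \sum_j k j by apply: sumr_ge0.
have e0 : 0 <= \int[mu]_p `|Ce| by apply: Rintegral_ge0.
exists m => E B [adm robj] i.
have reg := admissible_regular adm; have [oE mB _] := reg.
have /(orlicz_legendre mu K_N K0 K_cont)[mE iE] := oE.
pose x p := match i.1 with inl j => E p ord0 j | inr q => B p q.1 q.2 end.
have mx : measurable_fun setT x.
  rewrite /x; case: i.1 => [j|q]; last exact: mB.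
  by have /measurable_fun_mxP := mE; apply.
have [g [ig gm xg]] : exists g, [/\ itg g, \int[mu]_p g p <= m & \forall p \ae mu, `|x p| <= g p].
  rewrite /x; case: i.1 => [j|q].
    exists (fun p => KL (E p) + K (delta_mx ord0 j)); split.
    - by apply: itgD => //; exact: itg_cst.
    - rewrite RintegralD//; last exact: itg_cst.
      have kj : k j <= \sum_j k j by rewrite (bigD1 j)//= lerDl; apply: sumr_ge0.
      apply: le_trans (lerD (le_trans (KD _ _ adm robj) (ler_norm D)) kj) _.
      by rewrite /m lerDl.
    - apply: aeW => p; have := young_norm K_N (delta_mx ord0 j) (E p).
      rewrite frob_rV (bigD1 j)//= mxE !eqxx mul1r big1 ?addr0 1?addrC// => q qj.
      by rewrite mxE (negPf qj) andbF mul0r.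
  exists (fun=> `|Ce|); split; first exact: itg_cst.
    by rewrite /m lerDr addr_ge0.
  apply: (@ae_imp _ _ _ mu _ _ (admissible_bounds adm)) => p [_ /(_ q.1 q.2) H].
  exact: le_trans H (ler_norm _).
have e0' p : 0 <= encode E B i p by rewrite le_max lexx.
have ex p : encode E B i p <= `|x p|.
  rewrite ge_max normr_ge0/=; case: i.2; first exact: ler_norm.
  by rewrite -normrN ler_norm.
have me : measurable_fun setT (encode E B i).
  apply: measurable_maxr; first exact: measurable_cst.
  by case: i.2 => //; exact: measurableT_comp mx.
have aeg : \forall p \ae mu, `|encode E B i p| <= g p.
  by apply: (@ae_imp _ _ _ mu _ _ xg) => p; apply: le_trans; rewrite ger0_norm.
have ie := ae_le_itg me ig aeg; split=> //.
apply: le_trans gm; apply: ae_le_Rint => //.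
by apply: (@ae_imp _ _ _ mu _ _ aeg) => p; rewrite ger0_norm.
Qed.

Lemma dual_maximizer : exists E B, dual_admissible l T F L h E B /\
  dual_objective l T F L h v0 E B = dual_value l T F L h v0.
Proof.
have dv0 : (dual_objective l T F L h v0 (fun=> 0%R) (fun=> 0%R) <= dual_value l T F L h v0)%E.
  by apply: ereal_sup_ubound; exists (fun=> 0), (fun=> 0); split=> //; exact: admissible_zero.
have := dual_value_lty; have := le_trans dual_objective_zero dv0.
have ubound E B : dual_admissible l T F L h E B ->
    (dual_objective l T F L h v0 E B <= dual_value l T F L h v0)%E.
  by move=> adm; apply: ereal_sup_ubound; exists E, B.
have approx (r : R) : (r%:E < dual_value l T F L h v0)%E -> exists E B, superlevel r E B.
  by move=> /ereal_sup_gt[_ [E [B [adm ->]]] /ltW rE]; exists E, B.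
(* The lower and upper bounds make the supremum a real number s. *)
move: dv0 ubound approx; case: dual_value => // s _ ubound approx _ _.
pose r_ k : R := s - k.+1%:R^-1.
have r_ge k : s - 1 <= r_ k by rewrite lerB// invf_le1 ?ltr0n// ler1n.
have r_lt k : r_ k < s by rewrite ltrBlDr ltrDl invr_gt0 ltr0n.
have r_nd k : r_ k <= r_ k.+1 by rewrite lerB// lef_pV2 ?posrE ?ltr0n// ler_nat.
have sup_le (r r' : R) E B : r <= r' -> superlevel r' E B -> superlevel r E B.
  by move=> rr' [adm r'E]; split=> //; apply: le_trans r'E; rewrite lee_fin.
have [m encm] := encode_bound (s - 1).
(* The condition is on the decoded pair: f need not be an encoding, since a midpoint of positive and
   negative parts is in general not the decomposition of the midpoint. Decoding is linear, so this
   set is stable under midpoints. *)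
pose C k := [set f : coord -> X -> R | superlevel (r_ k) (decode_rV f) (decode_mx f) /\
  forall i, [/\ itg (f i), (forall p, 0 <= f i p) & \int[mu]_p f i p <= m]].
have [g [G [gC mG gG]]] : exists (g : nat -> coord -> X -> R) (G : coord -> X -> R),
    [/\ (forall k, C k (g k)), (forall i, measurable_fun setT (G i)) &
     \forall x \ae mu, forall i, g k i x @[k --> \oo] --> G i x].
  apply: (komlos (M := m)).
  - by move=> k f [supf fm]; split=> //; exact: sup_le (r_nd k) supf.
  - move=> k; have [|E [B supEB]] := approx (r_ k); first by rewrite lte_fin.
    exists (encode E B); split; first by rewrite encode_rVK encode_mxK.
    by apply: encm; exact: sup_le (r_ge k) supEB.
  - move=> k f f' [supf fm] [supf' fm']; split.
      have := superlevel_midpoint supf supf'; congr superlevel; apply/funext => p.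
        by apply/rowP => j; rewrite !mxE; field.
      by apply/matrixP => i j; rewrite !mxE; field.
    move=> i; have [if1 f0 fm1] := fm i; have [if2 f0' fm2] := fm' i.
    have -> : (fun x => (f i x + f' i x) / 2) = fun x => 2^-1 * (f i x + f' i x).
      by apply/funext => x; rewrite mulrC.
    split; first by apply: itgZ; exact: itgD.
      by move=> p; rewrite mulr_ge0 ?invr_ge0// addr_ge0.
    by rewrite RintegralZl//; [rewrite RintegralD//; lra|exact: itgD].
  - by move=> k f [_ fm].
(* The limit of the symmetric matrices is symmetric only almost everywhere, whereas [Lp_symm] asks
   for symmetry at every point; hence the symmetrization. *)
pose E := decode_rV G; pose B p := 2^-1 *: (decode_mx G p + (decode_mx G p)^T).
have mD i j : measurable_fun setT (fun p => decode_mx G p i j).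
  by under eq_fun do rewrite mxE; apply: measurable_funB; exact: mG.
have [D KD] := dual_objective_coercive (s - 1).
suff [adm sE] : superlevel s E B.
  by exists E, B; split=> //; apply/eqP; rewrite eq_le ubound.
apply: (@superlevel_closed s r_ D (fun k => decode_rV (g k)) (fun k => decode_mx (g k))).
- by move=> k; have [] := gC k.
- rewrite -[X in _ --> X]subr0; apply: cvgB; first exact: cvg_cst.
  exact: cvg_harmonic.
- by move=> k; have [/(sup_le _ _ _ _ (r_ge k))[adm sE] _] := gC k; exact: KD sE.
- apply/measurable_fun_mxP => i j; under eq_fun do rewrite mxE.
  by apply: measurable_funB; exact: mG.
- move=> i j; under eq_fun do rewrite !mxE.
  by apply: measurable_funM; [exact: measurable_cst|apply: measurable_funD; apply: measurable_funB; exact: mG].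
- by move=> p; rewrite /symm_mx/= linearZ/= linearD/= trmxK addrC.
apply: (@ae_imp _ _ _ mu _ _ gG) => p gGp.
have cD i j : decode_mx (g k) p i j @[k --> \oo] --> decode_mx G p i j.
  rewrite mxE; under eq_cvg do rewrite mxE.
  by apply: cvgB; exact: gGp.
split=> [j|i j].
  rewrite mxE; under eq_cvg do rewrite mxE.
  by apply: cvgB; exact: gGp.
have symg k : decode_mx (g k) p i j = 2^-1 * (decode_mx (g k) p i j + decode_mx (g k) p j i).
  have [[[_ [Bs _] _ _] _] _] := gC k.
  by have /matrixP/(_ i j) := Bs p; rewrite [LHS]mxE => ->; field.
have BE : B p i j = 2^-1 * (decode_mx G p i j + decode_mx G p j i).
  by rewrite /B; move: (decode_mx G p) => A; rewrite !mxE.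
rewrite (funext symg : (fun k => decode_mx (g k) p i j) = _) BE.
by apply: cvgM; [exact: cvg_cst|apply: cvgD; exact: cD].
Qed.

End dual_problem_theory.

Theorem theorem5p4 (R : realType) (d n N : nat)
  (hd : (0 < d)%N) (hn : (0 < n)%N) (hN : (0 < N)%N)
  (l : R) (hl : 0 < l) (T : R) (hT : 0 < T)
  (F : 'rV[R]_n -> 'M[R]_N) (L : diff_operator R d n N)
  (hFsymm : forall v, symm_mx (F v))
  (hFC2 : class_C 2 F)
  (hentropy : entropy_assumption F)
  (hconvex : Lambda_convexity l F L)
  (horder : Lambda_order_assumption l F L)
  (hcons : conservativity l F L)
  (h : R -> R) (hmeas : measurable_fun setT h)
  (hbounds : exists a b : R,
     0 < a /\ forall t, 0 <= t <= T -> a <= h t <= b)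
  (htrace : strong_trace_condition l F L)
  (v0 : 'rV[R]_d -> 'rV[R]_n)
  (hv0 : orlicz (torus_measure d l) (Kfun F) v0) :
  (exists E B, dual_admissible l T F L h E B /\
     dual_objective l T F L h v0 E B = dual_value l T F L h v0) /\
  0 <= Hfun T h 0 * fine (torus_measure d l setT) * \tr (F 0) / 2 /\
  ((Hfun T h 0 * fine (torus_measure d l setT) * \tr (F 0) / 2)%:E
     <= dual_value l T F L h v0)%E /\
  (dual_value l T F L h v0 < +oo)%E.
Proof.
have [K_strict K_N K_D2 KL_D2] := hentropy.
have F_cont : continuous F by have [] := hFC2.
have [F_cone _] := horder.
have [a [b [a0 h_bounds]]] := hbounds.
have [c trace] := htrace.
have zero_ge := dual_objective_zero hl hT L F_cont K_strict K_N K_D2 hmeas a0 h_bounds hv0.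
split; last split; last split.
- exact: (dual_maximizer hl hT hFsymm F_cont K_strict K_N K_D2 KL_D2 F_cone hmeas a0 h_bounds trace hv0).
- rewrite divr_ge0// mulr_ge0//; last exact: tr_F_ge0 F_cone 0.
  by apply: mulr_ge0; [exact: (Hfun_ge0 a0 h_bounds)|rewrite fine_ge0].
- apply: le_trans zero_ge _; apply: ereal_sup_ubound; exists (fun=> 0), (fun=> 0); split=> //.
  exact: (admissible_zero hl hT L F_cont K_N a0 h_bounds).
- exact: (dual_value_lty hl hT hFsymm F_cont K_strict K_N K_D2 KL_D2 F_cone hmeas a0 h_bounds trace hv0).
Qed.
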